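(* Let $c\ge 4$ be an integer, and let $T$ be a $(c-1)$-regular $c$-partite tournament in which every partite set has cardinality two. Then every arc of $T$ belongs to at least $2c-3$ cycles of pairwise distinct lengths.
   Context: A $c$-partite tournament is an orientation of a complete $c$-partite graph (finite, with $c$ nonempty partite sets): between any two vertices in different partite sets there is exactly one arc, and there are no arcs within a partite set. A digraph is $r$-regular if $d^+(v)=d^-(v)=r$ for every vertex $v$. Cycles are directed and simple; the length of a cycle is its number of arcs. *)

(* Defs.v *)
From mathcomp Require Import all_boot.

Set Implicit Arguments.
Unset Strict Implicit.
Unset Printing Implicit Defensive.

(* [partition P setT] already forces the members of P to be nonempty.  The
   last clause also excludes loops. *)
Definition multipartite_tournament (V : finType) (c : nat)
    (P : {set {set V}}) (arc : rel V) : Prop :=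
  [/\ partition P [set: V],
      #|P| = c,
      forall u v, pblock P u != pblock P v -> arc u v (+) arc v u
    & forall u v, pblock P u = pblock P v -> ~~ arc u v].

Definition outdegree (V : finType) (arc : rel V) (v : V) : nat :=
  #|[set w | arc v w]|.

Definition indegree (V : finType) (arc : rel V) (v : V) : nat :=
  #|[set w | arc w v]|.

Definition regular_digraph (V : finType) (r : nat) (arc : rel V) : Prop :=
  forall v, outdegree arc v = r /\ indegree arc v = r.

(* A cycle is given by its cyclic sequence s of distinct vertices, so that its
   number of arcs is [size s].  As [next s u] is u itself when u is not in s,
   membership of u has to be required. *)
Definition cycle_through (V : finType) (arc : rel V) (u v : V) (s : seq V)
    : Prop :=
  [/\ ucycle arc s, u \in s & next s u = v].

(* Main.v *)
Require Import Defs.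
From mathcomp Require Import all_boot zify.

(** Put r = c - 1 and contract the arc from u to v to one vertex z, which keeps
    the out-arcs of v and the in-arcs of u. The cycles of length l + 1 through
    that arc are the cycles of length l through z in the resulting digraph e
    on 2r + 1 vertices. Let A be the set of the r out-neighbours of z and B
    that of its r in-neighbours; call a vertex near if it lies in A or B and
    far otherwise. Two vertices other than z are joined by exactly one arc,
    unless they are partners, here called mates; the partners p of u and q of
    v have lost theirs. The record [contracted] collects what is used of e. It
    is preserved by reversing all arcs and exchanging p and q, so each
    argument also yields its dual.

    There are two tools. By regularity, for x other than z, at most r + 1
    vertices t besides x are such that x has an arc to t, or t is not z and
    has no arc to x; and at most r if moreover x is not in A or the mate of x
    is not among the t ([dominates_bound]). And if e has no cycle of length l
    + 1 through z, each rerouting of an l-cycle C that would gain a vertex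
    shows that some arc is absent ([splice]). Absent arcs make sets of such t,
    and the contradictions below come from sets that are too large.

    Let r >= 4. Lengths 3 and 4 occur ([no_cycle3_false], [no_cycle4_false]).
    The step from l to l + 1 ([cycle_step]) starts from an l-cycle C through z
    with as few far vertices as possible and supposes that z is on no (l +
    1)-cycle.

    Then every near vertex is on C ([near_inside]). A near vertex w off C has
    its mate s on C ([out_mate_on_cycle], [in_mate_on_cycle]); as w cannot be
    inserted into C, the rest of C splits into a stretch beaten by w followed
    by one that beats w, up to the special role of z. So w can take the place
    of s, and minimality makes s near too. Comparing the two vertices shows
    that they have the same stretches ([outside_twins]), and rerouting C
    through both of them leaves room for no further vertices ([twins_false],
    [four_cycle_twins_false], [both_twins_false]).

    If all vertices are near, C is now spanning, so all lengths up to 2r + 1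
    occur. Otherwise only far vertices are off C. If t is less than their
    number, a path of t of them cannot replace t - 1 vertices that are
    consecutive on C once z is removed ([gap]). This includes a gap that meets
    z, for A and B are so large that elsewhere a vertex of B directly precedes
    one of A, and z can be put there. Hence the out-neighbours on C of a
    vertex w off C form an interval that starts right after its mate, and for
    an arc from w to x the interval of x is the one of w moved forward by a
    bounded amount ([run_shift]). Going round a triangle off C, the shifts add
    up to a positive multiple of l - 1 that is too small
    ([others_triangle_false]), except in a configuration on five vertices of C
    that is excluded directly ([five_configuration_false]); without triangles
    a source and a sink off C would have too many neighbours on C
    ([others_ge3_false]). This handles three or more vertices off C. With just
    two, the same argument works when length l + 2 is absent as well
    ([two_others_false]).

    Counting: if all vertices are near, lengths 3, ..., 2r + 1 occur at z. If
    not, A and B meet, which gives length 2, and 3, ..., 2r - 1 occur together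
    with one of 2r and 2r + 1. Both ways these are 2r - 1 = 2c - 3 lengths.
    For r = 3 there are eight vertices, and a search through all orientations
    with the right degrees finds all lengths from 4 to 8 ([search8]). *)

Set Implicit Arguments.
Unset Strict Implicit.
Unset Printing Implicit Defensive.

(** * The contracted digraph *)

(** Contraction to the vertex z of an arc of an r-regular multipartite
    tournament with partite sets of size two.  The relation mt joins the
    partners that survive; those of the end points of the arc are p and q.
    The boolean summand in a degree condition stands for the arc between x
    and an end point that the contraction drops; it is written with the arcs
    of z so that only e occurs. *)
Record contracted (X : finType) (e : rel X) (z p q : X) (mt : rel X) (r : nat)
    : Prop := Contracted {
  c_irr : forall x, ~~ e x x;
  c_mtC : forall x y, mt x y = mt y x;
  c_mtxx : forall x, ~~ mt x x;
  c_mt_inj : forall x y y', mt x y -> mt x y' -> y = y';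
  c_mtz : forall x, ~~ mt z x;
  c_mtp : forall x, ~~ mt p x;
  c_mtq : forall x, ~~ mt q x;
  c_adj : forall x y, x != z -> y != z -> x != y -> ~~ mt x y ->
            e x y (+) e y x;
  c_mt_e : forall x y, mt x y -> ~~ e x y;
  c_pz : p != z;
  c_qz : q != z;
  c_pq : p != q;
  c_epz : ~~ e p z;
  c_ezq : ~~ e z q;
  c_out : forall x, x != z ->
            #|[set y | e x y]| + (~~ e z x && (x != q)) = r;
  c_in : forall x, x != z ->
            #|[set y | e y x]| + (~~ e x z && (x != p)) = r;
  c_outz : #|[set y | e z y]| = r;
  c_inz : #|[set y | e y z]| = r;
  c_card : #|X| = r.*2.+1
}.

Lemma contracted_dual (X : finType) (e : rel X) z p q mt r :
  contracted e z p q mt r -> contracted (fun x y => e y x) z q p mt r.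
Proof.
case=> H1 H2 H3 H4 H5 H6 H7 H8 H9 H10 H11 H12 H13 H14 H15 H16 H17 H18 H19.
by split=> //; [move=> *; rewrite addbC; apply: H8
  | move=> x y; rewrite H2; apply: H9 | rewrite eq_sym].
Qed.

Definition no_cycle (X : finType) (e : rel X) (z : X) (k : nat) :=
  forall D, ucycle e D -> z \in D -> size D != k.

Lemma no_cycle_dual (X : finType) (e : rel X) z k :
  no_cycle e z k -> no_cycle (fun x y => e y x) z k.
Proof.
move=> H D /andP[cD uD] zD; rewrite -size_rev; apply: H.
  by rewrite /ucycle rev_cycle cD rev_uniq.
by rewrite mem_rev.
Qed.

Lemma ucycle_dual (X : finType) (e : rel X) D :
  ucycle e D -> ucycle (fun x y => e y x) (rev D).
Proof. by move=> /andP[cD uD]; rewrite /ucycle rev_cycle cD rev_uniq. Qed.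

Ltac split_ands :=
  repeat match goal with
  | H : is_true (_ && _) |- _ => case/andP: H => ? ?
  end.
Ltac split_goal := repeat match goal with
  | |- is_true (_ && _) => apply/andP; split
  end.

Section Degrees.
Variables (X : finType) (e : rel X) (z p q : X) (mt : rel X) (r : nat).
Hypothesis H : contracted e z p q mt r.

(** The form in which all reroutings are used: W is the list of vertices gained
    by the cycle C, F the list of those lost, and D the new cycle. *)
Lemma splice k (C W D F : seq X) :
  no_cycle e z k -> uniq (W ++ C) -> z \in C ->
  perm_eq (D ++ F) (W ++ C) -> cycle e D -> z \notin F ->
  k + size F = size W + size C -> False.
Proof.
move=> NE uWC zC pe cD zF sW.
have uD : uniq D by move: uWC; rewrite -(perm_uniq pe) cat_uniq => /andP[].
have zD : z \in D.
  have : z \in D ++ F by rewrite (perm_mem pe) mem_cat zC orbT.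
  by rewrite mem_cat (negPf zF) orbF.
have : ucycle e D by rewrite /ucycle cD.
move=> /NE /(_ zD) /eqP; apply.
by apply/eqP; rewrite -(eqn_add2r (size F)) -size_cat (perm_size pe) size_cat sW.
Qed.

Lemma splice1 k (C W D F : seq X) :
  no_cycle e z k.+1 -> uniq (W ++ C) -> size C = k -> z \in C ->
  perm_eq (D ++ F) (W ++ C) -> cycle e D -> z \notin F ->
  size W = (size F).+1 -> False.
Proof.
move=> NE uWC sC zC pe cD zF sW; apply: (splice NE uWC zC pe cD zF).
by rewrite sW sC addSnnS addnC.
Qed.

Lemma arc_of_no_arc x y : x != z -> y != z -> x != y -> ~~ mt x y -> ~~ e x y -> e y x.
Proof. by move=> xz yz xy nm /negPf nxy; have := c_adj H xz yz xy nm; rewrite nxy. Qed.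

(** Only z can be joined to another vertex in both directions, as its out-arcs
    and in-arcs come from different vertices. *)
Lemma arc_asym x y : x != z -> y != z -> e x y -> ~~ e y x.
Proof.
move=> xz yz exy; have := c_adj H xz yz; rewrite exy /=; apply.
  by apply: contraTneq exy => ->; apply: c_irr H _.
by apply: contraTN exy; apply: c_mt_e H _ _.
Qed.

(** All t in S but the mate of x receive an arc from x, and S contains the mate
    at most once.  If the mate does occur, x is not q, so that the
    out-degree of x is r - 1 when x is not an out-neighbour of z; hence the
    exact bonus. *)
Lemma out_count x (S : seq X) : x != z -> uniq S ->
  {in S, forall t, t != x /\ (e x t \/ (t != z /\ ~~ e t x))} ->
  size S <= r + (e z x && has (mt x) S).
Proof.
move=> xz uS HS.
pose S' := [seq t <- S | ~~ mt x t].
have sub : {subset S' <= [set y | e x y]}.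
  move=> t; rewrite mem_filter inE => /andP[nm tS].
  have [tx [//|[tz net]]] := HS t tS.
  by apply: arc_of_no_arc net => //; rewrite (c_mtC H).
have le1 : size S' <= #|[set y | e x y]|.
  rewrite cardE; apply: uniq_leq_size; first exact: filter_uniq.
  by move=> t /sub; rewrite mem_enum.
have le2 : count (mt x) S <= has (mt x) S.
  rewrite -size_filter has_filter.
  case E: [seq _ <- _ | _] => [|a [|b l]] //=.
  have := filter_uniq (mt x) uS; rewrite E /= inE negb_or => /andP[/andP[/eqP ab _] _].
  have ha : a \in [seq t <- S | mt x t] by rewrite E inE eqxx.
  have hb : b \in [seq t <- S | mt x t] by rewrite E !inE eqxx orbT.
  move: ha hb; rewrite !mem_filter => /andP[ha _] /andP[hb _].
  by case: ab; apply: (c_mt_inj H) hb.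
have eqS : size S = count (mt x) S + size S'.
  by rewrite size_filter count_predC.
have := c_out H xz.
case ez: (e z x) => /=; first by lia.
case hm: (has _ _) le2 => le2; last by lia.
case: eqP => [xq|_] /=; last by lia.
by case/hasP: hm => t _; rewrite xq (negPf (c_mtq H _)).
Qed.

End Degrees.

(** * Neighbours off a cycle and too large neighbourhoods *)

Ltac cycle_simpl := rewrite ?/cycle ?cat_cons ?cat_path ?rcons_cat ?rcons_cons
  ?cat_path /= ?rcons_path ?cat_path ?rcons_path ?last_cat ?last_rcons ?last_cons
  ?all_cat ?all_rcons /=.
(** Both sides are flattened into arcs between consecutive list ends, after
    which the arcs of the new cycle are among those of the hypotheses. *)
Ltac solve_cycle := repeat (progress cycle_simpl); intros; split_ands; split_goal;
  try assumption; try done.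
(** Permutations of concatenations, by comparing counts. *)
Ltac solve_perm := apply/permP => ?;
  rewrite /= ?count_cat /= -?cats1 ?count_cat /= ?count_cat /= ?count_cat /= ?count_cat /=;
  clear; lia.

Ltac solve_sizes := clear; repeat match goal with
  | |- context [size ?l] => let n := fresh "n" in move: (size l) => n end; lia.

Lemma uniq_perm_cat (T : eqType) (S F E : seq T) :
  uniq E -> perm_eq (S ++ F) E -> uniq S.
Proof. by move=> uE pe; move: uE; rewrite -(perm_uniq pe) cat_uniq => /andP[]. Qed.

Lemma mem_rcons_ex (T : eqType) (x : T) (s : seq T) : x \in s ->
  exists s' l, s = rcons s' l.
Proof. by case/lastP: s => // s l _; exists s, l. Qed.

Lemma mem_successor (T : eqType) (P : seq T) l t : t \in P ->
  exists A b B, rcons P l = A ++ t :: b :: B.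
Proof.
case/splitPr => A B; rewrite rcons_cat rcons_cons.
by case E: (rcons B l) => [|b B']; [case: B E | exists A, b, B'].
Qed.

Definition out_outside (X : finType) (e : rel X) (w : X) (C : seq X) :=
  [seq y <- enum X | (y \notin w :: C) && e w y].
Definition in_outside (X : finType) (e : rel X) (w : X) (C : seq X) :=
  out_outside (fun x y => e y x) w C.

Section OutsideNeighbours.
Variables (X : finType) (e : rel X).
Lemma mem_out_outside w C y : (y \in out_outside e w C) = (y \notin w :: C) && e w y.
Proof. by rewrite mem_filter mem_enum andbT. Qed.
Lemma mem_in_outside w C y : (y \in in_outside e w C) = (y \notin w :: C) && e y w.
Proof. by rewrite mem_filter mem_enum andbT. Qed.

Lemma uniq_out_outside w C : uniq (w :: C) -> uniq (out_outside e w C ++ w :: C).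
Proof.
move=> u; rewrite cat_uniq; apply/and3P; split=> //.
  exact: filter_uniq (enum_uniq _).
by apply/hasPn => y yC; apply/negP; rewrite mem_out_outside yC.
Qed.

Lemma size_out_outside w C : ~~ e w w -> uniq (w :: C) ->
  size (out_outside e w C) + count (e w) C = #|[set y | e w y]|.
Proof.
move=> nww u.
have -> : count (e w) C = count (e w) (w :: C) by rewrite /= (negPf nww).
rewrite -size_filter -size_cat cardE.
apply/perm_size/uniq_perm; last 2 first.
- exact: enum_uniq.
- move=> y; rewrite mem_cat mem_out_outside mem_filter mem_enum in_set.
  by case: (y \in w :: C); case: (e w y).
rewrite cat_uniq; apply/and3P; split.
- exact: filter_uniq (enum_uniq _).
2: exact: filter_uniq.
apply/hasPn => y; rewrite mem_filter => /andP[_ yC].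
by apply/negP; rewrite mem_out_outside yC.
Qed.
End OutsideNeighbours.

Lemma size_in_outside (X : finType) (e : rel X) w C : ~~ e w w -> uniq (w :: C) ->
  size (in_outside e w C) + count (e^~ w) C = #|[set y | e y w]|.
Proof. exact: size_out_outside. Qed.

(** An absent arc from t counts as an arc from x: this is how the splicing
    arguments supply out-neighbours, and it fails to be one only at the mate
    of x. *)
Definition dominates (X : finType) (e : rel X) (z x : X) (S : seq X) :=
  all (fun t => e x t || (t != z) && ~~ e t x) S.

Lemma dominates_bound (X : finType) (e : rel X) z p q mt r :
  contracted e z p q mt r -> forall x (S : seq X), x != z -> uniq (x :: S) ->
  dominates e z x S -> size S <= r + (e z x && has (mt x) S).
Proof.
move=> H x S xz /= /andP[xS uS] /allP nS; apply: (out_count H) => // t tS.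
split; first by apply: contraNneq xS => <-.
by case/orP: (nS t tS) => [|/andP[]]; auto.
Qed.

Lemma dominated_bound (X : finType) (e : rel X) z p q mt r :
  contracted e z p q mt r -> forall x (S : seq X), x != z -> uniq (x :: S) ->
  dominates (fun x y => e y x) z x S -> size S <= r + (e x z && has (mt x) S).
Proof. by move=> H; apply: (dominates_bound (contracted_dual H)). Qed.

Section Overfull.
Variables (X : finType) (e : rel X) (z p q : X) (mt : rel X) (r : nat).
Hypothesis H : contracted e z p q mt r.
Lemma out_overfull x S : x != z -> uniq (x :: S) -> dominates e z x S ->
  r.+1 < size S -> False.
Proof. by move=> xz uS nS; have := dominates_bound H xz uS nS; case: (_ && _) => /=; lia. Qed.
Lemma out_overfull_notA x S : x != z -> ~~ e z x -> uniq (x :: S) -> dominates e z x S ->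
  r < size S -> False.
Proof. by move=> xz /negPf zx uS nS; have := dominates_bound H xz uS nS; rewrite zx /=;
  lia. Qed.
Lemma in_overfull x S : x != z -> uniq (x :: S) -> dominates (fun x y => e y x) z x S ->
  r.+1 < size S -> False.
Proof. by move=> xz uS nS; have := dominated_bound H xz uS nS; case: (_ && _) => /=; lia. Qed.
Lemma in_overfull_notB x S : x != z -> ~~ e x z -> uniq (x :: S) ->
  dominates (fun x y => e y x) z x S -> r < size S -> False.
Proof. by move=> xz /negPf zx uS nS; have := dominated_bound H xz uS nS; rewrite zx /=;
  lia. Qed.
End Overfull.

Section RunSizes.
Variables (X : finType) (e : rel X) (z p q : X) (mt : rel X) (r : nat).
Hypothesis H : contracted e z p q mt r.
Variables (s w : X) (L U : seq X).
Notation c := (L ++ U).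
Hypothesis HC : cycle e (s :: c).
Hypothesis uC : uniq (w :: s :: c).
Hypothesis NE : no_cycle e z (size c).+2.
Hypothesis zU : z \in U.
Hypothesis mws : mt w s.
Hypothesis nwz : ~~ e w z.
Hypothesis wL : all (e w) L.
Hypothesis Uw : all (e^~ w) U.

Let Wout := out_outside e w (s :: c).
Let Win := in_outside e w (s :: c).

Lemma run_zw : e z w. Proof. exact: (allP Uw). Qed.
Lemma run_wz : w != z.
Proof. by apply: contraTneq run_zw => ->; apply: c_irr H _. Qed.
Lemma run_sz : s != z.
Proof. by apply: contraTneq mws => ->; rewrite (c_mtC H) (negPf (c_mtz H _)). Qed.
Lemma run_zL : z \notin L.
Proof.
move: uC; rewrite /= cat_uniq => /and5P[_ _ _ /hasPn /(_ z zU)]; done.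
Qed.
Lemma run_Lz x : x \in L -> x != z.
Proof. by move=> xL; apply: contraNneq run_zL => <-. Qed.

Lemma size_out_run : size Wout + size L = r.
Proof.
have := c_out H run_wz; rewrite run_zw /= addn0 => <-.
rewrite -(size_out_outside (c_irr H w) uC) /= (negPf (c_mt_e H mws)) add0n count_cat.
move: wL; rewrite all_count => /eqP ->.
suff /eqP -> : count (e w) U == 0 by rewrite addn0.
rewrite -leqn0 leqNgt -has_count; apply/hasPn => y yU.
have [->//|yz] := eqVneq y z.
by apply: arc_asym H _ _ _ _ _ => //; [exact: run_wz | apply: (allP Uw)].
Qed.

Lemma size_in_run : (size Win + size U).+1 = r.
Proof.
have wp : w != p.
  by apply: contraTneq mws => ->; exact: (c_mtp H).
have := c_in H run_wz; rewrite nwz wp /= addn1 => <-; congr _.+1.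
rewrite -(size_in_outside (c_irr H w) uC) /=.
have -> : e s w = false by apply/negbTE/(c_mt_e H); rewrite (c_mtC H).
rewrite add0n count_cat.
move: Uw; rewrite all_count => /eqP ->.
suff /eqP -> : count (e^~ w) L == 0 by [].
rewrite -leqn0 leqNgt -has_count; apply/hasPn => y yU.
by apply: arc_asym H _ _ _ _ _; [exact: run_wz | exact: run_Lz | apply: (allP wL)].
Qed.

Lemma uniq_out_run : uniq (Wout ++ w :: s :: c). Proof. exact: uniq_out_outside. Qed.
Lemma out_runP x : x \in Wout -> [/\ uniq (x :: w :: s :: c), e w x & x != z].
Proof.
rewrite mem_out_outside => /andP[xC wx]; split=> //.
  by rewrite cons_uniq xC.
apply: contraNneq xC => ->; rewrite !inE mem_cat zU !orbT //.
Qed.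
Lemma in_runP y : y \in Win -> [/\ uniq (y :: w :: s :: c), e y w & y != z].
Proof.
rewrite mem_in_outside => /andP[xC wx]; split=> //.
  by rewrite cons_uniq xC.
apply: contraNneq xC => ->; rewrite !inE mem_cat zU !orbT //.
Qed.

End RunSizes.

(** * Two mates with the same out-run and in-run *)

Section Twins.
Variables (X : finType) (e : rel X) (z p q : X) (mt : rel X) (r : nat).
Hypothesis H : contracted e z p q mt r.
Variables (s w : X) (L U : seq X).
Notation c := (L ++ U).
Hypothesis HC : cycle e (s :: c).
Hypothesis uC : uniq (w :: s :: c).
Hypothesis NE : no_cycle e z (size c).+2.
Hypothesis zU : z \in U.
Hypothesis mws : mt w s.
Hypothesis nwz : ~~ e w z.
Hypothesis wL : all (e w) L.
Hypothesis Uw : all (e^~ w) U.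
Hypothesis nsz : ~~ e s z.
Hypothesis sL : all (e s) L.
Hypothesis Us : all (e^~ s) U.

Notation Wout := (out_outside e w (s :: c)).
Notation Win := (in_outside e w (s :: c)).

(** In the lemmas that follow, the witness D is the cycle that the excluded arc
    would close, and F is what it leaves out of the old one. *)
Lemma twin_splice (D F W : seq X) : uniq (W ++ s :: c) ->
  perm_eq (D ++ F) (W ++ s :: c) -> cycle e D -> z \notin F ->
  size W = (size F).+1 -> False.
Proof.
move=> uW pe cD zF sW; apply: (@splice1 X e z _ (s :: c) W D F NE) => //.
by rewrite inE mem_cat zU !orbT.
Qed.

(** The cycle jumps from a to d, returns from the end of U through s to the rest
    of L, and comes back through w, which beats L and is beaten by U. *)
Lemma twin_cross P a b R Q d B : L = P ++ a :: b :: R -> U = Q ++ d :: B ->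
  Q != [::] -> ~~ e a d.
Proof.
move=> EL EU Q0; apply/negP => ad.
apply: (@twin_splice (P ++ a :: d :: B ++ s :: b :: R ++ Q ++ [:: w]) [::] [:: w]) => //.
  by rewrite EL EU; solve_perm.
move: HC wL Uw sL; rewrite EL EU.
by case: P {EL} => [|h P]; case/lastP: Q {EU} Q0 => // Q u _; solve_cycle.
Qed.

Lemma twin_sz : s != z. Proof. exact: (run_sz H mws). Qed.
Lemma twin_wz : w != z. Proof. exact: (run_wz H zU Uw). Qed.
Lemma twin_inP y : y \in Win -> [/\ uniq ([:: y; w] ++ s :: c), e y w, y != z & e y w].
Proof. by case/(in_runP uC zU) => u yw yz. Qed.
Lemma twin_outP x : x \in Wout -> [/\ uniq ([:: x; w] ++ s :: c), e w x, x != z & e w x].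
Proof. by case/(out_runP uC zU) => u yw yz. Qed.

Lemma notin_head h R : L = h :: R -> z \notin [:: h].
Proof. by move=> EL; rewrite inE eq_sym; apply: (run_Lz uC zU); rewrite EL inE eqxx. Qed.

Lemma no_arc_last_in l U' y : L != [::] -> U = rcons U' l -> y \in Win -> ~~ e l y.
Proof.
move=> L0 EU /twin_inP[uy yw yz _]; apply/negP => ly.
apply: (twin_splice (D := c ++ [:: y; w]) (F := [:: s]) uy) => //.
- by solve_perm.
- move: HC wL Uw sL; rewrite EU.
  by case: L L0 => [|h P] // _; solve_cycle.
- by rewrite inE eq_sym twin_sz.
Qed.

Lemma no_arc_s_in c1 c2 R y : L = c1 :: c2 :: R -> y \in Win -> ~~ e s y.
Proof.
move=> EL /twin_inP[uy yw yz _]; apply/negP => ly.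
apply: (twin_splice (D := s :: y :: w :: c2 :: R ++ U) (F := [:: c1]) uy) => //.
- by rewrite EL; solve_perm.
- by move: HC wL; rewrite EL; solve_cycle.
- exact: notin_head EL.
Qed.

Lemma no_arc_inner_in h P a b R y : L = h :: P ++ a :: b :: R -> y \in Win -> ~~ e a y.
Proof.
move=> EL /twin_inP[uy yw yz _]; apply/negP => ly.
apply: (twin_splice (D := s :: P ++ a :: y :: w :: b :: R ++ U) (F := [:: h]) uy) => //.
- by rewrite EL; solve_perm.
- by move: HC wL sL; rewrite EL; case: P {EL} => [|h' P]; solve_cycle.
- exact: notin_head EL.
Qed.

Lemma no_arc_head_in3 c1 c2 c3 R y : L = c1 :: c2 :: c3 :: R -> y \in Win -> ~~ e c1 y.
Proof.
move=> EL /twin_inP[uy yw yz _]; apply/negP => ly.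
apply: (twin_splice (D := s :: c1 :: y :: w :: c3 :: R ++ U) (F := [:: c2]) uy) => //.
- by rewrite EL; solve_perm.
- by move: HC wL; rewrite EL; solve_cycle.
- by rewrite inE eq_sym; apply: (run_Lz uC zU); rewrite EL !inE eqxx orbT.
Qed.

Lemma no_arc_out_head c1 R x : L = c1 :: R -> x \in Wout -> ~~ e x c1.
Proof.
move=> EL /twin_outP[uy yw yz _]; apply/negP => ly.
apply: (twin_splice (D := c ++ [:: w; x]) (F := [:: s]) uy) => //.
- by solve_perm.
- move: HC wL Uw; rewrite EL.
  by case/lastP: U zU => [|U' l] // _; solve_cycle.
- by rewrite inE eq_sym twin_sz.
Qed.

Lemma no_arc_out_s c1 c2 R x : L = c1 :: c2 :: R -> x \in Wout -> ~~ e x s.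
Proof.
move=> EL /twin_outP[uy yw yz _]; apply/negP => ly.
apply: (twin_splice (D := s :: c2 :: R ++ U ++ [:: w; x]) (F := [:: c1]) uy) => //.
- by rewrite EL; solve_perm.
- move: HC wL Uw sL; rewrite EL.
  by case/lastP: U zU => [|U' l] // _; solve_cycle.
- exact: notin_head EL.
Qed.

Lemma no_arc_out_inrun c1 c2 R u Q d B x : L = c1 :: c2 :: R -> U = u :: Q ++ d :: B ->
  x \in Wout -> ~~ e x d.
Proof.
move=> EL EU /twin_outP[uy yw yz _]; apply/negP => ly.
apply: (twin_splice (D := s :: c2 :: R ++ u :: Q ++ w :: x :: d :: B) (F := [:: c1]) uy) => //.
- by rewrite EL EU; solve_perm.
- move: HC wL Uw sL; rewrite EL EU.
  by case/lastP: Q {EU} => [|Q l]; solve_cycle.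
- exact: notin_head EL.
Qed.

(** The arc from s is excluded, and s has no mate but w. *)
Lemma in_beats_s c1 c2 R y : L = c1 :: c2 :: R -> y \in Win -> e y s.
Proof.
move=> EL yU; have ns := no_arc_s_in EL yU.
case/twin_inP: yU => uy yw yz _.
apply: (arc_of_no_arc H twin_sz yz) => //.
  by apply: contraTneq uy => <-; rewrite /= !inE eqxx orbT.
apply/negP => msy; move: mws; rewrite (c_mtC H) => msw.
by move: uy; rewrite /= inE (c_mt_inj H msy msw) eqxx.
Qed.

Lemma no_arc_out_in3 c1 c2 c3 R x y : L = c1 :: c2 :: c3 :: R -> x \in Wout -> y \in Win ->
  ~~ e x y.
Proof.
move=> EL xL yU; apply/negP => xy.
have ys' := in_beats_s EL yU.
case/twin_inP: yU => uy yw yz _.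
case/twin_outP: xL => ux wx xz _.
apply: (twin_splice (D := s :: c3 :: R ++ U ++ [:: w; x; y]) (F := [:: c1;
  c2]) (W := [:: y, x & [:: w]])) => //.
- move: uy ux; rewrite /= !inE !negb_or => /and3P[/and3P[-> -> ->] _ _] /and3P[/and3P[-> ->
    ->] -> ->].
  by rewrite !andbT; apply: contraTneq xy => ->; apply: c_irr H _.
- by rewrite EL; solve_perm.
- move: HC wL Uw sL; rewrite EL.
  by case/lastP: U zU => [|U' l] // _; solve_cycle.
- by rewrite !inE negb_or ![z == _]eq_sym; apply/andP; split; apply: (run_Lz uC zU);
    rewrite EL !inE eqxx ?orbT.
Qed.

Lemma no_arc_out_in2 c1 c2 R U' l x y : L = c1 :: c2 :: R -> U = rcons U' l -> l != z ->
  x \in Wout -> y \in Win -> ~~ e x y.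
Proof.
move=> EL EU lz xL yU; apply/negP => xy.
have ys' := in_beats_s EL yU.
case/twin_inP: yU => uy yw yz _.
case/twin_outP: xL => ux wx xz _.
apply: (twin_splice (D := s :: c2 :: R ++ U' ++ [:: w; x; y]) (F := [:: c1;
  l]) (W := [:: y, x & [:: w]])) => //.
- move: uy ux; rewrite /= !inE !negb_or => /and3P[/and3P[-> -> ->] _ _] /and3P[/and3P[-> ->
    ->] -> ->].
  by rewrite !andbT; apply: contraTneq xy => ->; apply: c_irr H _.
- by rewrite EL EU; solve_perm.
- move: zU HC wL Uw sL; rewrite EL EU mem_rcons inE eq_sym (negPf lz).
  by case/lastP: U' {EU} => [|U' l'] // _; solve_cycle.
- by rewrite !inE negb_or ![z == _]eq_sym lz andbT; apply: (run_Lz uC zU);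
    rewrite EL !inE eqxx ?orbT.
Qed.

Lemma no_arc_head_in2 c1 c2 R U' l y : L = c1 :: c2 :: R -> U = rcons U' l -> l != z ->
  y \in Win -> ~~ e c1 y.
Proof.
move=> EL EU lz /twin_inP[uy yw yz _]; apply/negP => ly.
apply: (twin_splice (D := s :: c1 :: y :: w :: c2 :: R ++ U') (F := [:: l]) uy) => //.
- by rewrite EL EU; solve_perm.
- move: zU HC wL Us; rewrite EL EU mem_rcons inE eq_sym (negPf lz).
  by case/lastP: U' {EU} => [|U' l'] // _; solve_cycle.
- by rewrite inE eq_sym.
Qed.

Lemma no_arc_out_skip_last u Q d B l x : U = u :: Q ++ d :: rcons B l -> l != z ->
  x \in Wout -> ~~ e x d.
Proof.
move=> EU lz /twin_outP[uy yw yz _]; apply/negP => ly.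
apply: (twin_splice (D := s :: L ++ u :: Q ++ w :: x :: d :: B) (F := [:: l]) uy) => //.
- by rewrite EU; solve_perm.
- move: HC Uw Us; rewrite EU.
  by case/lastP: Q {EU} => [|Q l1]; case/lastP: B => [|B l2]; solve_cycle.
- by rewrite inE eq_sym.
Qed.

Lemma no_arc_out_skip_prev u Q g d B x : U = u :: Q ++ g :: d :: B -> g != z ->
  x \in Wout -> ~~ e x d.
Proof.
move=> EU lz /twin_outP[uy yw yz _]; apply/negP => ly.
apply: (twin_splice (D := s :: L ++ u :: Q ++ w :: x :: d :: B) (F := [:: g]) uy) => //.
- by rewrite EU; solve_perm.
- move: HC Uw; rewrite EU.
  by case/lastP: Q {EU} => [|Q l1]; solve_cycle.
- by rewrite inE eq_sym.
Qed.

Lemma twin_out_neq_z x : x \in Wout -> x != z. Proof. by case/twin_outP. Qed.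

(** The vertex t dominates both twins, its successor, all of L but the last
    vertex by crossing, and all vertices that w beats off the cycle. *)
Lemma twin_interior_false P a u Q t b B : L = rcons P a -> P != [::] ->
  U = u :: Q ++ t :: b :: B -> t != z -> False.
Proof.
move=> EL P0 EU tz.
have [h [h2 [L' EL2]]] : exists h h2 L', L = h :: h2 :: L'.
  by case: P P0 EL => // h [|h2 P] _ ->; [exists h, a, [::] | exists h, h2, (rcons P a)].
apply: (out_overfull H (x := t) (S := w :: s :: b :: P ++ Wout)) => //.
- apply: (uniq_perm_cat (F := a :: u :: Q ++ B) (uniq_out_run e uC)).
  by rewrite EL EU; solve_perm.
- rewrite /dominates /= all_cat; split_goal.
  + by move: Uw; rewrite EU; cycle_simpl; intros; split_ands; apply/orP; left.
  + by move: Us; rewrite EU; cycle_simpl; intros; split_ands; apply/orP; left.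
  + by move: HC; rewrite EU; solve_cycle; apply/orP; left.
  + apply/allP => k kP; apply/orP; right; apply/andP; split.
      by apply: (run_Lz uC zU); rewrite EL mem_rcons inE kP orbT.
    have [A [b' [B' E']]] := mem_successor a kP.
    by apply: (@twin_cross A k b' B' (u :: Q) t (b :: B)); rewrite ?EL.
  + apply/allP => x xWL; rewrite (twin_out_neq_z xWL) /= (no_arc_out_inrun EL2 EU xWL).
    by rewrite orbT.
- have := size_out_run H uC zU mws nwz wL Uw.
  rewrite EL /= size_cat size_rcons; solve_sizes.
Qed.

Lemma twin_uniq_in_out y : y \in Win -> uniq (y :: Wout ++ w :: s :: c).
Proof.
move=> yU; have [uy yw yz _] := twin_inP yU.
rewrite cons_uniq mem_cat negb_or uniq_out_run // andbT; apply/andP; split.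
  by apply: contra (arc_asym H yz twin_wz yw); case/twin_outP.
by case/andP: uy.
Qed.

(** A vertex y off the cycle that beats w would dominate w, s, the last vertex
    of the cycle, the vertices P and all that w beats off the cycle.  If the
    last vertex is z, it is missing from this list, but then y is not an
    out-neighbour of z. *)
Lemma twin_in_false P a y U' l c1 c2 R : L = rcons P a -> L = c1 :: c2 :: R ->
  U = rcons U' l ->
  y \in Win -> {in P, forall t, ~~ e t y} ->
  (forall x, x \in Wout -> ~~ e x y) -> False.
Proof.
move=> EL EL2 EU yU Py WLy; have [uy yw yz _] := twin_inP yU.
have L0 : L != [::] by rewrite EL2.
have sz : size Wout + (size P).+1 = r.
  have <- : size L = (size P).+1 by rewrite EL size_rcons.
  exact: (size_out_run H uC zU mws nwz wL Uw).
have Py' : all (fun t => e y t || (t != z) && ~~ e t y) P.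
  apply/allP => t tP; rewrite (Py t tP) andbT; apply/orP; right.
  by apply: (run_Lz uC zU); rewrite EL mem_rcons inE tP orbT.
have WLy' : all (fun t => e y t || (t != z) && ~~ e t y) Wout.
  by apply/allP => t tP; rewrite (WLy t tP) (twin_out_neq_z tP) orbT.
have nly := no_arc_last_in L0 EU yU.
have nsy := no_arc_s_in EL2 yU.
have [lz|lz] := eqVneq l z.
  apply: (out_overfull_notA H (x := y) (S := w :: s :: P ++ Wout)) => //.
  - by rewrite -lz.
  - apply: (uniq_perm_cat (F := a :: U) (twin_uniq_in_out yU)).
    by rewrite EL; solve_perm.
  - by rewrite /dominates /= all_cat yw Py' WLy' twin_sz nsy !orbT.
  - by rewrite /= size_cat -sz; solve_sizes.
apply: (out_overfull H (x := y) (S := w :: s :: l :: P ++ Wout)) => //.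
- apply: (uniq_perm_cat (F := a :: U') (twin_uniq_in_out yU)).
  by rewrite EL EU; solve_perm.
- by rewrite /dominates /= all_cat yw Py' WLy' twin_sz nsy lz nly !orbT.
- by rewrite /= size_cat -sz; solve_sizes.
Qed.

Lemma twin3_in_nil c1 c2 c3 R : L = c1 :: c2 :: c3 :: R -> Win = [::].
Proof.
move=> EL; case E: Win => [|y Y] //; exfalso.
have yU : y \in Win by rewrite E inE eqxx.
have /mem_rcons_ex[P [a EL']] : c1 \in L by rewrite EL inE eqxx.
have [U' [l EU]] := mem_rcons_ex zU.
apply: (twin_in_false EL' EL EU yU) => [t tP|x xL]; last exact: no_arc_out_in3 EL xL yU.
have [A [b [B EP]]] := mem_successor a tP.
case: A EP => [|h A] EP.
  have -> : t = c1 by move: EL; rewrite EL' EP => -[].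
  exact: no_arc_head_in3 EL yU.
by apply: (@no_arc_inner_in h A t b B y _ yU); rewrite EL' EP.
Qed.

Lemma twin2_in_nil c1 c2 U' l : L = [:: c1; c2] -> U = rcons U' l -> l != z -> Win = [::].
Proof.
move=> EL EU lz; case E: Win => [|y Y] //; exfalso.
have yU : y \in Win by rewrite E inE eqxx.
apply: (twin_in_false (P := [:: c1]) (a := c2) EL EL EU yU) => [t|x xL].
  by rewrite inE => /eqP ->; exact: no_arc_head_in2 EL EU lz yU.
exact: no_arc_out_in2 EL EU lz xL yU.
Qed.

(** A vertex off the cycle other than w is joined to w, whose mate s is on the
    cycle; if it has an arc to z, the hypothesis makes it beat w. *)
Lemma twin_in_z_bound : ~~ has (e^~ z) Wout -> r <= size Win + count (e^~ z) c.
Proof.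
move=> nWL; rewrite -(c_inz H) cardE -size_filter -size_cat.
apply: uniq_leq_size; first exact: enum_uniq.
move=> x; rewrite mem_enum in_set mem_cat mem_in_outside mem_filter => xz'.
have xz : x != z by apply: contraTneq xz' => ->; apply: c_irr H _.
have xw : x != w by apply: contraTneq xz' => ->.
have xs : x != s by apply: contraTneq xz' => ->.
rewrite xz' andTb; case xc: (x \in c); first by rewrite orbT.
rewrite orbF !inE (negPf xw) (negPf xs) xc /=.
have nxw : ~~ mt w x by apply/negP => /(c_mt_inj H mws) E; rewrite E eqxx in xs.
apply: (arc_of_no_arc H twin_wz xz) => //; first by rewrite eq_sym.
apply: contra nWL => wx; apply/hasP; exists x => //.
by rewrite mem_out_outside !inE (negPf xw) (negPf xs) xc.
Qed.

(** All interior vertices of U other than z are excluded, and U has r - 1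
    elements once no vertex off the cycle beats w. *)
Lemma twin_in_run3 P a : L = rcons P a -> P != [::] -> Win = [::] -> 4 <= r ->
  r = 4 /\ exists u l, U = [:: u; z; l].
Proof.
move=> EL P0 W0 r4.
have szU : (size U).+1 = r by rewrite -(size_in_run H uC zU mws nwz wL Uw) W0.
have uU : uniq U by move: uC; rewrite /= cat_uniq => /andP[_ /andP[_ /and3P[]]].
case EU: U => [|u1 [|u2 [|u3 U3]]]; move: szU r4; rewrite EU //=; try by (solve_sizes).
move=> szU r4.
have u2z : u2 = z.
  apply/eqP; apply/negPn/negP => u2z.
  exact: (twin_interior_false (Q := [::]) EL P0 EU u2z).
subst u2; case: U3 EU szU => [|g U3] EU szU; first by split; [rewrite -szU | exists u1, u3].
exfalso; apply: (twin_interior_false (Q := [:: z]) (t := u3) EL P0 EU).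
by apply: contraTneq uU => E; rewrite EU E /= !inE eqxx /= !andbF.
Qed.

(** The previous restrictions leave r = 4 and U of the form u, z, l. There the
    second vertex c2 of L and a vertex x off the cycle have too many
    in-neighbours; if w beats no x off the cycle, the cycle misses w only,
    so that c2 must be near. *)
Lemma twin_out_run3_false c1 c2 c3 R : L = c1 :: c2 :: c3 :: R -> 4 <= r ->
  (forall x, x != z -> e z x || e x z) \/ size c + 3 <= r.*2.+1 -> False.
Proof.
move=> EL r4 Nm; have W0 := twin3_in_nil EL.
have /mem_rcons_ex[P [a EL']] : c1 \in L by rewrite EL inE eqxx.
have P0 : P != [::] by case: P EL' => //; rewrite EL.
have [r4' [u [l EU]]] := twin_in_run3 EL' P0 W0 r4.
have c2z : c2 != z by apply: (run_Lz uC zU); rewrite EL !inE eqxx orbT.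
have c2l : ~~ e c2 l by apply: (@twin_cross [:: c1] c2 c3 R [:: u; z] l [::]).
have nc2B : ~~ e c2 z by apply: (@twin_cross [:: c1] c2 c3 R [:: u] z [:: l]).
have lz : l != z.
  apply: contraTneq uC => E.
  by rewrite EU E /= cat_uniq /= !inE eqxx /= !andbF.
have wc2 : e w c2 by apply: (allP wL); rewrite EL !inE eqxx orbT.
have sc2 : e s c2 by apply: (allP sL); rewrite EL !inE eqxx orbT.
have c12 : e c1 c2 by move: HC; rewrite EL; solve_cycle.
have nc2A : ~~ e z c2.
  apply/negP => zc2.
  (* As r = 4 and c2 has no arc to z, four in-neighbours are the limit. *)
  apply: (in_overfull_notB H (x := c2) (S := [:: w; s; c1; l; z])) => //.
  - apply: (uniq_perm_cat (F := [:: u, c3 & R]) uC).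
    by rewrite EL EU; solve_perm.
  - by rewrite /dominates /= wc2 sc2 c12 lz c2l zc2 !orbT.
  - by rewrite r4'.
case EW: Wout => [|x W].
  case: Nm => [/(_ c2 c2z)|].
    by rewrite (negPf nc2A) (negPf nc2B).
  have := size_out_run H uC zU mws nwz wL Uw; rewrite EW r4' size_cat EU /=.
  by solve_sizes.
have xW : x \in Wout by rewrite EW inE eqxx.
have [ux wx xz _] := twin_outP xW.
have c2x : e c2 x.
  apply/negPn/negP => nc2x.
  apply: (in_overfull_notB H (x := c2) (S := [:: w; s; c1; l; x])) => //.
  - apply: (uniq_perm_cat (F := [:: z, u, c3 & R]) ux).
    by rewrite EL EU; solve_perm.
  - by rewrite /dominates /= wc2 sc2 c12 lz c2l xz nc2x !orbT.
  - by rewrite r4'.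
have nxz : ~~ e x z by apply: (no_arc_out_inrun (Q := [::]) EL EU).
apply: (in_overfull_notB H (x := x) (S := [:: w; s; c1; c2; l])) => //.
- apply: (uniq_perm_cat (F := [:: z, u, c3 & R]) ux).
  by rewrite EL EU; solve_perm.
- rewrite /dominates /= wx twin_sz c2x lz (no_arc_out_s EL xW) (no_arc_out_head EL xW).
  rewrite (no_arc_out_inrun (Q := [:: z]) EL EU xW) !orbT /= !andbT.
  by apply/orP; right; apply: (run_Lz uC zU); rewrite EL !inE eqxx.
- by rewrite r4'.
Qed.

(** If z is not last, r = 4 and the two vertices that w beats off the cycle
    would have to beat each other.  If z is last, it has too few
    in-neighbours. *)
Lemma twin_out_run2_false c1 c2 : L = [:: c1; c2] -> 4 <= r -> 4 <= size c -> False.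
Proof.
move=> EL r4 sc4; have EL' : L = rcons [:: c1] c2 by [].
have szW := size_out_run H uC zU mws nwz wL Uw.
have [U' [l EU]] := mem_rcons_ex zU.
have [lz|lz] := eqVneq l z; last first.
  have W0 := twin2_in_nil EL EU lz.
  have [r4' [u [l' EU2]]] := twin_in_run3 EL' isT W0 r4.
  have ll : l' = l by move: EU; rewrite EU2 -cats1 => /(congr1 (last z)); rewrite last_cat.
  subst l'.
  have key x x' : x \in Wout -> x' \in Wout -> x != x' -> e x x'.
    move=> xW x'W xx'; apply/negPn/negP => nxx'.
    have [ux wx xz _] := twin_outP xW; have [ux' wx' xz' _] := twin_outP x'W.
    have nxz : ~~ e x z by apply: (no_arc_out_inrun (Q := [::]) EL EU2).
    apply: (in_overfull_notB H (x := x) (S := [:: w; s; c1; l; x'])) => //.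
    - apply: (uniq_perm_cat (F := [:: z; u; c2]) (E := x' :: [:: x; w] ++ s :: c)).
        rewrite cons_uniq ux andbT inE negb_or eq_sym xx' /=.
        by case/andP: ux'.
      by rewrite EL EU2; solve_perm.
    - rewrite /dominates /= wx twin_sz lz (no_arc_out_s EL xW) (no_arc_out_head EL xW) xz' nxx'.
      rewrite (no_arc_out_inrun (Q := [:: z]) EL EU2 xW) !orbT !andbT.
      by apply/orP; right; apply: (run_Lz uC zU); rewrite EL !inE eqxx.
    - by rewrite r4'.
  have : uniq Wout by have := uniq_out_run e uC; rewrite cat_uniq => /andP[].
  case EW: Wout szW key => [|x [|x' W]]; rewrite EL r4' //= => _ key.
  rewrite inE negb_or => /andP[/andP[xx' _] _].
  have xz : x != z by apply: twin_out_neq_z; rewrite EW inE eqxx.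
  have xz' : x' != z by apply: twin_out_neq_z; rewrite EW !inE eqxx orbT.
  have k1 : e x x' by apply: key; rewrite ?inE ?eqxx ?orbT.
  have k2 : e x' x by apply: key; rewrite ?inE ?eqxx ?orbT // eq_sym.
  by have := arc_asym H xz xz' k1; rewrite k2.
subst l.
case: U' EU => [|u1 [|u2 U']] EU.
- by move: sc4; rewrite EL EU.
- have nWz : ~~ has (e^~ z) Wout.
    by apply/hasPn => x xW; apply: (no_arc_out_inrun (Q := [::]) EL EU).
  have := twin_in_z_bound nWz; have := size_in_run H uC zU mws nwz wL Uw.
  have nc1z : ~~ e c1 z by apply: (@twin_cross [::] c1 c2 [::] [:: u1] z [::]).
  have c1z : c1 != z by apply: (run_Lz uC zU); rewrite EL !inE eqxx.
  rewrite count_cat EL EU /= (negPf nc1z) (negPf (c_irr H z)).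
  case: (e c2 z) (e u1 z) => -[] /=; rewrite /=; solve_sizes.
exfalso; case E: (rcons U' z) => [|b B]; first by case: (U') E.
apply: (twin_interior_false (Q := [::]) (t := u2) (b := b) (B := B) EL' isT).
  by rewrite EU /= E.
have uU : uniq U by move: uC; rewrite /= cat_uniq => /andP[_ /andP[_ /and3P[]]].
by apply: contraTneq uU => E'; rewrite EU E' /= mem_rcons inE eqxx /= !andbF.
Qed.

(** Skipping a vertex of U gives absent arcs from the vertices that w beats off
    the cycle to most of U; the few short shapes of U that remain leave too
    few in-neighbours for z. *)
Lemma twin_out_run1_false c1 : L = [:: c1] -> 4 <= r -> 4 <= size c -> False.
Proof.
move=> EL r4 sc4.
have szW := size_out_run H uC zU mws nwz wL Uw.
have uU : uniq U by move: uC; rewrite /= cat_uniq => /andP[_ /andP[_ /and3P[]]].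
have interior U1 t b B : U = U1 ++ t :: b :: B -> t != z ->
    (forall x, x \in Wout -> ~~ e x t) -> False.
  move=> EU tz nx.
  apply: (out_overfull H (x := t) (S := w :: s :: b :: Wout)) => //.
  - apply: (uniq_perm_cat (F := c1 :: U1 ++ B) (uniq_out_run e uC)).
    by rewrite EL EU; solve_perm.
  - rewrite /dominates /=; split_goal.
    + by move: Uw; rewrite EU; cycle_simpl; intros; split_ands; apply/orP; left.
    + by move: Us; rewrite EU; cycle_simpl; intros; split_ands; apply/orP; left.
    + by move: HC; rewrite EU; solve_cycle; apply/orP; left.
    + by apply/allP => x xWL; rewrite (twin_out_neq_z xWL) /= (nx x xWL) orbT.
  - have szl : size L = 1 by rewrite EL.
    by rewrite /= -szW szl; solve_sizes.
have fin (cc : seq X) : ~~ has (e^~ z) Wout -> size cc = 3 ->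
    (forall t, t \in c -> e t z -> t \in cc) -> size U = 3 -> False.
  move=> nWz scc csub sU; have := twin_in_z_bound nWz;
    have := size_in_run H uC zU mws nwz wL Uw.
  rewrite sU; have : count (e^~ z) c <= size cc; last by rewrite scc; solve_sizes.
  rewrite -size_filter; apply: uniq_leq_size.
    by apply: filter_uniq; move: uC => /= /and3P[].
  by move=> t; rewrite mem_filter => /andP[/= tz tc]; apply: csub.
have [U' [l EU]] := mem_rcons_ex zU.
have [lz|lz] := eqVneq l z; last first.
  case: U' EU => [|u1 [|u2 [|u3 U']]] EU.
  - by move: zU; rewrite EU inE eq_sym (negPf lz).
  - by move: sc4; rewrite EL EU.
  - have u2z : u2 = z.
      apply/eqP; apply/negPn/negP => u2z.
      apply: (interior [:: u1] u2 l [::] EU u2z) => x xW.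
      exact: (@no_arc_out_skip_last u1 [::] u2 [::] l).
    subst u2.
    apply: (fin [:: c1; u1; l]) => //; last by rewrite EU.
      apply/hasPn => x xW; exact: (@no_arc_out_skip_last u1 [::] z [::] l).
    move=> t; rewrite EL EU /= !inE => /or4P[] /eqP ->; rewrite ?eqxx ?orbT //.
    by rewrite (negPf (c_irr H _)).
  - have [u2z|u2z] := eqVneq u2 z; last first.
      apply: (interior [:: u1] u2 u3 (rcons U' l) EU u2z) => x xW.
      exact: (@no_arc_out_skip_last u1 [::] u2 (u3 :: U') l).
    have u3z : u3 != z.
      by apply: contraTneq uU => E'; rewrite EU E' u2z /= !inE eqxx /= !andbF.
    case E: (rcons U' l) => [|b B]; first by case: (U') E.
    apply: (interior [:: u1; u2] u3 b B _ u3z) => [|x xW]; first by rewrite EU /= E.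
    exact: (@no_arc_out_skip_last u1 [:: u2] u3 U' l).
subst l.
case: U' EU => [|u1 [|u2 [|u3 U']]] EU.
- by move: sc4; rewrite EL EU.
- by move: sc4; rewrite EL EU.
- have u2z : u2 != z.
    by apply: contraTneq uU => E'; rewrite EU E' /= !inE eqxx /= !andbF.
  apply: (fin [:: c1; u1; u2]) => //; last by rewrite EU.
    apply/hasPn => x xW; exact: (@no_arc_out_skip_prev u1 [::] u2 z [::]).
  move=> t; rewrite EL EU /= !inE => /or4P[] /eqP ->; rewrite ?eqxx ?orbT //.
  by rewrite (negPf (c_irr H _)).
have u2z : u2 != z.
  by apply: contraTneq uU => E'; rewrite EU E' /= !inE !mem_rcons !inE eqxx ?orbT /= ?andbF.
have u3z : u3 != z.
  by apply: contraTneq uU => E'; rewrite EU E' /= !inE !mem_rcons !inE eqxx ?orbT /= ?andbF.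
case E: (rcons U' z) => [|b B]; first by case: (U') E.
apply: (interior [:: u1; u2] u3 b B _ u3z) => [|x xW]; first by rewrite EU /= E.
by apply: (@no_arc_out_skip_prev u1 [::] u2 u3 (rcons U' z)).
Qed.

Lemma twins_false : 4 <= r -> 4 <= size c -> L != [::] ->
  (forall x, x != z -> e z x || e x z) \/ size c + 3 <= r.*2.+1 -> False.
Proof.
move=> r4 sc4; case EL: {1}L => [|c1 [|c2 [|c3 R]]] // _ Nm.
- exact: (twin_out_run1_false EL r4 sc4).
- exact: (twin_out_run2_false EL r4 sc4).
- exact: (twin_out_run3_false EL r4 Nm).
Qed.
End Twins.

(** * Near vertices off a cycle have their mate on it *)

Section MateOnCycle.
Variables (X : finType) (e : rel X) (z p q : X) (mt : rel X) (r : nat).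
Hypothesis H : contracted e z p q mt r.

(** Starting from z, no vertex of the cycle can be followed by x, so each of
    them beats x. *)
Lemma absorbed_along x l k : x \notin z :: l -> x != z -> ~~ has (mt x) l ->
  uniq (z :: l) -> cycle e (z :: l) -> no_cycle e z (size l).+2 ->
  path e z k -> prefix k l -> e z x -> all (e^~ x) k.
Proof.
move=> xC xz nm uC cC NE; elim/last_ind: k => // k t IH.
rewrite rcons_path => /andP[pk kt] /prefixP[l'].
rewrite cat_rcons => El zx.
have pre : prefix k l by apply/prefixP; exists (t :: l').
have ak := IH pk pre zx.
rewrite all_rcons ak andbT.
have tl : t \in l by rewrite El mem_cat inE eqxx orbT.
have tz : t != z by apply: contraTneq uC => <-; rewrite /= tl.
have lx : e (last z k) x.
  by case/lastP: k ak {pre pk kt IH El} => // k u; rewrite all_rcons last_rcons => /andP[].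
apply: (arc_of_no_arc H xz tz).
- by apply: contraNneq xC => ->; rewrite inE tl orbT.
- by apply: contra nm => mxt; apply/hasP; exists t.
apply/negP => xt.
apply: (@splice1 X e z (size l).+1 (z :: l) [:: x] (z :: k ++ x :: t :: l') [::]) => //.
- by rewrite cat1s cons_uniq xC.
- by rewrite inE eqxx.
- by rewrite El; solve_perm.
- by move: cC; rewrite El; solve_cycle.
Qed.

(** If x had no mate on the cycle, the whole cycle would beat x, and so would
    all in-neighbours y of z off the cycle: going from x through y into z
    and skipping the last vertex of the cycle would gain a vertex.  That is
    more than r vertices, and x has no arc to z. *)
Lemma mate_on_cycle_at_z x l : uniq (z :: l) -> cycle e (z :: l) -> no_cycle e z (size l).+2 ->
  x \notin z :: l -> e z x -> has (mt x) l.
Proof.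
move=> uC cC NE xC zx; apply/negPn/negP => nm.
have xz : x != z by apply: contraNneq xC => ->; rewrite inE eqxx.
have pl : path e z l by move: cC; rewrite /= rcons_path => /andP[].
have al := absorbed_along xC xz nm uC cC NE pl (prefix_refl l) zx.
have uxC : uniq (x :: z :: l) by rewrite cons_uniq xC.
case/lastP El : l => [|l' f].
  by move: cC; rewrite El /= andbT (negPf (c_irr H z)).
have fz : f != z.
  by apply: contraTneq uC => Ef; rewrite El Ef /= mem_rcons inE eqxx.
have nxz : ~~ e x z.
  apply/negP => xz'.
  apply: (@splice1 X e z (size l).+1 (z :: l) [:: x] (z :: l ++ [:: x]) [::]) => //.
  - by rewrite inE eqxx.
  - by solve_perm.
  - by move: cC al; rewrite El; solve_cycle.
have lx' : e (last z l') x.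
  move: al; rewrite El all_rcons => /andP[_].
  by case/lastP: (l') => // k u; rewrite all_rcons last_rcons => /andP[].
have uY : uniq (z :: l ++ in_outside e z l).
  have := @uniq_out_outside X (fun x y => e y x) z l uC.
  by rewrite -[z :: l ++ _]cat_cons !cat_uniq has_sym => /and3P[-> -> ->].
have YP y : y \in in_outside e z l -> [/\ y \notin z :: l, e y z & y != z].
  rewrite mem_in_outside => /andP[yC yz]; split=> //.
  by apply: contraNneq yC => ->; rewrite inE eqxx.
apply: (in_overfull_notB H (x := x) (S := z :: l ++ in_outside e z l)) => //.
- rewrite cons_uniq uY andbT -cat_cons mem_cat negb_or xC /=.
  by apply/negP => /YP[_ xz' _]; rewrite xz' in nxz.
- rewrite /dominates /= zx all_cat; apply/and3P; split=> //.
    by apply/allP => t tl; have /= -> : (e^~ x) t := allP al t tl.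
  apply/allP => y /YP[yC yz' yz]; rewrite yz; apply/orP; right.
  apply/negP => xy.
  apply: (@splice1 X e z (size l).+1 (z :: l) [:: y; x] (z :: l' ++ [:: x; y]) [:: f]) => //.
  - rewrite (cat_cons y [:: x]) cat1s 2!cons_uniq uC xC in_cons negb_or yC.
    by rewrite !andbT; apply: contraTneq xy => ->; apply: c_irr H _.
  - by rewrite inE eqxx.
  - by rewrite El; solve_perm.
  - by move: pl; rewrite El; solve_cycle.
  - by rewrite inE eq_sym.
- have := size_in_outside (c_irr H z) uC; rewrite (c_inz H) => <-.
  rewrite /= size_cat; have := count_size (e^~ z) l; solve_sizes.
Qed.

Lemma out_mate_on_cycle C x : ucycle e C -> z \in C -> no_cycle e z (size C).+1 ->
  x \notin C -> e z x -> has (mt x) C.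
Proof.
move=> /andP[cC uC] zC NE xC zx.
have [i l El] := rot_to zC.
have cl : cycle e (z :: l) by rewrite -El rot_cycle.
have ul : uniq (z :: l) by rewrite -El rot_uniq.
have sl : size C = (size l).+1 by rewrite -(size_rot i) El.
have := mate_on_cycle_at_z ul cl; rewrite -sl => /(_ x NE).
rewrite -El mem_rot => /(_ xC zx) hl.
rewrite -(has_rot i); rewrite El /= hl orbT //.
Qed.

End MateOnCycle.

Lemma in_mate_on_cycle (X : finType) (e : rel X) z p q mt r : contracted e z p q mt r ->
  forall C x, ucycle e C -> z \in C -> no_cycle e z (size C).+1 ->
  x \notin C -> e x z -> has (mt x) C.
Proof.
move=> H C x cC zC NE xC xz.
rewrite -has_rev; apply: (out_mate_on_cycle (contracted_dual H)) => //.
- exact: ucycle_dual.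
- by rewrite mem_rev.
- by rewrite size_rev; apply: no_cycle_dual.
- by rewrite mem_rev.
Qed.

(** * Runs of a vertex around a cycle *)

(** A vertex that cannot be inserted switches from beating to being beaten at
    most once. *)
Lemma run_split (X : eqType) (e : rel X) w c :
  (forall A a b B, c = A ++ a :: b :: B -> e a w -> ~~ e w b) ->
  all (fun t => e w t || e t w) c ->
  exists L U, [/\ c = L ++ U, all (e w) L & all (fun t => ~~ e w t && e t w) U].
Proof.
elim: c => [|a c IH] ins /=; first by exists [::], [::].
case/andP=> wa ac.
have [A a' b B E|L [U [E aL aU]]] := IH _ ac.
  by apply: (ins (a :: A) a' b B); rewrite E.
have [ewa|nwa] := boolP (e w a).
  by exists (a :: L), U; rewrite E /= ewa aL.
have aw : e a w by move: wa; rewrite (negPf nwa).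
case: L E aL => [|b L] E /=.
  by exists [::], (a :: U); rewrite E /= nwa aw aU.
case/andP=> wb _; have := ins [::] a b (L ++ U); rewrite E => /(_ erefl aw).
by rewrite wb.
Qed.

Lemma no_insert (X : finType) (e : rel X) z s w c :
  uniq (w :: s :: c) -> cycle e (s :: c) -> z \in c ->
  no_cycle e z (size c).+2 ->
  forall A a b B, c = A ++ a :: b :: B -> e a w -> ~~ e w b.
Proof.
move=> uC HC zc NE A a b B E aw; apply/negP => wb.
apply: (@splice1 X e z _ (s :: c) [:: w] (s :: A ++ a :: w :: b :: B) [::] NE) => //.
- by rewrite inE zc orbT.
- by rewrite E; solve_perm.
- by move: HC; rewrite E; solve_cycle.
Qed.

Section Runs.
Variables (X : finType) (e : rel X) (z p q : X) (mt : rel X) (r : nat).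
Hypothesis H : contracted e z p q mt r.

Lemma run_exists s w c : uniq (w :: s :: c) -> cycle e (s :: c) -> z \in c ->
  no_cycle e z (size c).+2 -> mt w s -> e z w || e w z ->
  exists L U, [/\ c = L ++ U, all (e w) L & all (fun t => ~~ e w t && e t w) U].
Proof.
move=> uC HC zc NE mws ez; apply: run_split; first exact: (no_insert uC HC zc NE).
apply/allP => t tc; have [->|tz] := eqVneq t z; first by rewrite orbC.
have wz : w != z by apply: contraTneq mws => ->; apply: (c_mtz H).
have wt : w != t by apply: contraTneq uC => ->; rewrite /= inE tc orbT.
have nm : ~~ mt w t.
  by apply: contraTN uC => mwt; rewrite (c_mt_inj H mws mwt) /= tc andbF.
by have := c_adj H wz tz wt nm; case: (e w t).
Qed.

Variables (s w : X) (L U : seq X).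
Notation c := (L ++ U).
Hypothesis HC : cycle e (s :: c).
Hypothesis uC : uniq (w :: s :: c).
Hypothesis NE : no_cycle e z (size c).+2.
Hypothesis zU : z \in U.
Hypothesis mws : mt w s.
Hypothesis nwz : ~~ e w z.
Hypothesis wL : all (e w) L.
Hypothesis Uw : all (e^~ w) U.
Hypothesis r4 : 4 <= r.
Hypothesis c3 : 3 <= size c.
Notation Wout := (out_outside e w (s :: c)).

Lemma run_WL x : x \in Wout -> [/\ uniq ([:: x; w] ++ s :: c), e w x & x != z].
Proof. exact: (out_runP uC zU). Qed.

(** With an empty out-run, the first vertex of the cycle after s would dominate
    w, its successor, and all r vertices that w beats.  If this first vertex
    is z, the third one takes its place. *)
Lemma out_run_nonempty : L != [::].
Proof.
apply/negP => /eqP EL.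
have szW := size_out_run H uC zU mws nwz wL Uw.
have sz := run_sz H mws; have szL : size L = 0 by rewrite EL.
case EU: U => [|c1 [|c2 [|c3' V]]]; try by move: c3; rewrite EL EU.
have Ec : c = c1 :: c2 :: c3' :: V by rewrite EL EU.
have [c1z|c1z] := eqVneq c1 z; last first.
  have nx x : x \in Wout -> ~~ e x c1.
    case/run_WL => ux wx xz; apply/negP => xc1.
    apply: (@splice1 X e z _ (s :: c) [:: x; w] (c ++ [:: w; x]) [:: s] NE ux) => //.
    - by rewrite inE mem_cat zU !orbT.
    - by solve_perm.
    - by move: HC Uw; rewrite EL EU; case/lastP: (V) => [|V' v]; solve_cycle.
    - by rewrite inE eq_sym.
  apply: (out_overfull H (x := c1) (S := w :: c2 :: Wout)) => //.
  - apply: (uniq_perm_cat (F := s :: c3' :: V) (uniq_out_run e uC)).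
    by rewrite Ec; solve_perm.
  - rewrite /dominates /=; split_goal.
    + by move: Uw; rewrite EU /= => /andP[->].
    + by move: HC; rewrite Ec /= => /and3P[_ -> _].
    + by apply/allP => x xW; case/run_WL: (xW) => _ _ ->; rewrite (nx x xW) orbT.
  - by rewrite /= -szW szL; solve_sizes.
have uc : uniq c by move: uC => /= /and3P[].
have c3z : c3' != z.
  by apply: contraTneq uc => E; rewrite Ec c1z E /= !inE eqxx !orbT.
have c2z : c2 != z.
  by apply: contraTneq uc => E; rewrite Ec c1z E /= !inE eqxx.
have nx x : x \in Wout -> ~~ e x c3'.
  case/run_WL => ux wx xz; apply/negP => xc3.
  apply: (@splice1 X e z _ (s :: c) [:: x;
    w] (s :: c1 :: w :: x :: c3' :: V) [:: c2] NE ux) => //.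
  - by rewrite inE mem_cat zU !orbT.
  - by rewrite Ec; solve_perm.
  - by move: HC Uw; rewrite EL EU; solve_cycle.
  - by rewrite inE eq_sym.
(* The third vertex is followed by s if the cycle ends there. *)
case En: (rcons V s) => [|nx3 V']; first by case: (V) En.
have ex : e c3' nx3.
  by case: V EU Ec En => [|v V''] EU Ec [<- _]; move: HC; rewrite Ec; solve_cycle.
apply: (out_overfull H (x := c3') (S := w :: nx3 :: Wout)) => //.
- apply: (uniq_perm_cat (F := c1 :: c2 :: V') (uniq_out_run e uC)).
  have : perm_eq (s :: V) (nx3 :: V') by rewrite -En perm_sym perm_rcons.
  move=> /permP pe; rewrite Ec; apply/permP => f; move: (pe f).
  by rewrite /= ?count_cat /= ?count_cat /=; clear; lia.
- rewrite /dominates /= ex; split_goal => //.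
  + by move: Uw; rewrite EU /= => /and4P[_ _ ->].
  + by apply/allP => x xW; case/run_WL: (xW) => _ _ ->; rewrite (nx x xW) orbT.
- by rewrite /= -szW szL; solve_sizes.
Qed.

(** If the out-run of s were longer, s would beat the second vertex c2 of the
    cycle.  Then a path from w through x to s would allow to skip c1, so s
    would beat all that w beats off the cycle, and more vertices on it than
    w does: too many. *)
Lemma longer_run_eq Ls Us : L != [::] -> c = Ls ++ Us -> all (e s) Ls ->
  all (fun t => ~~ e s t && e t s) Us -> size L <= size Ls -> Ls = L.
Proof.
move=> L0 Ec aLs aUs le.
have [Lx ELs] : exists Lx, Ls = L ++ Lx.
  exists (drop (size L) Ls).
  have : take (size L) (L ++ U) = take (size L) (Ls ++ Us) by rewrite Ec.
  rewrite take_size_cat // takel_cat // => {1}->.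
  by rewrite cat_take_drop.
case ELx: Lx => [|b Lx']; first by rewrite ELs ELx cats0.
exfalso; have [c1 [c2 [R Ec2]]] : exists c1 c2 R, Ls = c1 :: c2 :: R.
  case EL: L L0 => [|c1 [|c2 R]] // _.
    by exists c1, b, Lx'; rewrite ELs EL ELx.
  by exists c1, c2, (R ++ Lx); rewrite ELs EL.
have sz := run_sz H mws.
have sx x : x \in Wout -> e s x.
  case/run_WL => ux wx xz; apply: (arc_of_no_arc H xz sz).
  - by apply: contraTneq ux => ->; rewrite /= !inE eqxx ?orbT.
  - apply: contraTN ux; rewrite (c_mtC H) => msx.
    have <- : w = x by apply: (c_mt_inj H _ msx); rewrite (c_mtC H).
    by rewrite /= !inE eqxx.
  apply/negP => xs.
  apply: (@splice1 X e z _ (s :: c) [:: x; w] (s :: c2 :: R ++ Us ++ [:: w;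
    x]) [:: c1] NE ux) => //.
  - by rewrite inE mem_cat zU !orbT.
  - by rewrite Ec Ec2; solve_perm.
  - have lw : e (last c2 (R ++ Us)) w.
      have -> : last c2 (R ++ Us) = last z U.
        by have : last z (L ++ U) = last z (Ls ++ Us); [rewrite Ec | rewrite Ec2 /= => <-;
          rewrite last_cat; case: (U) zU].
      have [U' [l EU]] := mem_rcons_ex zU.
      by move: Uw; rewrite EU last_rcons all_rcons => /andP[].
    rewrite [R ++ _ ++ _]catA.
    move: lw HC aLs; rewrite Ec Ec2 !cat_cons.
    by case/lastP: (R ++ Us) => [|V v]; solve_cycle.
  - have c1L : c1 \in L by move: ELs; rewrite Ec2; case: (L) L0 => // a L' _ [-> _];
      rewrite inE eqxx.
    by rewrite inE eq_sym; apply: (run_Lz uC zU).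
have uS : uniq (s :: Wout ++ Ls).
  apply: (uniq_perm_cat (F := w :: Us) (uniq_out_run e uC)).
  by rewrite Ec; solve_perm.
have nS : dominates e z s (Wout ++ Ls).
  rewrite /dominates all_cat; apply/andP; split; apply/allP => t tS.
    by rewrite sx.
  by rewrite (allP aLs).
have nm : ~~ has (mt s) (Wout ++ Ls).
  apply/hasPn => t tS; apply/negP => mst.
  have ETw : w = t by apply: (c_mt_inj H _ mst); rewrite (c_mtC H).
  move: tS; rewrite -ETw mem_cat mem_out_outside inE eqxx /=.
  by move: uC; rewrite Ec /= !inE !negb_or mem_cat negb_or => /andP[/and3P[_ /negPf ->]].
have := dominates_bound H sz uS nS; rewrite (negPf nm) andbF addn0.
rewrite ELs ELx -(size_out_run H uC zU mws nwz wL Uw) !size_cat /=; solve_sizes.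
Qed.
End Runs.

Section OutsideTwins.
Variables (X : finType) (e : rel X) (z p q : X) (mt : rel X) (r : nat).
Hypothesis H : contracted e z p q mt r.
Hypothesis r4 : 4 <= r.

(** Either vertex can take the place of the other on the cycle.  The one with
    the longer out-run plays the role of s in [longer_run_eq]; when s has an
    arc to z, that one is s because its run reaches z. *)
Lemma outside_twins s w c : cycle e (s :: c) -> uniq (w :: s :: c) ->
  no_cycle e z (size c).+2 -> z \in c -> mt w s -> e z w -> ~~ e w z ->
  e z s || e s z -> 3 <= size c ->
  exists L U, [/\ c = L ++ U, L != [::] & z \in U] /\
    [/\ all (e w) L, all (e^~ w) U, all (e s) L, all (e^~ s) U & ~~ e s z].
Proof.
move=> HC uC NE zc mws zw nwz zs c3.
have zw' : e z w || e w z by rewrite zw.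
have [L [U [Ec wL Uw']]] := run_exists H uC HC zc NE mws zw'.
have Uw : all (e^~ w) U by apply: sub_all Uw' => t /andP[].
have zL : z \notin L by apply: contra nwz; apply: (allP wL).
have zU : z \in U by move: zc; rewrite Ec mem_cat (negPf zL).
subst c.
have L0 := out_run_nonempty H HC uC NE zU mws nwz wL Uw c3.
have HCs : cycle e (w :: L ++ U).
  move: HC wL Uw; have [U' [l ->]] := mem_rcons_ex zU; case: (L) L0 => // a L' _.
  by solve_cycle.
have uCs : uniq (s :: w :: L ++ U).
  by move: uC; rewrite /= !inE !negb_or eq_sym => /and3P[/andP[-> ->] -> ->].
have msw : mt s w by rewrite (c_mtC H).
have [Ls [Us [Ecs sLs Uss']]] := run_exists H uCs HCs zc NE msw zs.
have Uss : all (e^~ s) Us by apply: sub_all Uss' => t /andP[].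
have fin : Ls = L -> exists L0 U0, [/\ L ++ U = L0 ++ U0, L0 != [::] & z \in U0] /\
    [/\ all (e w) L0, all (e^~ w) U0, all (e s) L0, all (e^~ s) U0 & ~~ e s z].
  move=> ELs; exists L, U; have EUs : Us = U.
    by move/eqP: Ecs; rewrite ELs eqseq_cat // eqxx => /eqP ->.
  rewrite -{1}ELs -EUs; split; split; rewrite ?ELs ?EUs //.
  - by rewrite -ELs.
  - by rewrite -EUs.
  - by have := allP Uss' z; rewrite EUs => /(_ zU) /andP[].
case: (leqP (size L) (size Ls)) => le.
  by apply: fin; apply: (longer_run_eq H HC uC NE zU mws nwz wL Uw L0 Ecs).
have zUs : z \in Us.
  move: zc; rewrite Ecs mem_cat => /orP[zLs|//].
  have ELs : Ls = take (size Ls) L.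
    have := congr1 (take (size Ls)) Ecs.
    by rewrite [in RHS]take_size_cat // takel_cat // ltnW.
  by case/negP: zL; apply: (mem_take (n0 := size Ls)); rewrite -ELs.
have nsz : ~~ e s z by case/andP: (allP Uss' z zUs).
apply: fin; apply/esym.
have NEs : no_cycle e z (size (Ls ++ Us)).+2 by rewrite -Ecs.
have HCs' : cycle e (w :: Ls ++ Us) by rewrite -Ecs.
have uCs' : uniq (s :: w :: Ls ++ Us) by rewrite -Ecs.
have Ls0 : Ls != [::].
  by apply: (out_run_nonempty H HCs' uCs' NEs zUs msw nsz sLs Uss); rewrite -Ecs.
by apply: (longer_run_eq H HCs' uCs' NEs zUs msw nsz sLs Uss Ls0 (esym Ecs)) => //;
  rewrite ltnW.
Qed.

Lemma outside_twins_false s w c : cycle e (s :: c) -> uniq (w :: s :: c) ->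
  no_cycle e z (size c).+2 -> z \in c -> mt w s -> e z w -> ~~ e w z ->
  e z s || e s z -> 4 <= size c ->
  (forall x, x != z -> e z x || e x z) \/ size c + 3 <= r.*2.+1 -> False.
Proof.
move=> HC uC NE zc mws zw nwz zs c4 Nm.
have [L [U [[Ec L0 zU] [wL Uw sL Us nsz]]]] :=
  outside_twins HC uC NE zc mws zw nwz zs (ltnW c4).
by subst c; exact: (twins_false H HC uC NE zU mws nwz wL Uw nsz sL Us r4 c4 L0 Nm).
Qed.
End OutsideTwins.

(** * Twins off a cycle of length four *)

Section Four.
Variables (X : finType) (e : rel X) (z p q : X) (mt : rel X) (r : nat).
Hypothesis H : contracted e z p q mt r.
Hypothesis r4 : 4 <= r.

(** Four vertices on the cycle force r = 4, three pairs of mates as the near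
    vertices, and p and q as the far ones.  A cycle from z through a far
    vertex and back misses a pair of mates, so it does not exist when
    5-cycles do not.  Hence all of B beats p, p beats q, and q beats all of
    A; with y1 and y2 in both A and B, the vertices z, y1, p, q, y2 form a
    5-cycle. *)
Lemma four_cycle_twins_false s w c : cycle e (s :: c) -> uniq (w :: s :: c) ->
  no_cycle e z 5 -> size c = 3 -> z \in c -> mt w s -> e z w -> ~~ e w z ->
  e z s -> ~~ e s z -> False.
Proof.
move=> HC uC NE sc zc mws zw nwz zs nsz.
have [a [b Ec]] : exists a b, perm_eq c [:: z; a; b].
  have pe := perm_to_rem zc; have := perm_size pe; rewrite sc.
  case: (rem z c) pe => [|a [|b [|? ?]]] // pe _; by exists a, b.
have cC : ucycle e (s :: c) by rewrite /ucycle HC; case/andP: uC.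
have zC : z \in s :: c by rewrite inE zc orbT.
have NEC : no_cycle e z (size (s :: c)).+1 by rewrite /= sc.
have out x : x \notin s :: c -> e z x || e x z -> [\/ x = w, mt a x | mt b x].
  move=> xC zx; have : has (mt x) (s :: c).
    case/orP: zx => zx; first exact: (out_mate_on_cycle H).
    exact: (in_mate_on_cycle H).
  rewrite /= (eq_has_r (perm_mem Ec)) /= (c_mtC H x z) (negPf (c_mtz H _)) orbF /=.
  case/or3P => [xs|xa|xb].
  - by constructor 1; apply: (c_mt_inj H) (s) _ _ _ _; rewrite (c_mtC H).
  - by constructor 2; rewrite (c_mtC H).
  - by constructor 3; rewrite (c_mtC H).
have inA x : e z x || e x z -> [\/ x \in [:: w; s; a; b], mt a x | mt b x].
  move=> zx; case xC: (x \in s :: c); last first.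
    by case: (out x (negbT xC) zx) => [->|xa|xb]; [constructor 1|constructor 2|constructor 3];
      rewrite ?inE ?eqxx.
  constructor 1; move: xC zx; rewrite inE (perm_mem Ec) !inE => /or4P[] /eqP ->;
    by rewrite ?eqxx ?orbT // (negPf (c_irr H z)).
have sz := run_sz H mws.
have wz : w != z by apply: contraTneq mws => ->; apply: (c_mtz H).
have [a' [b' [Bsub aa bb]]] : exists a' b',
    [/\ forall x, e x z -> x \in [:: a; b; a'; b'],
     (a' == a) || mt a a' & (b' == b) || mt b b'].
  exists (odflt a [pick x | mt a x]), (odflt b [pick x | mt b x]).
  split=> [x xz||]; try by case: pickP => [t /= ->|]; rewrite ?orbT //= eqxx.
  have : e z x || e x z by rewrite xz orbT.
  case/inA => [|ax|bx].
  - rewrite !inE => /or4P[] /eqP E; rewrite ?E ?eqxx ?orbT //.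
      by move: xz; rewrite E (negPf nwz).
    by move: xz; rewrite E (negPf nsz).
  - case: pickP => [t at'|/(_ x)] /=; last by rewrite ax.
    by rewrite (c_mt_inj H at' ax) !inE eqxx !orbT.
  - case: [pick x0 | mt b x0] / pickP => [t at'|/(_ x)] /=; last by rewrite bx.
    by rewrite (c_mt_inj H at' bx) !inE eqxx !orbT.
pose B := [set x | e x z].
have cB : #|B| = r := c_inz H.
have BS : B \subset [:: a; b; a'; b'].
  by apply/subsetP => x; rewrite inE; apply: Bsub.
have le4 : #|[:: a; b; a'; b']| <= 4 := card_size _.
have cS : #|[:: a; b; a'; b']| = 4.
  by apply/eqP; rewrite eqn_leq le4 (leq_trans r4) // -cB subset_leq_card.
have rE : r = 4.
  by apply/eqP; rewrite eqn_leq r4 andbT -cB -cS subset_leq_card.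
have uS : uniq [:: a; b; a'; b'] by apply/card_uniqP; rewrite cS.
have BE x : (x \in [:: a; b; a'; b']) = e x z.
  have/subset_cardP : #|B| = #|[:: a; b; a'; b']| by rewrite cB rE cS.
  by move=> /(_ BS x); rewrite !inE.
move: (uS); rewrite /= !inE !negb_or !andbT.
case/and3P => /and3P[ab aa' ab'] /andP[ba' bb'] a'b'.
have {aa} maa : mt a a' by move: aa; rewrite eq_sym (negPf aa').
have {bb} mbb : mt b b' by move: bb; rewrite eq_sym (negPf bb').
have Asub x : e z x -> x \in [:: w; s] \/ e x z.
  move=> zx; case: (inA x); first by rewrite zx.
  - rewrite !inE => /or4P[] /eqP E; rewrite ?E ?eqxx ?orbT; auto; right;
      rewrite -E E -BE !inE eqxx ?orbT //.
  - by move=> ax; right; rewrite -BE (c_mt_inj H ax maa) !inE eqxx !orbT.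
  - by move=> ax; right; rewrite -BE (c_mt_inj H ax mbb) !inE eqxx !orbT.
have mated x : e z x || e x z -> exists y, mt x y.
  have mB y : e y z -> exists t, mt y t.
    rewrite -BE !inE => /or4P[] /eqP ->; [exists a'|exists b'|exists a|exists b];
      by rewrite // (c_mtC H).
  case/orP => [/Asub[]|] //; auto; rewrite !inE => /orP[] /eqP ->; [exists s|exists w];
    by rewrite // (c_mtC H).
have nAz x : ~~ (e z x || e x z) -> forall y, e z y || e y z -> y != x.
  by move=> nx y; apply: contraTneq => ->.
(* Such a route misses one of the three pairs of mates. *)
have noroute x a1 b1 : x != z -> ~~ (e z x || e x z) -> a1 != b1 ->
    e z a1 -> e b1 z -> e a1 x -> ~~ e x b1.
  move=> xz nx ab1 za bz ax; apply/negP => xb.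
  have az : a1 != z by apply: contraTneq za => ->; apply: (c_irr H).
  have bz' : b1 != z by apply: contraTneq bz => ->; apply: (c_irr H).
  have a1x : a1 != x by apply: nAz nx _ _; rewrite za.
  have b1x : b1 != x by apply: nAz nx _ _; rewrite bz orbT.
  have cD : ucycle e [:: z; a1; x; b1].
    by rewrite /ucycle /= za ax xb bz !inE !negb_or !andbT ![z == _]eq_sym az xz bz' a1x ab1
      eq_sym b1x.
  have zD : z \in [:: z; a1; x; b1] by rewrite inE eqxx.
  have pair u v : e z u || e u z -> e z v || e v z -> mt u v -> (u \in [:: a1;
    b1]) || (v \in [:: a1; b1]).
    move=> uAB vAB muv; case uD: (u \in [:: z; a1; x; b1]).
      have uz : u != z by apply: contraTneq uAB => ->; rewrite (negPf (c_irr H z)).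
      by move: uD; rewrite !inE (negPf uz) (negPf (nAz x nx u uAB)) /= => ->.
    have : has (mt u) [:: z; a1; x; b1].
      case/orP: (uAB) => zu; first by apply: (out_mate_on_cycle H cD zD NE); rewrite ?uD.
      by apply: (in_mate_on_cycle H cD zD NE); rewrite ?uD.
    case/hasP => t tD mut; have vt := c_mt_inj H muv mut; subst t.
    have uz : v != z by apply: contraTneq vAB => ->; rewrite (negPf (c_irr H z)).
    by move: tD; rewrite !inE (negPf uz) (negPf (nAz x nx v vAB)) /= => ->; rewrite orbT.
  have p1 : (w \in [:: a1; b1]) || (s \in [:: a1; b1]).
    by apply: pair => //; rewrite ?zw ?zs.
  have p2 : (a \in [:: a1; b1]) || (a' \in [:: a1; b1]).
    by apply: pair => //; rewrite -BE !inE eqxx ?orbT.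
  have p3 : (b \in [:: a1; b1]) || (b' \in [:: a1; b1]).
    by apply: pair => //; rewrite -BE !inE eqxx ?orbT.
  have wb1 : w != b1 by apply: contraNneq nwz => ->.
  have sb1 : s != b1 by apply: contraNneq nsz => ->.
  have a1ws : (a1 == w) || (a1 == s).
    by move: p1; rewrite !inE (negPf wb1) (negPf sb1) !orbF ![a1 == _]eq_sym.
  have na1 t : e t z -> t != a1.
    by case/orP: a1ws => /eqP -> tz; apply: contraTneq tz => ->.
  have [az' [bz'' [a'z b'z]]] : e a z /\ e b z /\ e a' z /\ e b' z.
    by rewrite -!BE !inE !eqxx !orbT.
  move: p2 p3; rewrite !inE (negPf (na1 _ az')) (negPf (na1 _ bz'')) (negPf (na1 _ a'z))
    (negPf (na1 _ b'z)) /=.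
  move/eqP: ab => ab; move/eqP: ab' => ab'; move/eqP: ba' => ba'; move/eqP: a'b' => a'b'.
  by case/orP => /eqP E1 /orP[] /eqP E2; congruence.
have pz := c_pz H; have qz := c_qz H; have pq := c_pq H.
have nAB x : (forall t, ~~ mt x t) -> ~~ (e z x || e x z).
  by move=> nm; apply/negP => /mated[y mxy]; have := nm y; rewrite mxy.
have np := nAB p (c_mtp H); have nq := nAB q (c_mtq H).
have [npA npB] : ~~ e z p /\ ~~ e p z by apply/andP; rewrite -negb_or.
have [nqA nqB] : ~~ e z q /\ ~~ e q z by apply/andP; rewrite -negb_or.
pose A := [set x | e z x].
have cA : #|A| = r := c_outz H.
have Bp : forall b1, e b1 z -> e b1 p.
  have [a1 za1 a1p] : exists2 a1, e z a1 & e a1 p.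
    have [/exists_inP[a1 a1A ?]|] := boolP [exists a1 in A, e a1 p].
      by exists a1 => //; rewrite inE in a1A.
    rewrite negb_exists_in => /forall_inP nAp.
    have := c_out H pz; rewrite (negPf npA) pq /= addn1 rE.
    have : A \subset [set y | e p y].
      apply/subsetP => y yA; have zy : e z y by move: yA; rewrite inE.
      rewrite inE; apply: (arc_of_no_arc H).
      - by apply: contraTneq zy => ->; apply: (c_irr H).
      - done.
      - by apply: nAz np _ _; rewrite zy.
      - by rewrite (c_mtC H); apply: (c_mtp H).
      - exact: nAp.
    by move/subset_leq_card; rewrite cA rE => le [] E; rewrite E in le.
  move=> b1 b1z; have [<-//|ab1] := eqVneq a1 b1.
  apply: (arc_of_no_arc H) => //.
  - by apply: contraTneq b1z => ->; apply: (c_irr H).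
  - by rewrite eq_sym; apply: nAz np _ _; rewrite b1z orbT.
  - exact: (c_mtp H).
  - exact: (noroute p a1 b1).
have qA : forall a1, e z a1 -> e q a1.
  have [b1 b1z qb1] : exists2 b1, e b1 z & e q b1.
    have [/exists_inP[a1 a1A ?]|] := boolP [exists b1 in B, e q b1].
      by exists a1 => //; rewrite inE in a1A.
    rewrite negb_exists_in => /forall_inP nAp.
    have := c_in H qz; rewrite (negPf nqB) eq_sym pq /= addn1 rE.
    have : B \subset [set y | e y q].
      apply/subsetP => y yA; have zy : e y z by move: yA; rewrite inE.
      rewrite inE; apply: (arc_of_no_arc H) => //.
      - by apply: contraTneq zy => ->; apply: (c_irr H).
      - by rewrite eq_sym; apply: nAz nq _ _; rewrite zy orbT.
      - exact: (c_mtq H).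
      - exact: nAp.
    by move/subset_leq_card; rewrite cB rE => le [] E; rewrite E in le.
  move=> a1 za1; have [->//|ab1] := eqVneq a1 b1.
  apply: (arc_of_no_arc H) => //.
  - by apply: contraTneq za1 => ->; apply: (c_irr H).
  - by apply: nAz nq _ _; rewrite za1.
  - by rewrite (c_mtC H); apply: (c_mtq H).
  - by apply/negP => a1q; have := noroute q a1 b1 qz nq ab1 za1 b1z a1q; rewrite qb1.
have pqe : e p q.
  have inp : [set y | e y p] = B.
    apply/eqP; rewrite eq_sym eqEcard cB; apply/andP; split.
      by apply/subsetP => y; rewrite !inE; apply: Bp.
    by have := c_in H pz; rewrite eqxx andbF addn0 => ->.
  apply: (arc_of_no_arc H) => //; first by rewrite eq_sym.
    exact: (c_mtq H).
  by have /setP/(_ q) := inp; rewrite !inE (negPf nqB) => ->.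
have : 1 < #|A :\ w :\ s|.
  have := cardsD1 s (A :\ w); have := cardsD1 w A; rewrite cA rE.
  move: #|_ :\ s| #|A :\ w| (w \in A) (s \in _) => m n b1 b2; clear.
  by case: b1; case: b2; lia.
case/card_gt1P => y1 [y2 []]; rewrite !inE => /and3P[y1s y1w zy1] /and3P[y2s y2w zy2] y12.
have yB y : y != s -> y != w -> e z y -> e y z.
  by move=> ys yw /Asub[]//; rewrite !inE (negPf ys) (negPf yw).
have y1z := yB _ y1s y1w zy1; have y2z := yB _ y2s y2w zy2.
have ny y : e z y -> [/\ y != z, y != p & y != q].
  move=> zy; split; first by apply: contraTneq zy => ->; apply: (c_irr H).
    by apply: nAz np _ _; rewrite zy.
  by apply: nAz nq _ _; rewrite zy.
have [y1z' y1p y1q] := ny _ zy1; have [y2z' y2p y2q] := ny _ zy2.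
have := NE [:: z; y1; p; q; y2]; rewrite inE eqxx /= => /(_ _ isT) E.
have : false; last by []; apply: E.
rewrite /ucycle /= zy1 (Bp y1 y1z) pqe (qA y2 zy2) y2z !inE !negb_or !andbT.
by rewrite ![z == _]eq_sym y1z' pz qz y2z' y1p y1q y12 pq eq_sym y2p eq_sym y2q.
Qed.
End Four.

(** * Two mates adjacent to z in both directions *)

Section BothTwins.
Variables (X : finType) (e : rel X) (z p q : X) (mt : rel X) (r : nat).
Hypothesis H : contracted e z p q mt r.
Variables (s w : X) (Lo Up : seq X).
Notation c := (Lo ++ z :: Up).
Hypothesis HC : cycle e (s :: c).
Hypothesis uC : uniq (w :: s :: c).
Hypothesis NE : no_cycle e z (size c).+2.
Hypothesis mws : mt w s.
Hypothesis wz : e w z.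
Hypothesis zw : e z w.
Hypothesis sz : e s z.
Hypothesis zs : e z s.
Hypothesis wL : all (e w) Lo.
Hypothesis Uw : all (e^~ w) Up.
Hypothesis sL : all (e s) Lo.
Hypothesis Us : all (e^~ s) Up.
Notation Wout := (out_outside e w (s :: c)).
Notation Win := (in_outside e w (s :: c)).

Lemma both_wz : w != z. Proof. by apply: contraTneq zw => ->; apply: (c_irr H). Qed.
Lemma both_sz : s != z. Proof. by apply: contraTneq zs => ->; apply: (c_irr H). Qed.
Lemma both_zc : z \in c. Proof. by rewrite mem_cat inE eqxx orbT. Qed.
Lemma both_Lo_neq_z x : x \in Lo -> x != z.
Proof.
move=> xL; apply: contraTneq uC => E; rewrite E in xL.
by rewrite /= cat_uniq /= xL /= !andbF.
Qed.
Lemma both_Up_neq_z x : x \in Up -> x != z.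
Proof.
move=> xL; apply: contraTneq uC => E; rewrite E in xL.
by rewrite /= cat_uniq /= xL /= !andbF.
Qed.

Lemma both_size_in : (size Win + size Up).+1 = r.
Proof.
have := c_in H both_wz; rewrite wz /= addn0 => <-.
rewrite -(size_in_outside (c_irr H w) uC) /=.
have -> : e s w = false by apply/negbTE/(c_mt_e H); rewrite (c_mtC H).
rewrite add0n count_cat /= zw -addnS; congr (_ + _).
move: Uw; rewrite all_count => /eqP ->.
suff /eqP -> : count (e^~ w) Lo == 0 by [].
rewrite -leqn0 leqNgt -has_count; apply/hasPn => y yU.
by apply: (arc_asym H both_wz (both_Lo_neq_z yU)); apply: (allP wL).
Qed.
Lemma both_size_out : (size Wout + size Lo).+1 = r.
Proof.
have := c_out H both_wz; rewrite zw /= addn0 => <-.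
rewrite -(size_out_outside (c_irr H w) uC) /= (negPf (c_mt_e H mws)).
rewrite add0n count_cat /= wz.
move: wL; rewrite all_count => /eqP ->.
suff /eqP -> : count (e w) Up == 0 by rewrite /=; solve_sizes.
rewrite -leqn0 leqNgt -has_count; apply/hasPn => y yU.
by apply: (arc_asym H (both_Up_neq_z yU) both_wz); apply: (allP Uw).
Qed.
Lemma both_outP x : x \in Wout -> [/\ uniq ([:: x; w] ++ s :: c), e w x & x != z].
Proof. exact: (out_runP uC (mem_head z Up)). Qed.
Lemma both_inP x : x \in Win -> [/\ uniq ([:: x; w] ++ s :: c), e x w & x != z].
Proof. exact: (in_runP uC (mem_head z Up)). Qed.
Lemma both_uniq_in : uniq (Win ++ w :: s :: c). Proof. exact: uniq_out_outside. Qed.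
Lemma both_uniq_in_out y : y \in Win -> uniq (y :: Wout ++ w :: s :: c).
Proof.
move=> yU; have [uy yw yz] := both_inP yU.
rewrite cons_uniq mem_cat negb_or uniq_out_run // andbT; apply/andP; split.
  by apply: contra (arc_asym H yz both_wz yw); case/both_outP.
by case/andP: uy.
Qed.

Lemma both_splice (D F W : seq X) : uniq (W ++ s :: c) ->
  perm_eq (D ++ F) (W ++ s :: c) -> cycle e D -> z \notin F ->
  size W = (size F).+1 -> False.
Proof.
move=> uW pe cD zF sW; apply: (@splice1 X e z _ (s :: c) W D F NE) => //.
by rewrite inE both_zc orbT.
Qed.

(** The cycle goes from a directly to d, returns through w to the part of Lo
    after a, and through z to the part of Up before d. *)
Lemma both_cross P a R Q d B : Lo = P ++ a :: R -> Up = Q ++ d :: B -> ~~ e a d.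
Proof.
move=> EL EU; apply/negP => ad.
apply: (both_splice (D := s :: P ++ a :: d :: B ++ w :: R ++ z :: Q) (F := [::]) (W := [::
  w])) => //.
  by rewrite EL EU; solve_perm.
move: HC wL Uw sL Us zs wz; rewrite EL EU.
by case: P {EL} => [|? P]; case/lastP: Q {EU} => [|Q ?]; case: R => [|? R];
  case/lastP: B => [|B ?]; solve_cycle.
Qed.

Lemma mem_split_ex (T : eqType) (d : T) U : d \in U -> exists A B, U = A ++ d :: B.
Proof. by case/splitPr => A B; exists A, B. Qed.

(** The vertex c2 is dominated by both mates, by c1, by all of Up and by all
    that beat w off the cycle. *)
Lemma both_run2_false c1 c2 R : Lo = c1 :: c2 :: R -> False.
Proof.
move=> EL; have c2L : c2 \in Lo by rewrite EL !inE eqxx orbT.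
apply: (in_overfull H (x := c2) (S := w :: s :: c1 :: Up ++ Win)).
- exact: both_Lo_neq_z.
- apply: (uniq_perm_cat (F := R ++ [:: z]) both_uniq_in).
  by rewrite EL; solve_perm.
- rewrite /dominates /= all_cat; split_goal.
  + by move: wL; rewrite EL /= => /and3P[_ ->].
  + by move: sL; rewrite EL /= => /and3P[_ ->].
  + by move: HC; rewrite EL; solve_cycle; apply/orP; left.
  + apply/allP => d dU; have [A [B EU]] := mem_split_ex dU.
    by rewrite (both_Up_neq_z dU) (@both_cross [:: c1] c2 R A d B) ?orbT.
  + apply/allP => y yW; case/both_inP: (yW) => uy yw yz; rewrite yz.
    apply/orP; right; apply/negP => c2y.
    apply: (both_splice (D := s :: c2 :: y :: w :: R ++ z :: Up) (F := [:: c1]) (W := [:: y;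
      w])) => //.
    * by rewrite EL; solve_perm.
    * by move: HC wL Uw sL Us wz; rewrite EL; case: (R) => [|? R']; solve_cycle.
    * by rewrite inE eq_sym; apply: both_Lo_neq_z; rewrite EL inE eqxx.
- by rewrite /= size_cat -both_size_in; solve_sizes.
Qed.

(** On a 4-cycle, a vertex y off the cycle that beats w would dominate both
    mates, c1, e1 and all that w beats off the cycle. *)
Lemma both_run1_false c1 e1 : Lo = [:: c1] -> Up = [:: e1] -> 4 <= r -> False.
Proof.
move=> EL EU r4; have szU := both_size_in; have szL := both_size_out.
case EW: Win => [|y WU']; first by move: szU r4; rewrite EW EU /=; solve_sizes.
have yU : y \in Win by rewrite EW inE eqxx.
case/both_inP: (yU) => uy yw yz.
have c1z : c1 != z by apply: both_Lo_neq_z; rewrite EL inE eqxx.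
have e1z : e1 != z by apply: both_Up_neq_z; rewrite EU inE eqxx.
have nsy : ~~ e s y.
  apply/negP => sy; apply: (both_splice (D := [:: s; y; w; z; e1]) (F := [:: c1]) uy) => //.
  - by rewrite EL EU; solve_perm.
  - by move: HC wz; rewrite EL EU; solve_cycle.
  - by rewrite inE eq_sym.
have nc1y : ~~ e c1 y.
  apply/negP => sy; apply: (both_splice (D := [:: s; c1; y; w; z]) (F := [:: e1]) uy) => //.
  - by rewrite EL EU; solve_perm.
  - by move: HC wz zs; rewrite EL EU; solve_cycle.
  - by rewrite inE eq_sym.
have ney : ~~ e e1 y.
  apply/negP => sy; apply: (both_splice (D := [:: c1; z; e1; y; w]) (F := [:: s]) uy) => //.
  - by rewrite EL EU; solve_perm.
  - by move: HC wL; rewrite EL EU; solve_cycle.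
  - by rewrite inE eq_sym both_sz.
have ys : e y s.
  apply: (arc_of_no_arc H both_sz yz) => //.
    by apply: contraTneq uy => <-; rewrite /= !inE eqxx orbT.
  apply/negP => msy; move: mws; rewrite (c_mtC H) => msw.
  by move: uy; rewrite /= inE (c_mt_inj H msy msw) eqxx.
have nxy x : x \in Wout -> ~~ e x y.
  case/both_outP => ux wx xz; apply/negP => xy.
  apply: (both_splice (D := [:: z; w; x; y; s]) (F := [:: c1; e1]) (W := [:: y; x; w])) => //.
  - move: uy ux; rewrite /= !inE !negb_or => /and3P[/and3P[-> -> ->] _ _] /and3P[/and3P[-> ->
      ->] -> ->].
    by rewrite !andbT; apply: contraTneq xy => ->; apply: c_irr H _.
  - by rewrite EL EU; solve_perm.
  - by rewrite /= zw wx xy ys sz.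
  - by rewrite !inE negb_or ![z == _]eq_sym c1z e1z.
apply: (out_overfull H (x := y) (S := w :: s :: c1 :: e1 :: Wout)) => //.
- apply: (uniq_perm_cat (F := [:: z]) (both_uniq_in_out yU)).
  by rewrite EL EU; solve_perm.
- rewrite /dominates /= yw both_sz nsy c1z nc1y e1z ney !orbT /=.
  by apply/allP => x xW; rewrite (nxy x xW); case/both_outP: xW => _ _ ->; rewrite orbT.
- have sl : size Lo = 1 by rewrite EL.
  by rewrite /= -szL sl; solve_sizes.
Qed.
End BothTwins.

Lemma cycle_rev1 (X : eqType) (e : rel X) s c :
  cycle e (s :: c) -> cycle (fun x y => e y x) (s :: rev c).
Proof. by move=> HC; rewrite -(rot_cycle 1) rot1_cons -rev_cons rev_cycle. Qed.

Lemma uniq_rev2 (X : eqType) (w s : X) c :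
  uniq (w :: s :: c) -> uniq (w :: s :: rev c).
Proof. by rewrite /= !inE !mem_rev rev_uniq. Qed.

(** A run Up of length at least two is handled by reversing all arcs. *)
Lemma both_twins_false (X : finType) (e : rel X) z p q mt r : contracted e z p q mt r ->
  forall s w Lo Up, cycle e (s :: Lo ++ z :: Up) -> uniq (w :: s :: Lo ++ z :: Up) ->
  no_cycle e z (size (Lo ++ z :: Up)).+2 -> mt w s ->
  e w z -> e z w -> e s z -> e z s ->
  all (e w) Lo -> all (e^~ w) Up -> all (e s) Lo -> all (e^~ s) Up -> 4 <= r ->
  3 <= size (Lo ++ z :: Up) -> False.
Proof.
move=> H s w Lo Up HC uC NE mws wz zw sz zs wL Uw sL Us r4 c3.
case EL: {1}Lo => [|c1 [|c2 R]];
  last by apply: (both_run2_false H HC uC NE mws wz zw zs wL Uw sL Us EL).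
all: case EU: {1}Up => [|e1 [|e2 V]]; try by move: c3; rewrite EL EU.
all: try by apply: (both_run1_false H HC uC NE mws wz zw sz zs wL Uw EL EU r4).
all: case/lastP EU2: {1}Up (EU) => [|V1 u1] //; case/lastP: V1 EU2 => [|V2 u2] EU2 // _;
  try by move: EU; rewrite EU2.
all: have Er : rev (Lo ++ z :: Up) = rev Up ++ z :: rev Lo by rewrite rev_cat rev_cons
  cat_rcons.
all: apply: (@both_run2_false _ _ _ _ _ _ _ (contracted_dual H) s w (rev Up) (rev Lo) _ _ _ _
  _ _ _ _ _ _ _ u1 u2 (rev V2)) => //;
  rewrite -?Er ?all_rev ?size_rev //;
    first [exact: cycle_rev1 | exact: uniq_rev2 | exact: no_cycle_dual
  | by rewrite EU2 !rev_rcons].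
Qed.

(** * A cycle with fewest far vertices contains all near vertices *)

(** Also z itself is far, which adds the same amount to the count for each cycle
    through z. *)
Definition far (X : finType) (e : rel X) z x := ~~ (e z x || e x z).
Definition far_minimal (X : finType) (e : rel X) z C :=
  forall D, ucycle e D -> z \in D -> size D = size C ->
    count (far e z) C <= count (far e z) D.

Section Inside.
Variables (X : finType) (e : rel X) (z p q : X) (mt : rel X) (r : nat).
Hypothesis H : contracted e z p q mt r.

(** The vertex z may be inserted on both sides of w, so it separates the two
    runs. *)
Lemma both_run_exists s w c : cycle e (s :: c) -> uniq (w :: s :: c) ->
  no_cycle e z (size c).+2 -> z \in c -> mt w s -> e z w -> e w z ->
  exists Lo Up, [/\ c = Lo ++ z :: Up, all (e w) Lo & all (e^~ w) Up].
Proof.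
move=> HC uC NE zc mws zw wz; have zw' : e z w || e w z by rewrite zw.
have [L [U [Ec aL aU]]] := run_exists H uC HC zc NE mws zw'.
have aU' : all (e^~ w) U by apply: sub_all aU => t /andP[].
have zL : z \in L.
  move: zc; rewrite Ec mem_cat => /orP[//|/(allP aU)].
  by rewrite wz.
have [A [B EL]] := mem_split_ex zL.
case: B EL => [|b B] EL.
  exists A, U; move: aL; rewrite EL all_cat => /andP[-> _]; split=> //.
  by rewrite Ec EL -catA.
have Ec' : c = A ++ z :: b :: (B ++ U) by rewrite Ec EL -catA.
have := no_insert uC HC zc NE Ec' zw.
by move: aL; rewrite EL all_cat /= => /and4P[_ _ ->].
Qed.

(** Putting w in the place of s gives a cycle of the same length, so by
    minimality s cannot be the only far one of the two. *)
Lemma swap_near s w c : far_minimal e z (s :: c) -> uniq (w :: s :: c) ->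
  cycle e (w :: c) -> z \in c -> e z w || e w z -> e z s || e s z.
Proof.
move=> mC uC HCw zc nw; have uw : uniq (w :: c).
  by move: uC; rewrite /= inE negb_or => /and3P[/andP[_ ->] _ ->].
have := mC (w :: c); rewrite /ucycle HCw uw inE zc orbT => /(_ isT isT erefl) /=.
by rewrite /far nw /=; case: (e z s || e s z) => //=; rewrite ltnn.
Qed.

Lemma swap_cycle s w (L U : seq X) : cycle e (s :: L ++ U) ->
  (if L is c1 :: _ then e w c1 else if U is c1 :: _ then e w c1 else false) ->
  (if rev U is c1 :: _ then e c1 w else if rev L is c1 :: _ then e c1 w else false) ->
  cycle e (w :: L ++ U).
Proof.
case: L => [|a L]; case/lastP: U => [|U b] //; rewrite ?rev_rcons.
- by case: U => [|u U]; solve_cycle.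
- by case/lastP: L => [|L l]; rewrite ?rev_cons ?rev_rcons /= ; solve_cycle.
- by solve_cycle.
Qed.

Hypothesis r4 : 4 <= r.

(** A near vertex w off the cycle that is joined to z in one direction only
    makes its mate near, and hence its twin. *)
Lemma strict_inside s w c : cycle e (s :: c) -> uniq (w :: s :: c) ->
  no_cycle e z (size c).+2 -> z \in c -> mt w s -> e z w -> ~~ e w z ->
  3 <= size c -> far_minimal e z (s :: c) ->
  (forall x, x != z -> e z x || e x z) \/ size c + 3 <= r.*2.+1 -> False.
Proof.
move=> HC uC NE zc mws zw nwz c3 mC Nm.
have zw' : e z w || e w z by rewrite zw.
have zs : e z s || e s z.
  have [L [U [Ec wL Uw']]] := run_exists H uC HC zc NE mws zw'.
  have Uw : all (e^~ w) U by apply: sub_all Uw' => t /andP[].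
  have zL : z \notin L by apply: contra nwz; apply: (allP wL).
  have zU : z \in U by move: zc; rewrite Ec mem_cat (negPf zL).
  subst c; have L0 := out_run_nonempty H HC uC NE zU mws nwz wL Uw c3.
  apply: (swap_near mC uC _ zc zw').
  apply: (swap_cycle HC).
    by case: (L) L0 wL => //= a L' _ /andP[].
  by have [U' [l EU]] := mem_rcons_ex zU; move: Uw; rewrite EU rev_rcons all_rcons => /andP[].
have [c4|] := leqP 4 (size c).
  exact: (outside_twins_false H r4 HC uC NE zc mws zw nwz zs c4 Nm).
rewrite ltnS => cle; have c3' : size c = 3 by apply/eqP; rewrite eqn_leq cle.
have [L [U [_ [_ _ _ _ nsz]]]] := outside_twins H HC uC NE zc mws zw nwz zs c3.
have zs' : e z s by move: zs; rewrite (negPf nsz) orbF.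
apply: (four_cycle_twins_false H r4 HC uC _ c3' zc mws zw nwz zs' nsz).
by rewrite -[5]/(3.+2) -c3'.
Qed.

(** If the mate s is joined to z in one direction only, exchanging the roles of
    s and w makes w joined to z in one direction only as well. *)
Lemma both_inside s w c : cycle e (s :: c) -> uniq (w :: s :: c) ->
  no_cycle e z (size c).+2 -> z \in c -> mt w s -> e z w -> e w z ->
  3 <= size c -> far_minimal e z (s :: c) -> False.
Proof.
move=> HC uC NE zc mws zw wz c3 mC.
have zw' : e z w || e w z by rewrite zw.
have [Lo [Up [Ec wL Uw]]] := both_run_exists HC uC NE zc mws zw wz.
have HCw : cycle e (w :: c).
  rewrite Ec; apply: swap_cycle; first by rewrite -Ec; exact: HC.
    by case: (Lo) wL => //= a L' /andP[].
  by case/lastP: (Up) Uw => //= U u; rewrite rev_cons rev_rcons /= all_rcons => /andP[].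
have zs := swap_near mC uC HCw zc zw'.
have msw : mt s w by rewrite (c_mtC H).
have uCs : uniq (s :: w :: c).
  by move: uC; rewrite /= !inE !negb_or eq_sym => /and3P[/andP[-> ->] -> ->].
have sz : e s z.
  apply/negPn/negP => nsz; have zs' : e z s by move: zs; rewrite (negPf nsz) orbF.
  have [L [U [_ [_ _ _ _]]]] := outside_twins H HCw uCs NE zc msw zs' nsz zw' c3.
  by rewrite wz.
have {}zs : e z s.
  apply/negPn/negP => nzs.
  have [L [U [_ [_ _ _ _]]]] : exists L U, [/\ rev c = L ++ U, L != [::] & z \in U] /\
    [/\ all (fun x => e x s) L, all (e s) U, all (e^~ w) L, all (e w) U & ~~ e z w].
    apply: (outside_twins (contracted_dual H) (s := w) (w := s)) => //.
    - exact: cycle_rev1.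
    - exact: uniq_rev2.
    - by rewrite size_rev; apply: no_cycle_dual.
    - by rewrite mem_rev.
    - by rewrite wz.
    - by rewrite size_rev.
  by rewrite zw.
have [Lo' [Up' [Ec' sL Us]]] := both_run_exists HCw uCs NE zc msw zs sz.
have zL : z \notin Lo.
  by apply: contraTN uC => zL; rewrite Ec /= cat_uniq /= zL /= !andbF.
have zL' : z \notin Lo'.
  by apply: contraTN uC => zL'; rewrite Ec' /= cat_uniq /= zL' /= !andbF.
move/eqP: (Ec); rewrite Ec' eqseq_pivot2l // => /andP[/eqP E1 /eqP E2]; subst Lo' Up'.
rewrite Ec in HC uC NE c3.
exact: (both_twins_false H HC uC NE mws wz zw sz zs wL Uw sL Us r4 c3).
Qed.
End Inside.

Section NearInside.
Variables (X : finType) (e : rel X) (z p q : X) (mt : rel X) (r : nat).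
Hypothesis H : contracted e z p q mt r.
Hypothesis r4 : 4 <= r.

Lemma far_dual x : far (fun x y => e y x) z x = far e z x.
Proof. by rewrite /far orbC. Qed.

Lemma rot_mate C (s : X) : s \in C -> ucycle e C -> far_minimal e z C ->
  exists c, [/\ perm_eq C (s :: c), ucycle e (s :: c) & far_minimal e z (s :: c)].
Proof.
move=> sC /andP[cC uC] mC; have [i c Ec] := rot_to sC.
exists c; rewrite -Ec; split; first by rewrite perm_sym perm_rot.
  by rewrite /ucycle rot_cycle cC rot_uniq.
have /permP/(_ (far e z)) E : perm_eq C (rot i C) by rewrite perm_sym perm_rot.
by move=> D cD zD; rewrite size_rot -E; apply: mC.
Qed.

Theorem near_inside C : ucycle e C -> z \in C -> 4 <= size C ->
  no_cycle e z (size C).+1 -> far_minimal e z C ->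
  (forall x, x != z -> e z x || e x z) \/ size C + 2 <= r.*2.+1 ->
  forall x, e z x || e x z -> x \in C.
Proof.
move=> cC zC C4 NE mC Nm w nw; apply/negPn/negP => wC.
have /hasP[s sC mws] : has (mt w) C.
  by case/orP: nw => zw; [apply: (out_mate_on_cycle H) | apply: (in_mate_on_cycle H)].
have [c [pe /andP[cc uc] mc]] := rot_mate sC cC mC.
have sz := perm_size pe; rewrite /= in sz.
rewrite sz in C4 NE Nm; rewrite (perm_mem pe) in zC; rewrite (perm_mem pe) in wC.
have uC : uniq (w :: s :: c) by rewrite cons_uniq wC uc.
have {}zC : z \in c.
  by move: zC; rewrite inE eq_sym (negPf (run_sz H mws)).
rewrite addSnnS in Nm.
case zw: (e z w); last first.
  have wz : e w z by move: nw; rewrite zw.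
  apply: (strict_inside (contracted_dual H) r4 (s := s) (w := w) (c := rev c));
    rewrite ?zw ?size_rev //.
  - exact: cycle_rev1.
  - exact: uniq_rev2.
  - exact: no_cycle_dual.
  - by rewrite mem_rev.
  - move=> D cD zD sD; have := mc (rev D); rewrite /ucycle rev_cycle rev_uniq mem_rev size_rev.
    move: sD; rewrite /= size_rev => -> /(_ cD zD erefl).
    rewrite (eq_count far_dual) count_rev.
    by rewrite (eq_count far_dual) far_dual count_rev.
  - by case: Nm => [N|]; [left=> x /N; rewrite orbC | right].
case wz: (e w z); first exact: (both_inside H r4 cc uC NE zC mws zw wz).
exact: (strict_inside H r4 cc uC NE zC mws zw (negbT wz)).
Qed.
End NearInside.

(** * Paths of far vertices that bypass part of the cycle *)

Lemma not_path (T : eqType) (R : rel T) x s : ~~ path R x s ->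
  exists P a b Q, x :: s = P ++ a :: b :: Q /\ ~~ R a b.
Proof.
elim: s x => //= y s IH x; rewrite negb_and => /orP[nR|/IH[P [a [b [Q [E nR]]]]]].
  by exists [::], x, y, s.
by exists (x :: P), a, b, Q; rewrite E.
Qed.

(** If no vertex in f is directly followed by one in g, each step of the path
    uses at most one of the two. *)
Lemma path_count (T : eqType) (f g : pred T) x s :
  path (fun a b => ~~ (f a && g b)) x s ->
  count f (belast x s) + count g s <= size s.
Proof.
elim: s x => //= y s IH x /andP[nfg /IH]; move: nfg.
by case: (f x); case: (g y) => //= _; lia.
Qed.

Section Bypass.
Variables (X : finType) (e : rel X) (z p q : X) (mt : rel X) (r : nat).
Hypothesis H : contracted e z p q mt r.
Hypothesis r4 : 4 <= r.
Variable l : seq X.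
Hypothesis ul : uniq (z :: l).
Hypothesis cl : cycle e (z :: l).
Hypothesis near_in : forall x, e z x || e x z -> x \in l.
Hypothesis NE : no_cycle e z (size l).+2.
Hypothesis m2 : size l + 2 <= r.*2.

(** The vertices off the cycle; all of them are far from here on. *)
Definition others := [seq x <- enum X | x \notin z :: l].

Lemma perm_others : perm_eq (z :: l ++ others) (enum X).
Proof.
apply: uniq_perm; rewrite ?enum_uniq //.
  rewrite -cat_cons cat_uniq ul filter_uniq ?enum_uniq // andbT /=.
  by apply/hasPn => x; rewrite mem_filter => /andP[].
by move=> x; rewrite -cat_cons mem_cat mem_filter mem_enum !inE andbT orbN.
Qed.

Lemma countX (f : pred X) : #|[set y | f y]| = f z + count f l + count f others.
Proof.
have -> : #|[set y | f y]| = count f (enum X).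
  rewrite cardE -size_filter; apply/perm_size/uniq_perm.
  - exact: enum_uniq.
  - exact: filter_uniq (enum_uniq _).
  - by move=> y; rewrite mem_enum mem_filter mem_enum in_set andbT.
by rewrite -(permP perm_others) /= count_cat addnA.
Qed.

Lemma othersP x : (x \in others) = (x \notin z :: l).
Proof. by rewrite mem_filter mem_enum andbT. Qed.

Lemma others_far x : x \in others -> [/\ x != z, x \notin l, ~~ e z x & ~~ e x z].
Proof.
rewrite othersP inE negb_or => /andP[xz xl]; split=> //.
  by apply: contra xl => zx; apply: near_in; rewrite zx.
by apply: contra xl => zx; apply: near_in; rewrite zx orbT.
Qed.

Lemma mem_l_neq_z x : x \in l -> x != z.
Proof. by move=> xl; apply: contraTneq ul => <-; rewrite /= xl. Qed.

Lemma countA : count (e z) l = r.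
Proof.
rewrite -(c_outz H) countX (negPf (c_irr H z)).
suff /eqP -> : count (e z) others == 0 by rewrite addn0.
by rewrite -leqn0 leqNgt -has_count; apply/hasPn => x /others_far[].
Qed.

Lemma countB : count (e^~ z) l = r.
Proof.
rewrite -(c_inz H) countX (negPf (c_irr H z)).
suff /eqP -> : count (e^~ z) others == 0 by rewrite addn0.
by rewrite -leqn0 leqNgt -has_count; apply/hasPn => x /others_far[].
Qed.

Lemma size_others : size l + size others = r.*2.
Proof.
by move: (perm_size perm_others); rewrite -cardE (c_card H) /= size_cat => -[].
Qed.

Lemma uniq_others_cat ws : uniq ws -> {subset ws <= others} -> uniq (ws ++ z :: l).
Proof.
move=> uws sub; rewrite cat_uniq uws ul andbT andTb; apply/hasPn => x xl.
by apply: contraL xl => /sub; rewrite othersP.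
Qed.

(** The vertices F that are bypassed do not include z. *)
Lemma gap_ahead k l1 F G ws w1 ws' : ws = w1 :: ws' -> uniq ws ->
  {subset ws <= others} -> path e w1 ws' ->
  l = l1 ++ F ++ G -> l1 != [::] -> G != [::] ->
  no_cycle e z k -> k + size F = (size l + size ws).+1 ->
  e (last z l1) w1 -> ~~ e (last w1 ws') (head z G).
Proof.
move=> Ews uws sub pw El l10 G0 NEk sF ew1; apply/negP => ew2.
apply: (@splice X e z _ (z :: l) ws (z :: l1 ++ ws ++ G) F NEk) => //.
- exact: uniq_others_cat.
- by rewrite inE eqxx.
- by rewrite El; solve_perm.
- move: cl ew1 ew2 pw; rewrite El Ews.
  case/lastP: l1 l10 {El} => // l1 a _; case: G G0 => // b G _.
  by solve_cycle.
- by apply: contraL ul => zF; rewrite El /= !mem_cat zF !orbT.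
- by rewrite sF /= addnS addnC.
Qed.

(** The bypassed part of the cycle is F2, z, F1.  What remains still contains
    more near vertices, counted for A and B, than it has steps; so some
    vertex of B directly precedes one of A there, and z is put back between
    them. *)
Lemma gap_around k F1 G F2 ws w1 ws' : ws = w1 :: ws' -> uniq ws ->
  {subset ws <= others} -> path e w1 ws' ->
  l = F1 ++ G ++ F2 -> G != [::] ->
  no_cycle e z k -> k + (size F1 + size F2) = (size l + size ws).+1 ->
  (size l + (size F1 + size F2)).+1 < r.*2 ->
  e (last z G) w1 -> ~~ e (last w1 ws') (head z G).
Proof.
move=> Ews uws sub pw El G0 NEk sF small ew1; apply/negP => ew2.
case EG: G G0 => [|g0 G'] // _.
have [/path_count bound|] := boolP (path (fun a b => ~~ (e a z && e z b)) g0 G').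
  have cA := countA; have cB := countB.
  move: cA cB bound small; rewrite El EG !count_cat !size_cat /=.
  have := count_size (e z) F1; have := count_size (e z) F2.
  have := count_size (e^~ z) F1; have := count_size (e^~ z) F2.
  have : count (e^~ z) (g0 :: G') <= count (e^~ z) (belast g0 G') + 1.
    rewrite lastI -cats1 count_cat /= addn0; case: (e _ z); solve_sizes.
  rewrite /=; case: (e z g0) (e g0 z) => -[];
    move: (count _ _) (count _ _) (count _ _) (count _ _) (count _ _) (count _ _) (count _
    _); solve_sizes.
case/not_path => P [a [b [Q [E]]]]; rewrite negbK => /andP[az zb].
rewrite EG /= in ew1 ew2.
have hE : head z (P ++ [:: a]) = g0 by case: (P) E => [|x P'] [->].
have lE : last z (b :: Q) = last g0 G'.
  by have := congr1 (last z) E; rewrite /= last_cat /= => ->.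

apply: (@splice X e z _ (z :: l) ws (z :: b :: Q ++ ws ++ P ++ [:: a]) (F1 ++ F2) NEk) => //.
- exact: uniq_others_cat.
- by rewrite inE eqxx.
- by rewrite El EG E; solve_perm.
- have eg : path e z (F1 ++ (g0 :: G') ++ F2 ++ [:: z]).
    by move: cl; rewrite El EG /= rcons_cat /= rcons_cat cats1.
  have eg2 : path e g0 G'.
    by move: eg; rewrite cat_path /= cat_path => /and3P[_ _ /andP[]].
  have eg3 : sorted e (P ++ a :: b :: Q) by rewrite -E.
  move: ew1 ew2 pw az zb eg3; rewrite Ews -lE -hE.
  by case: P {E hE} => [|h P] /=; case/lastP: Q {lE} => [|Q lq]; solve_cycle.
- by apply: contraL ul => zF; rewrite El /= !mem_cat; move: zF; rewrite mem_cat => /orP[] ->;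
    rewrite ?orbT.
- by rewrite size_cat sF /= addnS addnC.
Qed.

(** Positions on the cycle without z, read modulo its length. *)
Definition cnth i := nth z l (i %% size l).
Notation c := cnth.

Lemma leq_r_size : r <= size l. Proof. by rewrite -countA count_size. Qed.
Lemma size_gt0 : 0 < size l. Proof. by apply: leq_trans leq_r_size; apply: leq_trans r4. Qed.

Lemma cnth_mem i : c i \in l. Proof. by rewrite mem_nth // ltn_mod size_gt0. Qed.
Lemma cnth_mod i j : i = j %[mod size l] -> c i = c j.
Proof. by rewrite /c => ->. Qed.
Lemma cnth_inj i j : c i = c j -> i = j %[mod size l].
Proof.
move/eqP; rewrite nth_uniq ?ltn_mod ?size_gt0 //; first by move/eqP.
by case/andP: ul.
Qed.

Lemma gap k i d ws w1 ws' : ws = w1 :: ws' -> uniq ws ->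
  {subset ws <= others} -> path e w1 ws' ->
  no_cycle e z k -> k + d = (size l + size ws).+2 -> 0 < d ->
  d <= size l -> size l + d < r.*2 ->
  e (c i) w1 -> ~~ e (last w1 ws') (c (i + d)).
Proof.
move=> Ews uws sub pw NEk kd d0 dL small.
have -> : c (i + d) = c (i %% size l + d) by apply: cnth_mod; rewrite modnDml.
have -> : c i = c (i %% size l) by apply: cnth_mod; rewrite modn_mod.
have: i %% size l < size l by rewrite ltn_mod size_gt0.
move: (i %% size l) => {}i iL; rewrite {1}/c modn_small //.
have [it|it] := ltnP (i + d) (size l).
  rewrite /c modn_small // => ei.
  rewrite -[i + d]addn0 -nth_drop nth0.
  apply: (@gap_ahead k (take i.+1 l) (take d.-1 (drop i.+1 l)) (drop (i + d) l) ws w1 ws') =>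
    //.
  - rewrite -{1}(cat_take_drop i.+1 l) -{1}(cat_take_drop d.-1 (drop i.+1 l)) drop_drop.
    by have -> : d.-1 + i.+1 = i + d by move: d0; clear; lia.
  - by rewrite -size_eq0 size_takel.
  - by rewrite -size_eq0 size_drop -lt0n subn_gt0.
  - by rewrite size_takel ?size_drop; move: it d0 kd; move: (size l) (size ws); clear; lia.
  - by rewrite (take_nth z) // last_rcons.
(* From here on, the bypassed vertices reach beyond the end of l. *)
pose j := i + d - size l.
have -> : c (i + d) = nth z l j.
  rewrite /c; have -> : i + d = j + size l by rewrite /j subnK.
  by rewrite modnDr modn_small // /j; move: iL dL d0; clear; lia.
move=> ei; have ji : j <= i by rewrite /j; move: iL dL d0; clear; lia.
pose G := take (i.+1 - j) (drop j l).
have hG : head z G = nth z l j.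
  by rewrite -nth0 nth_take ?subn_gt0 // nth_drop addn0.
have sG : size G = i.+1 - j.
  by rewrite size_takel // size_drop leq_sub2r.
have lG : last z G = nth z l i.
  by rewrite (last_nth z) sG subSn //= /G nth_take ?subSn // nth_drop subnKC.
have sF : size (take j l) + size (drop i.+1 l) = d.-1.
  by rewrite size_takel ?size_drop /j; move: iL it d0 dL; move: (size l); clear; lia.
rewrite -hG; apply: (@gap_around k (take j l) G (drop i.+1 l) ws w1 ws') => //.
- rewrite /G -{1}(cat_take_drop j l) -{1}(cat_take_drop (i.+1 - j) (drop j l)) drop_drop
    subnK //.
  exact: leqW.
- by rewrite -size_eq0 sG -lt0n subn_gt0.
- by rewrite sF; move: kd d0; move: (size l) (size ws); clear; lia.
- by rewrite sF; move: small d0; move: (size l); clear; lia.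
- by rewrite lG.
Qed.

Lemma cnth_index x : x \in l -> forall i, exists2 j, i <= j & x = c j.
Proof.
move=> xl i; exists (index x l + i * size l).
  by apply: leq_trans (leq_addl _ _); rewrite leq_pmulr // size_gt0.
by rewrite /c addnC modnMDl modn_small ?index_mem // nth_index.
Qed.

Lemma no_insert_others w i : w \in others -> e (c i) w -> ~~ e w (c i.+1).
Proof.
move=> wo ew; rewrite -addn1; apply: (@gap _ i 1 [:: w] w [::] _ _ _ _ NE) => //.
- by move=> x; rewrite inE => /eqP ->.
- exact: size_gt0.
- by move: m2; clear; lia.
Qed.

Lemma others_adj w x : w \in others -> x \in l -> ~~ mt w x -> e w x (+) e x w.
Proof.
case/others_far => wz wl _ _ xl; apply: (c_adj H wz (mem_l_neq_z xl)).
by apply: contraNneq wl => ->.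
Qed.

Lemma unmated_mono w : w \in others -> ~~ has (mt w) l ->
  all (e^~ w) l \/ all (e w) l.
Proof.
move=> wo nm; have nmx x : x \in l -> ~~ mt w x by move=> xl; apply: (hasPn nm).
have [/hasP[x xl xw]|nh] := boolP (has (e^~ w) l); last first.
  right; apply/allP => x xl; have := others_adj wo xl (nmx x xl).
  by rewrite (negPf (hasPn nh x xl)) addbF.
left; have [i _ Ex] := cnth_index xl 0.
have up j : i <= j -> e (c j) w.
  move/subnKC <-; elim: (j - i) => [|k IH]; first by rewrite addn0 -Ex.
  rewrite addnS; have := others_adj wo (cnth_mem (i + k).+1) (nmx _ (cnth_mem _)).
  by rewrite (negPf (no_insert_others wo IH)).
by apply/allP => y /cnth_index/(_ i)[j ij ->]; apply: up.
Qed.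

(** A far vertex has in-degree at most r, with equality for p only. *)
Lemma all_in_eq_p w : w \in others -> all (e^~ w) l ->
  [/\ w = p, size l = r & ~~ has (e^~ w) others].
Proof.
move=> wo; rewrite all_count => /eqP cw.
case/others_far: (wo) => wz _ zw wz'.
have := c_in H wz; rewrite wz' (countX (e^~ w)) (negPf zw) cw /=.
have szl := leq_r_size; case: eqP => /= [->|_] E.
  split=> //; first by move: E szl; clear; lia.
  by rewrite has_count -leqNgt; move: E szl; clear; lia.
by move: E szl; clear; lia.
Qed.

(** If p is beaten by all of the cycle, then A and B both consist of the cycle
    without z, q is not on it and beats all of it, and the path from p to q
    replaces one vertex. *)
Lemma unmated_all_in w : w \in others -> ~~ has (mt w) l -> all (e^~ w) l -> False.
Proof.
move=> wo nm aw; have [wp szl nh] := all_in_eq_p wo aw; subst w.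
have aA : all (e z) l by rewrite all_count countA szl.
have qo : q \in others.
  rewrite othersP inE negb_or (c_qz H) /=; apply/negP => /(allP aA).
  by rewrite (negPf (c_ezq H)).
have nmq : ~~ has (mt q) l by apply/hasPn => x _; apply: (c_mtq H).
have [|aq] := unmated_mono qo nmq.
  by case/(all_in_eq_p qo) => E _ _; have := c_pq H; rewrite E eqxx.
have pq : e p q.
  apply: (arc_of_no_arc H (c_qz H) (c_pz H)); first by rewrite eq_sym (c_pq H).
    exact: (c_mtq H).
  exact: (hasPn nh).
have : ~~ e q (c 2).
  apply: (@gap _ 0 2 [:: p; q] p [:: q] _ _ _ _ NE) => //.
  - by rewrite /= inE (c_pq H).
  - by move=> x; rewrite !inE => /orP[] /eqP ->.
  - by rewrite /= pq.
  - by rewrite szl; move: r4; clear; lia.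
  - by rewrite szl; move: r4; clear; lia.
  - by rewrite (allP aw) // cnth_mem.
by rewrite (allP aq) // cnth_mem.
Qed.
End Bypass.

Section Mated.
Variables (X : finType) (e : rel X) (z p q : X) (mt : rel X) (r : nat).
Hypothesis H : contracted e z p q mt r.
Hypothesis r4 : 4 <= r.
Variable l : seq X.
Hypothesis ul : uniq (z :: l).
Hypothesis cl : cycle e (z :: l).
Hypothesis near_in : forall x, e z x || e x z -> x \in l.
Hypothesis NE : no_cycle e z (size l).+2.
Hypothesis m2 : size l + 2 <= r.*2.

(** A vertex without a mate on the cycle is joined to all of the cycle and
    cannot be inserted, so the cycle beats it or is beaten by it. *)
Lemma others_mated w : w \in others z l -> has (mt w) l.
Proof.
move=> wo; apply/negPn/negP => nm.
have [aw|aw] := unmated_mono H r4 ul cl near_in NE m2 wo nm.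
  exact: (unmated_all_in H r4 ul cl near_in NE m2 wo nm aw).
apply: (@unmated_all_in _ _ _ _ _ _ _ (contracted_dual H) r4 (rev l) _ _ _ _ _ w).
- by rewrite /= mem_rev rev_uniq.
- exact: cycle_rev1.
- by move=> x; rewrite orbC mem_rev; apply: near_in.
- by rewrite size_rev; apply: no_cycle_dual.
- by rewrite size_rev.
- by move: wo; rewrite !mem_filter !inE mem_rev.
- by rewrite has_rev.
- by rewrite all_rev.
Qed.
End Mated.

(** * Out-neighbourhoods on the cycle as intervals *)

Lemma nth_rot_mod (T : Type) (x0 : T) (l : seq T) g j : g < size l -> j < size l ->
  nth x0 (rot g l) j = nth x0 l ((g + j) %% size l).
Proof.
move=> gl jl; rewrite /rot nth_cat size_drop nth_drop.
have [lt|ge] := ltnP j (size l - g).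
  by rewrite modn_small //; move: lt gl; clear; lia.
rewrite nth_take; last by move: ge gl jl; clear; lia.
have -> : g + j = (j - (size l - g)) + size l by move: ge gl; clear; lia.
by rewrite modnDr modn_small //; move: ge gl jl; clear; lia.
Qed.

Section CyclicRuns.
Variables (X : finType) (e : rel X) (z p q : X) (mt : rel X) (r : nat).
Hypothesis H : contracted e z p q mt r.
Hypothesis r4 : 4 <= r.
Variable l : seq X.
Hypothesis ul : uniq (z :: l).
Hypothesis cl : cycle e (z :: l).
Hypothesis near_in : forall x, e z x || e x z -> x \in l.
Hypothesis NE : no_cycle e z (size l).+2.
Hypothesis m2 : size l + 2 <= r.*2.
Notation c := (cnth z l).
Notation W := (others z l).

(** On the cycle without z, w beats exactly the n vertices that follow its mate. *)
Definition run_at w g n := [/\ mt w (c g),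
  forall j, 0 < j <= n -> e w (c (g + j)) &
  forall j, n < j < size l -> e (c (g + j)) w].

Lemma run_at_exists w : w \in W -> exists g, run_at w g (count (e w) l).
Proof.
move=> wo; have /hasP[s sl mws] := others_mated H r4 ul cl near_in NE m2 wo.
pose g := index s l; have gl : g < size l by rewrite index_mem.
have Ecg j : j < size l -> nth z (rot g l) j = c (g + j) by exact: nth_rot_mod.
have [rho Er] : exists rho, rot g l = s :: rho.
  exists (drop g.+1 l ++ take g l).
  by rewrite /rot (drop_nth z gl) nth_index.
have sz : size l = (size rho).+1 by rewrite -(size_rot g) Er.
have perm : perm_eq l (s :: rho) by rewrite -Er perm_sym perm_rot.
have ur : uniq (s :: rho) by rewrite -Er rot_uniq; case/andP: ul.
have [A a b B E|| L [U [EL aL aU]]] := @run_split X e w rho.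
- have szA : (size A).+2 < size l by rewrite sz E size_cat /=; solve_sizes.
  have := Ecg (size A).+1 (ltnW szA); have := Ecg (size A).+2 szA.
  rewrite Er E /= !nth_cat ltnn subnn ltnNge leqnSn subSnn /= => -> ->.
  by rewrite [g + (size A).+2]addnS; apply: (no_insert_others H r4 ul cl near_in NE m2).
- apply/allP => t tr; have tl : t \in l by rewrite (perm_mem perm) inE tr orbT.
  have nm : ~~ mt w t.
    by apply: contraTN ur => mwt; rewrite (c_mt_inj H mws mwt) /= tr.
  by have := others_adj H ul near_in wo tl nm; case: (e w t).
have cnt : count (e w) l = size L.
  rewrite (permP perm) /= (negPf (c_mt_e H mws)) EL count_cat.
  move: aL; rewrite all_count => /eqP ->.
  suff /eqP -> : count (e w) U == 0 by rewrite addn0.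
  by rewrite -leqn0 leqNgt -has_count; apply/hasPn => y /(allP aU)/andP[].
exists g; rewrite cnt; split.
- have := Ecg 0; rewrite Er addn0 => <- //=; exact: leq_ltn_trans gl.
- case=> // j /= jL; rewrite -Ecg; last first.
    by rewrite sz EL size_cat; move: jL; solve_sizes.
  by rewrite Er EL /= nth_cat jL; apply: (allP aL); rewrite mem_nth.
- case=> // j /andP[jL jl]; rewrite -Ecg // Er EL /= nth_cat ltnNge -ltnS jL /=.
  have /(allP aU)/andP[] // : nth z U (j - size L) \in U.
  by rewrite mem_nth //; move: jL jl; rewrite sz EL size_cat; solve_sizes.
Qed.

(** The vertices of the cycle that are d steps after an in-neighbour of w are
    not out-neighbours of y.  This confines the out-interval of y, and k is
    the distance from the mate of w to that of y. *)
Lemma run_shift w y g n g' n' d : run_at w g n -> run_at y g' n' -> 0 < d -> 0 < n' ->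
  n' < size l -> n.+1 < size l ->
  (forall i, e (c i) w -> ~~ e y (c (i + d))) ->
  exists k, [/\ d <= k.+1, g' = g + k %[mod size l] & k + n' <= n + d].
Proof.
move=> [_ ow iw] [_ oy iy] d0 n'0 n'l nl nw.
have l0 : 0 < size l by apply: leq_ltn_trans nl.
(* The distance from g to g' is taken between d - 1 and d - 1 plus the length;
   multiplying by the length minus one negates modulo the length. *)
pose j0 := (g' + (g + d.-1) * (size l).-1) %% size l.
have j0l : j0 < size l by rewrite ltn_mod.
pose k := d.-1 + j0.
have gk : g' = g + k %[mod size l].
  have -> : g + k = g + d.-1 + j0 by rewrite /k addnA.
  by rewrite /j0 modnDmr addnCA -mulnS prednK // addnC modnMDl.
have Ec i j : i = j %[mod size l] -> c i = c j by exact: cnth_mod.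
have cg i : c (g' + i) = c (g + k + i) by apply: Ec; rewrite -modnDml gk modnDml.
have jn : j0 <= n.
  rewrite leqNgt; apply/negP => nj.
  have := nw _ (iw j0 _); rewrite nj j0l => /(_ isT).
  have -> : g + j0 + d = g + k + 1 by rewrite /k; move: d0; clear; lia.
  by rewrite -cg oy.
exists k; split=> //; first by rewrite /k; move: d0; clear; lia.
rewrite leqNgt; apply/negP => big.
pose i := n + d.+1 - k.
have ki : k + i = n.+1 + d by rewrite /i /k; move: d0 jn; clear; lia.
have i0 : 0 < i <= n' by move: big ki d0 jn; rewrite /k; clear; lia.
have := nw _ (iw n.+1 _); rewrite leqnn nl => /(_ isT).
by rewrite -addnA -ki addnA -cg oy.
Qed.

Lemma others_nonmates w : w \in W -> forall t, t \in W -> ~~ mt w t.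
Proof.
move=> wo t to; have /hasP[s sl mws] := others_mated H r4 ul cl near_in NE m2 wo.
apply: contraTN to => mwt; rewrite -(c_mt_inj H mws mwt) othersP inE sl orbT //.
Qed.

Lemma others_tournament w x : w \in W -> x \in W -> w != x -> e w x (+) e x w.
Proof.
move=> wo xo wx; have [wz _ _ _] := others_far near_in wo.
have [xz _ _ _] := others_far near_in xo.
exact: (c_adj H wz xz wx (others_nonmates wo xo)).
Qed.

Lemma others_neq_pq w : w \in W -> (w != p) && (w != q).
Proof.
move=> wo; have /hasP[s sl mws] := others_mated H r4 ul cl near_in NE m2 wo.
by apply/andP; split; apply: contraTneq mws => ->; [apply: (c_mtp H) | apply: (c_mtq H)].
Qed.

Lemma outdegree_others w : w \in W -> (count (e w) l + count (e w) W).+1 = r.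
Proof.
move=> wo; have [wz _ zw wz'] := others_far near_in wo.
have /andP[wp wq] := others_neq_pq wo.
have := c_out H wz; rewrite (negPf zw) wq (countX ul (e w)) (negPf wz') /=.
by rewrite add0n addn1.
Qed.

Lemma indegree_others w : w \in W -> (count (e^~ w) l + count (e^~ w) W).+1 = r.
Proof.
move=> wo; have [wz _ zw wz'] := others_far near_in wo.
have /andP[wp wq] := others_neq_pq wo.
have := c_in H wz; rewrite (negPf wz') wp (countX ul (e^~ w)) /= (negPf zw) /=.
by rewrite add0n addn1.
Qed.

Lemma q_in_l : q \in l.
Proof.
apply/negPn/negP => ql; have qo : q \in W by rewrite othersP inE negb_or (c_qz H).
by have := others_neq_pq qo; rewrite eqxx andbF.
Qed.

Lemma ltn_r_size : r < size l.
Proof.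
rewrite ltn_neqAle (leq_r_size H ul near_in) andbT; apply/negP => /eqP E.
have : all (e z) l by rewrite all_count (countA H ul near_in) E.
by move/allP/(_ q q_in_l); rewrite (negPf (c_ezq H)).
Qed.

Lemma outdegree_others_lt w : w \in W -> count (e w) W < size W.
Proof.
move=> wo; have := count_predC (e w) W => <-.
rewrite -[X in X < _]addn0 ltn_add2l -has_count; apply/hasP; exists w => //=.
exact: (c_irr H).
Qed.

Lemma run_length_bounds w : w \in W ->
  [/\ 0 < count (e w) l, count (e w) l < size l & (count (e w) l).+1 < size l].
Proof.
move=> wo; have := outdegree_others wo; have := outdegree_others_lt wo;
  have := size_others H ul; have := ltn_r_size.
move: (count _ l) (count _ W) (size l) (size W) r4; clear; move=> a b c d.
by move=> r4 h1 h2 h3 h4; split; lia.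
Qed.

(** The path from w to x has two vertices; d - 1 vertices are bypassed, so the
    length reached is k. *)
Lemma arc_shift w x g g' k d : w \in W -> x \in W -> e w x ->
  no_cycle e z k -> k + d = (size l).+4 -> 0 < d ->
  d <= size l -> size l + d < r.*2 ->
  run_at w g (count (e w) l) -> run_at x g' (count (e x) l) ->
  exists k, [/\ d <= k.+1, g' = g + k %[mod size l] &
    k + count (e x) l <= count (e w) l + d].
Proof.
move=> wo xo wx NEk kd d0 dl small rw rx.
have [_ _ nw] := run_length_bounds wo; have [x0 xl _] := run_length_bounds xo.
apply: (run_shift rw rx) => // i ew;
  apply: (@gap _ _ _ _ _ _ _ H r4 l ul cl near_in k i d [:: w; x] w [:: x]) => //=.
- rewrite inE andbT; apply: contraTneq wx => ->; apply: (c_irr H).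
- by move=> t; rewrite !inE => /orP[] /eqP ->.
- by rewrite wx.
- by rewrite kd addn2.
Qed.
End CyclicRuns.

(** * Shifts of intervals along arcs between far vertices *)

Lemma count_le (T : eqType) (f g : pred T) s :
  {in s, forall x, f x -> g x} -> count f s <= count g s.
Proof.
elim: s => //= x s IH sub; apply: leq_add.
  by case: (f x) (sub x (mem_head _ _)) => // ->.
by apply: IH => y ys; apply: sub; rewrite inE ys orbT.
Qed.

Lemma count_lt (T : eqType) (f g : pred T) s u :
  {in s, forall x, f x -> g x} -> u \in s -> g u -> ~~ f u -> count f s < count g s.
Proof.
elim: s => //= x s IH sub; have subs : {in s, forall x, f x -> g x}.
  by move=> y ys; apply: sub; rewrite inE ys orbT.
rewrite inE => /predU1P[->|us] gu nfu.
  by rewrite gu (negPf nfu) ltnS; apply: count_le.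
rewrite -addnS; apply: leq_add; last exact: IH.
by case: (f x) (sub x (mem_head _ _)) => // ->.
Qed.

Section Shifts.
Variables (X : finType) (e : rel X) (z p q : X) (mt : rel X) (r : nat).
Hypothesis H : contracted e z p q mt r.
Hypothesis r4 : 4 <= r.
Variable l : seq X.
Hypothesis ul : uniq (z :: l).
Hypothesis cl : cycle e (z :: l).
Hypothesis near_in : forall x, e z x || e x z -> x \in l.
Hypothesis NE : no_cycle e z (size l).+2.
Hypothesis m2 : size l + 2 <= r.*2.
Notation c := (cnth z l).
Notation W := (others z l).
Notation n w := (count (e w) l).
Notation run_at := (run_at e z mt l).

Lemma same_mate w x g g' n1 n2 : run_at w g n1 -> run_at x g' n2 ->
  g' = g %[mod size l] -> w = x.
Proof.
move=> [mw _ _] [mx _ _] E; have Ec : c g' = c g by exact: cnth_mod.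
rewrite Ec in mx; apply: (c_mt_inj H (x := c g)); by rewrite (c_mtC H).
Qed.

(** With cycles two longer excluded as well, no vertex need be bypassed (d = 1).
    Then the out-interval of x has the same size as its room, and w and x
    would have the same mate. *)
Lemma two_others_false w x : perm_eq W [:: w; x] -> e w x ->
  no_cycle e z (size l).+3 -> False.
Proof.
move=> pW wx NE3; have wo : w \in W by rewrite (perm_mem pW) inE eqxx.
have xo : x \in W by rewrite (perm_mem pW) !inE eqxx orbT.
have sW : size W = 2 by rewrite (perm_size pW).
have [wz _ _ _] := others_far near_in wo; have [xz _ _ _] := others_far near_in xo.
have xw := arc_asym H wz xz wx.
have [g rw] := run_at_exists H r4 ul cl near_in NE m2 wo.
have [g' rx] := run_at_exists H r4 ul cl near_in NE m2 xo.
have Lr : size l + 2 = r.*2 by rewrite -sW; exact: (size_others H ul).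
have l0 : 0 < size l by exact: (size_gt0 H r4 ul near_in).
have kd : (size l).+3 + 1 = (size l).+4 by rewrite addn1.
have sm : size l + 1 < r.*2 by rewrite -Lr addn1 addn2.
have [k [_ Eg le]] :=
  arc_shift H r4 ul cl near_in NE m2 wo xo wx NE3 kd isT l0 sm rw rx.
have := outdegree_others H r4 ul cl near_in NE m2 wo;
  have := outdegree_others H r4 ul cl near_in NE m2 xo.
rewrite !(permP pW) /= wx (negPf xw) !(negPf (c_irr H _)) => Ex Ew.
have k0 : k = 0 by move: Ex Ew le; clear; lia.
have := same_mate rw rx; rewrite Eg k0 addn0 => /(_ erefl) E.
by move: wx; rewrite E (negPf (c_irr H _)).
Qed.

Hypothesis m3 : size l + 2 < r.*2.

Lemma arc_shift2 w x g g' : w \in W -> x \in W -> e w x ->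
  run_at w g (n w) -> run_at x g' (n x) ->
  exists k, [/\ 0 < k, g' = g + k %[mod size l] & k + n x <= n w + 2].
Proof.
move=> wo xo wx rw rx; have lr := ltn_r_size H r4 ul cl near_in NE m2.
have kd : (size l).+2 + 2 = (size l).+4 by rewrite addn2.
have l2 : 2 <= size l by move: lr r4; clear; lia.
have [k [k1 ? ?]] := arc_shift H r4 ul cl near_in NE m2 wo xo wx NE kd isT l2 m3 rw rx.
by exists k.
Qed.

(** There is only one vertex of the cycle without z that is not in A, and it is
    q. *)
Lemma near_all_but_q t : size l = r.+1 -> t \in l -> t != q -> e z t.
Proof.
move=> Lr tl tq; have ql := q_in_l H r4 ul cl near_in NE m2.
apply/negPn/negP => nzt.
have : size [:: q; t] <= size [seq x <- l | ~~ e z x].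
  apply: uniq_leq_size; first by rewrite /= inE eq_sym tq.
  by move=> x; rewrite !inE mem_filter => /orP[] /eqP ->; rewrite ?(c_ezq H) ?nzt.
have := count_predC (e z) l; rewrite (countA H ul near_in) Lr size_filter.
have -> : count (predC (e z)) l = count (fun x => ~~ e z x) l by [].
by move=> E /=; move: E; move: (count _ l); clear; lia.
Qed.

Lemma near_all_but_p t : size l = r.+1 -> t \in l -> t != p -> e t z.
Proof.
move=> Lr tl tp; have pl : p \in l.
  apply/negPn/negP => pl; have po : p \in W by rewrite othersP inE negb_or (c_pz H).
  by have := others_neq_pq H r4 ul cl near_in NE m2 po; rewrite eqxx.
apply/negPn/negP => nzt.
have : size [:: p; t] <= size [seq x <- l | ~~ e x z].
  apply: uniq_leq_size; first by rewrite /= inE eq_sym tp.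
  by move=> x; rewrite !inE mem_filter => /orP[] /eqP ->; rewrite ?(c_epz H) ?nzt.
have := count_predC (e^~ z) l; rewrite (countB H ul near_in) Lr size_filter.
have -> : count (predC (e^~ z)) l = count (fun x => ~~ e x z) l by [].
by move=> E /=; move: E; move: (count _ l); clear; lia.
Qed.

(** Counted from the mate of w, the mates of w, x, y are at positions 0, 1 and
    3.  As r + 1 = 5, all vertices on the cycle but z and q are in A and all
    but z and p in B; this closes a 7-cycle. *)
Lemma five_configuration_false w x y g g1 g2 : r = 4 -> size l = 5 ->
  w \in W -> x \in W -> y \in W -> e w x -> uniq [:: w; x; y] ->
  run_at w g 2 -> run_at x g1 2 -> run_at y g2 2 ->
  g1 = g + 1 %[mod size l] -> g2 = g + 3 %[mod size l] -> False.
Proof.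
move=> rE L5 wo xo yo wx uW [mw ow iw] [mx ox ix] [my oy iy] E1 E2.
have Ec i j : i = j %[mod 5] -> c i = c j by rewrite -L5; apply: cnth_mod.
rewrite L5 in E1 E2.
have c1 i : c (g1 + i) = c (g + 1 + i) by apply: Ec; rewrite -modnDml E1 modnDml.
have c2 i : c (g2 + i) = c (g + 3 + i) by apply: Ec; rewrite -modnDml E2 modnDml.
have cD i j : c (g + i) = c (g + j) -> i = j %[mod 5].
  move/(cnth_inj H r4 ul near_in); rewrite L5 => /eqP.
  by rewrite eqn_modDl => /eqP.
have cl' i : c (g + i) \in l by exact: (cnth_mem H r4 ul near_in).
have E3 : c (g + 3) = c g2 by apply: Ec; rewrite E2.
have three : uniq [:: c (g + 3); c (g + 2); c (g + 0)].
  by rewrite /= !inE !negb_or !andbT; split_goal; apply/eqP => /cD.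
have ne_pq w0 t : mt w0 t -> (t != q) * (t != p).
  by move=> m; split; apply: contraTneq m => ->; rewrite (c_mtC H);
    [apply: (c_mtq H) | apply: (c_mtp H)].
have Lr : size l = r.+1 by rewrite rE.
have z3 : e z (c (g + 3)).
  by apply: near_all_but_q => //; rewrite E3 (ne_pq _ _ my).
have c0z : e (c (g + 0)) z.
  by apply: near_all_but_p => //; rewrite addn0 (ne_pq _ _ mw).
have e3w : e (c (g + 3)) w by apply: iw; rewrite L5.
have x2 : e x (c (g + 2)).
  by rewrite -[2]/(1 + 1) addnA -c1; apply: ox.
have y2 : e (c (g + 2)) y.
  have -> : c (g + 2) = c (g2 + 4).
    by rewrite c2; apply: Ec; rewrite -addnA -[3 + 4]/(2 + 5) addnA modnDr.
  by apply: iy; rewrite L5.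
have y0 : e y (c (g + 0)).
  have -> : c (g + 0) = c (g2 + 2).
    by rewrite c2; apply: Ec; rewrite -addnA -[3 + 2]/(0 + 5) addnA modnDr.
  exact: oy.
have := NE (D := [:: z; c (g + 3); w; x; c (g + 2); y; c (g + 0)]).
rewrite L5 inE eqxx /= => /(_ _ isT) E.
have : false; last by []; apply: E.
rewrite /ucycle /= z3 e3w wx x2 y2 y0 c0z /=.
have uall : uniq ([:: w; x; y] ++ z :: [:: c (g + 3); c (g + 2); c (g + 0)]).
  have sub t : t \in [:: z; c (g + 3); c (g + 2); c (g + 0)] -> t \in z :: l.
    by rewrite in_cons [t \in z :: l]in_cons => /predU1P[->|];
      rewrite ?eqxx // !inE => /or3P[] /eqP ->; rewrite cl' orbT.
  rewrite cat_uniq; apply/and3P; split=> //.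
    apply/hasPn => t /sub tl; apply: contraL tl => tw; rewrite -othersP.
    by move: tw; rewrite /= !inE => /or3P[] /eqP ->.
  rewrite cons_uniq three andbT; apply/negP => zt.
  have : z \in l by move: zt; rewrite !inE => /or3P[] /eqP ->.
  by move: ul => /= /andP[/negP].
suff pe : perm_eq [:: z; c (g + 3); w; x; c (g + 2); y; c (g + 0)]
  ([:: w; x; y] ++ z :: [:: c (g + 3); c (g + 2); c (g + 0)]).
  by rewrite -(perm_uniq pe) in uall.
by solve_perm.
Qed.

Lemma arc_neq w x : e w x -> w != x.
Proof. by apply: contraTneq => ->; apply: (c_irr H). Qed.

Lemma others_asym w x : w \in W -> x \in W -> e w x -> ~~ e x w.
Proof.
move=> wo xo; have [wz _ _ _] := others_far near_in wo.
have [xz _ _ _] := others_far near_in xo; exact: (arc_asym H wz xz).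
Qed.

(** Each arc shifts by at least one, and by at most two more than the difference
    of the interval lengths.  Round the triangle the lengths cancel, and the
    shifts add up to a multiple of the length L of the cycle without z that
    is at most 6; taking two arcs at once lowers this to 5 if at least four
    vertices are off the cycle.  As L > r, what remains is L = 5 and r = 4
    with three vertices off the cycle. *)
Lemma others_triangle_false w x y : w \in W -> x \in W -> y \in W ->
  e w x -> e x y -> e y w -> False.
Proof.
move=> wo xo yo wx xy yw.
have uW : uniq [:: w; x; y].
  by rewrite /= !inE negb_or (arc_neq wx) (arc_neq xy) eq_sym (arc_neq yw).
have uW' : uniq [:: x; y; w].
  by rewrite /= !inE negb_or (arc_neq xy) (arc_neq yw) eq_sym (arc_neq wx).
have uW'' : uniq [:: y; w; x].
  by rewrite /= !inE negb_or (arc_neq yw) (arc_neq wx) eq_sym (arc_neq xy).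
have [g rw] := run_at_exists H r4 ul cl near_in NE m2 wo.
have [g1 rx] := run_at_exists H r4 ul cl near_in NE m2 xo.
have [g2 ry] := run_at_exists H r4 ul cl near_in NE m2 yo.
have [k1 [k10 E1 le1]] := arc_shift2 wo xo wx rw rx.
have [k2 [k20 E2 le2]] := arc_shift2 xo yo xy rx ry.
have [k3 [k30 E3 le3]] := arc_shift2 yo wo yw ry rw.
have lr := ltn_r_size H r4 ul cl near_in NE m2.
have sum2 a b h : h = g + a %[mod size l] -> g = h + b %[mod size l] -> size l %| a + b.
  move=> F1 F2; rewrite /dvdn -(mod0n (size l)) -(eqn_modDl g) addn0.
  by rewrite eq_sym {1}F2 -modnDml F1 modnDml addnA.
have E12 : g2 = g + (k1 + k2) %[mod size l].
  by rewrite E2 -modnDml E1 modnDml addnA.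
have dv := sum2 _ _ _ E12 E3.
have [L5 rE] : size l = 5 /\ r = 4.
  have [small|big] := ltnP (size l + 3) r.*2.
    exfalso.
    have [k [k0 Ek lek]] : exists k, [/\ 3 <= k.+1, g2 = g + k %[mod size l] & k + n y <= n w
      + 3].
      have [_ _ nw] := run_length_bounds H r4 ul cl near_in NE m2 wo.
      have [y0 yl _] := run_length_bounds H r4 ul cl near_in NE m2 yo.
      apply: (run_shift rw ry) => // i ew.
      apply: (@gap _ _ _ _ _ _ _ H r4 l ul cl near_in _ i 3 [:: w; x; y] w [:: x;
        y] _ _ _ _ NE) => //=.
      - by move=> t; rewrite !inE => /or3P[] /eqP ->.
      - by rewrite wx xy.
      - by move: lr r4; clear; lia.
    have := sum2 _ _ _ Ek E3 => /dvdn_leq le.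
    have := le (leq_trans k30 (leq_addl _ _)).
    by move: lek le3 lr small r4 k0; move: (n y) (n w) (size l); clear; lia.
  have := dvdn_leq (leq_trans k30 (leq_addl _ _)) dv.
  move: le1 le2 le3 lr big m3 r4; move: (n x) (n y) (n w) (size l); clear.
  by move=> a b d L ? ? ? ? ? ? ? ?; split; lia.
have out1 t u v : t \in W -> u \in W -> v \in W -> e t u -> e u v -> e v t -> n t = 2.
  move=> to uo vo tu uv vt.
  have szW3 : size W = 3.
    by have := size_others H ul; rewrite L5 rE; case: (size W) => [|[|[|[|?]]]].
  have pW : perm_eq W [:: t; u; v].
    have un : uniq [:: t; u;
      v] by rewrite /= !inE negb_or (arc_neq tu) (arc_neq uv) eq_sym (arc_neq vt).
    rewrite perm_sym; apply: uniq_perm => //.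
      exact: filter_uniq (enum_uniq _).
    have sub : {subset [:: t; u; v] <= W} by move=> a; rewrite !inE => /or3P[] /eqP ->.
    by have [] := uniq_min_size un sub; rewrite ?szW3.
  have := outdegree_others H r4 ul cl near_in NE m2 to; rewrite rE (permP pW) /= tu.
  rewrite (negPf (c_irr H t)) (negPf (others_asym vo to vt)).
  by move: (n t); clear=> a; rewrite /=; lia.
have nw := out1 w x y wo xo yo wx xy yw.
have nx := out1 x y w xo yo wo xy yw wx.
have ny := out1 y w x yo wo xo yw wx xy.
rewrite nw in rw le1 le3; rewrite nx in rx le1 le2; rewrite ny in ry le2 le3.
rewrite L5 in dv.
have ksum : [\/ k1 = 1 /\ k2 + k3 = 4, k2 = 1 /\ k1 + k3 = 4 | k3 = 1 /\ k1 + k2 = 4].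
  move: k10 k20 k30 le1 le2 le3 dv; clear.
  move=> a0 b0 c0 h1 h2 h3 /dvdnP[j Ej].
  have [E|a1] := eqVneq k1 1; first by constructor 1; lia.
  have [E|b1] := eqVneq k2 1; first by constructor 2; lia.
  by constructor 3; lia.
case: ksum => -[k1E ks].
- apply: (five_configuration_false rE L5 wo xo yo wx uW rw rx ry); first by rewrite E1 k1E.
  by have -> : 3 = k1 + k2; [move: k1E ks le1 le2 le3; clear; lia | exact: E12].
- apply: (five_configuration_false rE L5 xo yo wo xy uW' rx ry rw); first by rewrite E2 k1E.
  by rewrite E3 -modnDml E2 modnDml -addnA; congr (_ %% _); move: k1E ks le1 le2 le3; clear;
    lia.
- apply: (five_configuration_false rE L5 yo wo xo yw uW'' ry rw rx); first by rewrite E3 k1E.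
  by rewrite E1 -modnDml E3 modnDml -addnA; congr (_ %% _); move: k1E ks le1 le2 le3; clear;
    lia.
Qed.

(** Without triangles, a vertex w with most out-neighbours off the cycle is a
    source there and one x with fewest is a sink.  Then w has r - 1
    in-neighbours and x has r - 1 out-neighbours on the cycle, and the shift
    from w to x has no room for both. *)
Lemma others_ge3_false : False.
Proof.
have szw := size_others H ul.
case EW: W szw => [|w0 W0] szw.
  by move: szw m3 => /=; rewrite addn0 => ->; clear; lia.
have w0o : w0 \in W by rewrite EW inE eqxx.
clear EW szw W0.
have [w wo wmax] := @arg_maxnP X w0 (mem W) (fun t => count (e t) W) w0o.
have [x xo xmin] := @arg_minnP X w0 (mem W) (fun t => count (e t) W) w0o.
have src y : y \in W -> y != w -> e w y.
  move=> yo yw; apply/negPn/negP => nwy.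
  have ey : e y w.
    by have := others_tournament H r4 ul cl near_in NE m2 yo wo yw; rewrite (negPf nwy) addbF.
  have : count (e y) W <= count (e w) W := wmax y yo.
  rewrite leqNgt => /negP; apply.
  apply: (count_lt (u := w)) => //; last exact: (c_irr H).
  move=> u uo wu; apply/negPn/negP => nyu.
  have yu : y != u by apply: contraNneq nwy => ->.
  have uy : e u y by have := others_tournament H r4 ul cl near_in NE m2 yo uo yu;
    rewrite (negPf nyu).
  exact: (others_triangle_false wo uo yo wu uy ey).
have snk y : y \in W -> y != x -> e y x.
  move=> yo yx; apply/negPn/negP => nyx.
  have ey : e x y.
    by have := others_tournament H r4 ul cl near_in NE m2 yo xo yx; rewrite (negPf nyx).
  have : count (e x) W <= count (e y) W := xmin y yo.
  rewrite leqNgt => /negP; apply.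
  apply: (count_lt (u := y)) => //; last exact: (c_irr H).
  move=> u uo yu; apply/negPn/negP => nxu.
  have xu : u != x by apply: contraNneq nyx => <-.
  have ux : e u x by have := others_tournament H r4 ul cl near_in NE m2 uo xo xu;
    rewrite (negPf nxu) addbF.
  exact: (others_triangle_false xo yo uo ey yu ux).
have inw : count (e^~ w) W = 0.
  apply/eqP; rewrite -leqn0 leqNgt -has_count; apply/hasPn => y yo.
  have [->|yw] := eqVneq y w; first exact: (c_irr H).
  exact: (others_asym wo yo (src y yo yw)).
have outx : count (e x) W = 0.
  apply/eqP; rewrite -leqn0 leqNgt -has_count; apply/hasPn => y yo.
  have [->|yw] := eqVneq y x; first exact: (c_irr H).
  exact: (others_asym yo xo (snk y yo yw)).
have iw := indegree_others H r4 ul cl near_in NE m2 wo;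
  have ox := outdegree_others H r4 ul cl near_in NE m2 xo.
have [g rw] := run_at_exists H r4 ul cl near_in NE m2 wo.
have [g1 rx] := run_at_exists H r4 ul cl near_in NE m2 xo.
have szw := size_others H ul.
have wx : e w x.
  have [E|xw] := eqVneq x w; last exact: src.
  have := indegree_others H r4 ul cl near_in NE m2 xo; rewrite -E in inw.
  have : size W <= 1.
    have : count (predC1 x) W <= count (e x) W.
      by apply: count_le => y yo yx; rewrite E; apply: src => //; rewrite -E.
    rewrite outx leqn0 => /eqP c0; have := count_predC (pred1 x) W.
    rewrite c0 addn0 => <-.
    by rewrite count_uniq_mem ?leq_b1 // filter_uniq ?enum_uniq.
  by move: szw m3; move: (size W) (size l); clear; lia.
have [k [k0 _ le]] := arc_shift2 wo xo wx rw rx.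
(* The inequality is strict because of the mate of w. *)
have tot : n w + count (e^~ w) l < size l.
  have [mw _ _] := rw.
  have gl : c g \in l by exact: (cnth_mem H r4 ul near_in).
  have -> : size l = count predT l by rewrite count_predT.
  have -> : n w + count (e^~ w) l = count (predU (e w) (e^~ w)) l.
    rewrite -count_predUI [X in _ + X](_ : _ = 0) ?addn0 //.
    apply/eqP; rewrite -leqn0 leqNgt -has_count; apply/hasPn => y yl.
    apply/negP => /andP[/= wy yw]; have [wz _ _ _] := others_far near_in wo.
    by have := arc_asym H wz (mem_l_neq_z ul yl) wy; rewrite yw.
  apply: (count_lt (u := c g)) => //=.
  by rewrite (negPf (c_mt_e H mw)) /= (c_mt_e H) // (c_mtC H).
by move: iw ox le tot m3 k0 szw; rewrite inw outx;
  move: (n w) (n x) (count _ l) (size l) (size W); clear; lia.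
Qed.
End Shifts.

(** * Cycle lengths through the contracted vertex *)

Section Base.
Variables (X : finType) (e : rel X) (z p q : X) (mt : rel X) (r : nat).
Hypothesis H : contracted e z p q mt r.
Hypothesis r4 : 4 <= r.

Lemma near_neq_z x : e z x || e x z -> x != z.
Proof. by apply: contraTneq => ->; rewrite orbb; apply: (c_irr H). Qed.

(** Nonadjacent vertices other than z are mates, and mates are unique. *)
Lemma independent_le2 (S : {set X}) : z \notin S ->
  {in S &, forall x y, ~~ e x y} -> #|S| <= 2.
Proof.
move=> zS ind; rewrite leqNgt; apply/negP => /card_gt2P[x [y [t [[xS yS tS]]]]].
case=> xy yt tx.
have nz u : u \in S -> u != z by move=> uS; apply: contraNneq zS => <-.
have mate u v : u \in S -> v \in S -> u != v -> mt u v.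
  move=> uS vS uv; apply/negPn/negP => nm.
  have := c_adj H (nz u uS) (nz v vS) uv nm.
  by rewrite (negPf (ind u v uS vS)) (negPf (ind v u vS uS)).
have := c_mt_inj H (mate x y xS yS xy) (mate x t xS tS _).
by rewrite eq_sym => /(_ tx) E; rewrite E eqxx in yt.
Qed.

(** Without arcs from A to B, a vertex of A not in B would be dominated by z and
    all of B; so A = B is a set without arcs. *)
Lemma no_cycle3_false : no_cycle e z 3 -> False.
Proof.
move=> NE; pose A := [set x | e z x]; pose B := [set x | e x z].
have cA : #|A| = r := c_outz H; have cB : #|B| = r := c_inz H.
have noarc a b : e z a -> e b z -> ~~ e a b.
  move=> za bz; apply/negP => ab.
  have az : a != z by apply: near_neq_z; rewrite za.
  have bz' : b != z by apply: near_neq_z; rewrite bz orbT.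
  have anb : a != b by apply: contraTneq ab => ->; apply: (c_irr H).
  have := NE [:: z; a; b]; rewrite inE eqxx /= => /(_ _ isT) E.
  have : false; last by []; apply: E.
  by rewrite /ucycle /= za ab bz !inE negb_or anb ![z == _]eq_sym az bz'.
have AB : A \subset B.
  apply/subsetP => a; rewrite !inE => za; apply/negPn/negP => naz.
  have az : a != z by apply: near_neq_z; rewrite za.
  have aB : a \notin B by rewrite inE.
  apply: (in_overfull_notB H (x := a) (S := z :: enum B)) => //.
  - rewrite /= !inE negb_or az enum_uniq !mem_enum aB inE.
    by rewrite (c_irr H).
  - rewrite /dominates /= za /=; apply/allP => b; rewrite mem_enum inE => bz.
    by rewrite (noarc a b za bz) near_neq_z ?orbT // bz orbT.
  - by rewrite /= -cardE cB.
have : #|A| <= 2.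
  apply: independent_le2; first by rewrite inE (c_irr H).
  by move=> x y xA /(subsetP AB); rewrite !inE in xA * => yz; apply: noarc.
by rewrite cA; move: r4; clear; lia.
Qed.

Definition unreached_in_two := [set x | (x != z) && ~~ [exists a, e z a && e a x]].

(** Let a and a' be in A but not in this set.  An arc from a' to a would let the
    set, z and a' all dominate a.  So A splits into two parts without arcs,
    each with at most two elements; the part outside the set is a pair of
    mates, and for one of them the mate is missing among the r + 1 vertices
    that dominate it. *)
Lemma no_cycle4_half : r <= #|unreached_in_two| -> False.
Proof.
move=> big; pose A := [set x | e z x]; have cA : #|A| = r := c_outz H.
have zX : z \notin unreached_in_two by rewrite inE eqxx.
have X1P x a : x \in unreached_in_two -> e z a -> ~~ e a x.
  rewrite inE => /andP[_ /existsPn /(_ a)] h za.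
  by apply: contra h => ax; rewrite za.
have I1 : #|A :&: unreached_in_two| <= 2.
  apply: independent_le2; first by rewrite !inE (negPf (c_irr H z)).
  by move=> x y; rewrite !in_setI => /andP[xA _] /andP[_ yX]; apply: X1P => //;
    rewrite inE in xA.
have ind a a2 : a \in A :\: unreached_in_two -> a2 \in A :\: unreached_in_two -> ~~ e a2 a.
  rewrite !in_setD => /andP[aX aA] /andP[aX2 aA2]; apply/negP => a2a.
  rewrite inE in aA; rewrite inE in aA2.
  have az : a != z by apply: near_neq_z; rewrite aA.
  have az2 : a2 != z by apply: near_neq_z; rewrite aA2.
  have aa2 : a != a2 by apply: contraTneq a2a => ->; apply: (c_irr H).
  apply: (in_overfull H (x := a) (S := [:: z, a2 & enum unreached_in_two])) => //.
  - rewrite /= !inE !mem_enum enum_uniq !negb_or az aa2 aX zX aX2 [z == _]eq_sym az2 //.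
  - rewrite /dominates /= aA a2a /=; apply/allP => x; rewrite mem_enum => xX.
    by rewrite (X1P x a xX aA) andbT; move: xX; rewrite inE => /andP[-> _]; rewrite orbT.
  - by rewrite /= -cardE.
have : 1 < #|A :\: unreached_in_two|.
  by have := cardsID unreached_in_two A; rewrite cA; move: I1 r4; move: #|_| #|_|; clear; lia.
case/card_gt1P => a [a2 [aD a2D aa2]].
move: (aD) (a2D); rewrite !in_setD => /andP[aX aA] /andP[aX2 aA2].
rewrite inE in aA; rewrite inE in aA2.
have az : a != z by apply: near_neq_z; rewrite aA.
have az2 : a2 != z by apply: near_neq_z; rewrite aA2.
have maa : mt a a2.
  apply/negPn/negP => nm; have := c_adj H az az2 aa2 nm.
  by rewrite (negPf (ind a a2 aD a2D)) (negPf (ind a2 a a2D aD)).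
have := dominated_bound H (x := a) (S := z :: enum unreached_in_two) az.
rewrite /= !inE !mem_enum enum_uniq negb_or az aX zX -cardE => /(_ isT).
have -> : mt a z || has (mt a) (enum unreached_in_two) = false.
  rewrite (c_mtC H) (negPf (c_mtz H a)); apply/negbTE/hasPn => x; rewrite mem_enum => xX.
  by apply/negP => /(c_mt_inj H maa) E; rewrite E xX in aX2.
rewrite andbF addn0 => h; move: big; rewrite leqNgt h //.
rewrite /dominates /= aA /=; apply/allP => x; rewrite mem_enum => xX.
by rewrite (X1P x a xX aA) andbT; move: xX; rewrite inE => /andP[-> _]; rewrite orbT.
Qed.
End Base.

Section Steps.
Variables (X : finType) (e : rel X) (z p q : X) (mt : rel X) (r : nat).
Hypothesis H : contracted e z p q mt r.
Hypothesis r4 : 4 <= r.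

(** Each vertex other than z is unreached from z in two steps, or does not reach
    z in two steps; one of the two sets has at least r elements. *)
Lemma no_cycle4_false : no_cycle e z 4 -> False.
Proof.
move=> NE; pose X2 := unreached_in_two (fun x y => e y x) z.
have cover : [set~ z] \subset unreached_in_two e z :|: X2.
  apply/subsetP => x; rewrite in_setC1 => xz; rewrite in_setU !inE xz /=.
  rewrite -negb_and; apply/negP => /andP[/existsP[a /andP[za ax]] /existsP[b /andP[bz xb]]].
  have az : a != z by apply: (near_neq_z H); rewrite za.
  have bz' : b != z by apply: (near_neq_z H); rewrite bz orbT.
  have anx : a != x by apply: contraTneq ax => ->; apply: (c_irr H).
  have xnb : x != b by apply: contraTneq xb => ->; apply: (c_irr H).
  have anb : a != b.
    by apply: contraTneq xb => <-; apply: (arc_asym H az xz ax).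
  have := NE [:: z; a; x; b]; rewrite inE eqxx /= => /(_ _ isT) E.
  have : false; last by []; apply: E.
  by rewrite /ucycle /= za ax xb bz !inE !negb_or anb anx xnb ![z == _]eq_sym az bz' xz.
have := subset_leq_card cover; rewrite cardsC1 (c_card H) /= => le.
have := leq_trans le (leq_card_setU _ _).
have [b1|s1] := leqP r #|unreached_in_two e z|; first by move=> _;
  exact: (no_cycle4_half H r4 b1).
have [b2|s2] := leqP r #|X2|; first by move=> _;
  exact: (no_cycle4_half (contracted_dual H) r4 b2).
by move: s1 s2; move: #|_| #|_|; clear; lia.
Qed.

(** Boolean, so that absence can be argued by contradiction and a minimal cycle
    can be chosen. *)
Definition has_cycle k := [exists t : k.-tuple X, ucycleb e t && (z \in t)].

Lemma has_cycleP k : reflect (exists C, [/\ ucycle e C, z \in C & size C = k]) (has_cycle k).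
Proof.
apply: (iffP existsP) => [[t /andP[ct zt]]|[C [cC zC sC]]].
  by exists t; rewrite size_tuple.
by exists (Tuple (introT eqP sC)); apply/andP.
Qed.

Lemma no_cycleP k : ~~ has_cycle k -> no_cycle e z k.
Proof.
move=> nh D cD zD; apply: contra nh => /eqP sD.
by apply/has_cycleP; exists D.
Qed.

Lemma minimal_cycle k : has_cycle k ->
  exists C, [/\ ucycle e C, z \in C, size C = k & far_minimal e z C].
Proof.
case/existsP => t0 h0.
have [t /andP[ct zt] tmin] := @arg_minnP _ t0 (fun t : k.-tuple X => ucycleb e t && (z \in t))
  (fun t : k.-tuple X => count (far e z) t) h0.
exists t; split=> //; first by rewrite size_tuple.
move=> D cD zD sD; rewrite size_tuple in sD.
by apply: (tmin (Tuple (introT eqP sD))); apply/andP.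
Qed.

(** With k = 2r - 1 two vertices are off the cycle, and one of the next two
    lengths occurs. *)
Lemma cycle_step k : 4 <= k -> has_cycle k ->
  (forall x, x != z -> e z x || e x z) /\ k <= r.*2 \/
  k.+1 <= r.*2 /\ (k.+1 = r.*2 -> ~~ has_cycle k.+2) ->
  has_cycle k.+1.
Proof.
move=> k4 hk Nm; case: (boolP (has_cycle k.+1)) => // /no_cycleP NE; exfalso.
have [C [cC zC sC mC]] := minimal_cycle hk.
have NEC : no_cycle e z (size C).+1 by rewrite sC.
have kC : 4 <= size C by rewrite sC.
have near : forall x, e z x || e x z -> x \in C.
  apply: (near_inside H r4 cC zC kC NEC mC).
  by case: Nm => [[N _]|[le _]]; [left | right; rewrite sC addn2 ltnS].
have [cc uC] := andP cC.
case: Nm => [[N le]|[le m2]].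
  have : size (enum X) <= size C.
    apply: uniq_leq_size => [|x _]; first exact: enum_uniq.
    by have [->//|xz] := eqVneq x z; apply/near/N.
  by rewrite -cardE (c_card H) sC; move: le; clear; lia.
have [i l El] := rot_to zC.
have cl : cycle e (z :: l) by rewrite -El rot_cycle.
have ul : uniq (z :: l) by rewrite -El rot_uniq.
have sl : k = (size l).+1 by rewrite -sC -(size_rot i) El.
have near_l x : e z x || e x z -> x \in l.
  move=> zx; have := near x zx; rewrite -(mem_rot i) El inE.
  by rewrite (negPf (near_neq_z H zx)).
rewrite sl in le m2 NE; have m2' : size l + 2 <= r.*2 by rewrite addn2; exact: le.
have [m3|m3] := ltnP (size l + 2) r.*2.
  exact: (others_ge3_false H r4 ul cl near_l NE m2' m3).
have Er : size l + 2 = r.*2 by apply/eqP; rewrite eqn_leq m2' m3.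
have NE3 : no_cycle e z (size l).+3 by apply/no_cycleP/m2; rewrite -Er addn2.
have sW : size (others z l) = 2.
  by apply/eqP; rewrite -(eqn_add2l (size l)) (size_others H ul) Er.
case EW: (others z l) sW => [|w [|x [|? ?]]] // _.
have wo : w \in others z l by rewrite EW inE eqxx.
have xo : x \in others z l by rewrite EW !inE eqxx orbT.
have wx : w != x.
  have : uniq (others z l) by rewrite filter_uniq ?enum_uniq.
  by rewrite EW /= inE andbT.
have pe1 : perm_eq (others z l) [:: w; x] by rewrite EW.
have pe2 : perm_eq (others z l) [:: x; w].
  by rewrite EW (perm_catC [:: w] [:: x]).
have := others_tournament H r4 ul cl near_l NE m2' wo xo wx.
case ewx: (e w x) => /=.
  by move=> _; apply: (two_others_false H r4 ul cl near_l NE m2' pe1 ewx NE3).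
by move=> exw; apply: (two_others_false H r4 ul cl near_l NE m2' pe2 exw NE3).
Qed.

Lemma cycles_all_near : (forall x, x != z -> e z x || e x z) ->
  forall k, 3 <= k <= r.*2.+1 -> has_cycle k.
Proof.
move=> N; elim=> // k IH /andP[k3 le]; move: k3; rewrite leq_eqVlt => /predU1P[<-|k3].
  by case: (boolP (has_cycle 3)) => // /no_cycleP /(no_cycle3_false H r4).
move: k3; rewrite ltnS leq_eqVlt => /predU1P[<-|k4].
  by case: (boolP (has_cycle 4)) => // /no_cycleP /no_cycle4_false.
by apply: cycle_step => //; [apply: IH; rewrite ltnW //= ltnW | left].
Qed.

Lemma cycles_low k : 3 <= k <= r.*2.-1 -> has_cycle k.
Proof.
elim: k => // k IH /andP[k3 le]; move: k3; rewrite leq_eqVlt => /predU1P[<-|k3].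
  by case: (boolP (has_cycle 3)) => // /no_cycleP /(no_cycle3_false H r4).
move: k3; rewrite ltnS leq_eqVlt => /predU1P[<-|k4].
  by case: (boolP (has_cycle 4)) => // /no_cycleP /no_cycle4_false.
apply: cycle_step => //; first by apply: IH; rewrite ltnW //= ltnW.
by right; split; [|move=> E]; move: le r4; try rewrite -E; clear; lia.
Qed.

Lemma cycles_top : has_cycle r.*2 || has_cycle r.*2.+1.
Proof.
have [//|/= n2] := boolP (has_cycle r.*2.+1); first by rewrite orbT.
rewrite orbF; have r2 : r.*2 = r.*2.-1.+1 by move: r4; clear; lia.
rewrite r2; apply: cycle_step.
- by move: r4; clear; lia.
- by apply: cycles_low; move: r4; clear; lia.
- by right; split=> [|_]; rewrite -r2.
Qed.
End Steps.

(** * Exhaustive search on eight vertices *)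

(** Membership by plain recursion, as the search evaluates it very often. *)
Fixpoint mem_nat (x : nat) (s : seq nat) : bool :=
  if s is y :: s' then (if eqn x y then true else mem_nat x s') else false.

(** Depth-first search for a path of n more vertices after x that avoids vis and
    ends with an arc to 0. *)
Fixpoint closing_path (adj : seq (seq nat)) n x vis : bool :=
  if n is n'.+1 then
    has (fun y => if mem_nat y vis then false else closing_path adj n' y (y :: vis)) (nth
      [::] adj x)
  else mem_nat 0 (nth [::] adj x).

Definition all_lengths adj :=
  all (fun n => closing_path adj n 2 [:: 2; 0]) [:: 2; 3; 4; 5; 6].

(** Runs through the orientations of the pairs prs in which no vertex exceeds
    the out-degrees and in-degrees still available, and tests each; adj
    lists the out-neighbours chosen so far. *)
Fixpoint orientations (prs : seq (nat * nat)) (outs ins : seq nat) (adj : seq (seq nat)) :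
  bool :=
  if prs is (i, j) :: prs' then
    let arc a b :=
      match nth 0 outs a, nth 0 ins b with
      | o.+1, d.+1 => orientations prs' (set_nth 0 outs a o) (set_nth 0 ins b d)
                        (set_nth [::] adj a (b :: nth [::] adj a))
      | _, _ => true
      end in
    if arc i j then arc j i else false
  else all_lengths adj.

(** The partite sets are {0,1}, {2,3}, {4,5} and {6,7}; the arc from 0 to 2 is
    given. *)
Definition pairs8 := [seq ij <- [seq (i, j) | i <- iota 0 8, j <- iota 0 8] |
  (ij.1 < ij.2) && (ij.1./2 != ij.2./2) && (ij != (0, 2))].

Definition search8 :=
  orientations pairs8 [:: 2; 3; 3; 3; 3; 3; 3; 3] [:: 3; 3; 2; 3; 3; 3; 3; 3]
    [:: [:: 2]; [::]; [::]; [::]; [::]; [::]; [::]; [::]].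

Lemma search8_true : search8. Proof. by vm_compute. Qed.

Lemma mem_natE x s : mem_nat x s = (x \in s).
Proof. by elim: s => //= y s ->; rewrite inE -eqnE; case: eqn. Qed.

Section SearchSound.
Variables (A : rel nat).

Definition sound_adj adj := forall i j, j \in nth [::] adj i -> (j < 8) && A i j.

Lemma closing_pathP adj n x vis : sound_adj adj -> closing_path adj n x vis ->
  exists p, [/\ size p = n, path A x p, uniq p, all (fun y => (y < 8) && (y \notin vis)) p
    & A (last x p) 0].
Proof.
move=> sa; elim: n x vis => [|n IH] x vis /=.
  by rewrite mem_natE => /sa/andP[_ x0]; exists [::].
case/hasP => y /sa/andP[y8 xy]; rewrite mem_natE; case: ifP => // /negbT yv.
case/IH => p [sp pp up ap lp]; exists (y :: p); split=> //=.
- by rewrite sp.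
- by rewrite xy.
- rewrite up andbT; apply/negP => yp; have /andP[_] := allP ap y yp.
  by rewrite inE eqxx.
- rewrite y8 yv /=; apply: sub_all ap => t /andP[->].
  by rewrite inE negb_or => /andP[_ ->].
Qed.

Definition winner (ij : nat * nat) := if A ij.1 ij.2 then ij.1 else ij.2.
Definition loser (ij : nat * nat) := if A ij.1 ij.2 then ij.2 else ij.1.

(** The search passes through the orientation A itself, since the available
    degrees never fall below those that A needs for the remaining pairs. *)
Lemma orientationsP prs outs ins adj :
  (forall ij, ij \in prs -> [&& ij.1 < 8, ij.2 < 8 & A ij.1 ij.2 || A ij.2 ij.1]) ->
  (forall k, count (fun ij => winner ij == k) prs <= nth 0 outs k) ->
  (forall k, count (fun ij => loser ij == k) prs <= nth 0 ins k) ->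
  sound_adj adj -> orientations prs outs ins adj ->
  exists2 adj', sound_adj adj' & all_lengths adj'.
Proof.
elim: prs outs ins adj => [|[i j] prs IH] outs ins adj prsP outsP insP sa.
  by move=> /= al; exists adj.
pose arc a b := match nth 0 outs a, nth 0 ins b with
  | o.+1, d.+1 => orientations prs (set_nth 0 outs a o) (set_nth 0 ins b d)
                    (set_nth [::] adj a (b :: nth [::] adj a))
  | _, _ => true
  end.
rewrite [orientations _ _ _ _](_ : _ = if arc i j then arc j i else false) //.
have one_arc a b : a < 8 -> b < 8 -> A a b -> winner (i, j) = a -> loser (i, j) = b ->
    arc a b -> exists2 adj', sound_adj adj' & all_lengths adj'.
  move=> a8 b8 Aab Ew El; rewrite /arc.
  have := outsP a; rewrite /= Ew eqxx add1n; case Eo: (nth 0 outs a) => [|o] // lo.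
  have := insP b; rewrite /= El eqxx add1n; case Ei: (nth 0 ins b) => [|d] // ld.
  apply: IH.
  - by move=> ij ijp; apply: prsP; rewrite inE ijp orbT.
  - move=> k; rewrite nth_set_nth /=; case: eqP => [->|_]; first exact: lo.
    by apply: leq_trans (outsP k); rewrite /= leq_addl.
  - move=> k; rewrite nth_set_nth /=; case: eqP => [->|_]; first exact: ld.
    by apply: leq_trans (insP k); rewrite /= leq_addl.
  - move=> x y; rewrite nth_set_nth /=; case: eqP => [->|_]; last exact: sa.
    by rewrite inE => /predU1P[->|/sa//]; rewrite b8.
have /and3P[/= i8 j8 Aij] := prsP (i, j) (mem_head _ _).
case: ifP => // hij hji.
have [aij|naij] := boolP (A i j).
  by apply: (one_arc i j); rewrite /winner /loser /= ?aij.
by apply: (one_arc j i); rewrite /winner /loser /= ?(negPf naij) //; move: Aij;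
  rewrite (negPf naij).
Qed.

Hypothesis A02 : A 0 2.
Hypothesis Atour : forall i j, i < 8 -> j < 8 -> i./2 != j./2 -> A i j = ~~ A j i.
Hypothesis Amate : forall i j, i < 8 -> j < 8 -> i./2 = j./2 -> A i j = false.
Hypothesis Aout : forall i, i < 8 -> count (A i) (iota 0 8) = 3.
Hypothesis Ain : forall i, i < 8 -> count (A^~ i) (iota 0 8) = 3.

Lemma ifTF (b : bool) : (if b then true else false) = b. Proof. by case: b. Qed.
Lemma ifFT (b : bool) : (if b then false else true) = ~~ b. Proof. by case: b. Qed.

Lemma pairs8P ij : ij \in pairs8 -> [&& ij.1 < 8, ij.2 < 8 & A ij.1 ij.2 || A ij.2 ij.1].
Proof.
have : all (fun ij => [&& ij.1 < 8, ij.2 < 8 & ij.1./2 != ij.2./2]) pairs8 by [].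
move=> /allP h /h /and3P[i8 j8 ne].
by rewrite i8 j8 (Atour i8 j8 ne); case: (A _ _).
Qed.

Lemma winnerE i j k : (winner (i, j) == k) = if A i j then i == k else j == k.
Proof. by rewrite /winner /=; case: ifP. Qed.
Lemma loserE i j k : (loser (i, j) == k) = if A i j then j == k else i == k.
Proof. by rewrite /loser /=; case: ifP. Qed.

Let mates :=
  (@Amate 0 0 isT isT erefl, @Amate 0 1 isT isT erefl, @Amate 1 0 isT isT
   erefl, @Amate 1 1 isT isT erefl, @Amate 2 2 isT isT erefl, @Amate 2 3 isT
   isT erefl, @Amate 3 2 isT isT erefl, @Amate 3 3 isT isT erefl, @Amate 4 4
   isT isT erefl, @Amate 4 5 isT isT erefl, @Amate 5 4 isT isT erefl, @Amate 5
   5 isT isT erefl, @Amate 6 6 isT isT erefl, @Amate 6 7 isT isT erefl, @Amate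
   7 6 isT isT erefl, @Amate 7 7 isT isT erefl).
Let flips :=
  (@Atour 2 0 isT isT isT, @Atour 3 0 isT isT isT, @Atour 4 0 isT isT isT,
   @Atour 5 0 isT isT isT, @Atour 6 0 isT isT isT, @Atour 7 0 isT isT isT,
   @Atour 2 1 isT isT isT, @Atour 3 1 isT isT isT, @Atour 4 1 isT isT isT,
   @Atour 5 1 isT isT isT, @Atour 6 1 isT isT isT, @Atour 7 1 isT isT isT,
   @Atour 4 2 isT isT isT, @Atour 5 2 isT isT isT, @Atour 6 2 isT isT isT,
   @Atour 7 2 isT isT isT, @Atour 4 3 isT isT isT, @Atour 5 3 isT isT isT,
   @Atour 6 3 isT isT isT, @Atour 7 3 isT isT isT, @Atour 6 4 isT isT isT,
   @Atour 7 4 isT isT isT, @Atour 6 5 isT isT isT, @Atour 7 5 isT isT isT).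

(** With all arcs written with increasing indices, the degree condition and the
    count are sums of the same truth values. *)
Lemma wins8 k : count (fun ij => winner ij == k) pairs8 <=
  nth 0 [:: 2; 3; 3; 3; 3; 3; 3; 3] k.
Proof.
case: (ltnP k 8) => k8; last first.
  rewrite leqNgt; apply/negP => h; have : has (fun ij => winner ij == k) pairs8.
    by rewrite has_count; apply: leq_ltn_trans h.
  case/hasP => ij /pairs8P /and3P[i8 j8 _] /eqP wk.
  by move: k8; rewrite -wk /winner; case: ifP => _; rewrite leqNgt ?i8 ?j8.
have := Aout k8; rewrite /= !winnerE.
case: k k8 => [|[|[|[|[|[|[|[|k]]]]]]]] // _;
  rewrite /= ?if_same ?ifTF ?ifFT !mates ?flips ?A02 /=;
  clear; lia.
Qed.

Lemma losses8 k : count (fun ij => loser ij == k) pairs8 <=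
  nth 0 [:: 3; 3; 2; 3; 3; 3; 3; 3] k.
Proof.
case: (ltnP k 8) => k8; last first.
  rewrite leqNgt; apply/negP => h; have : has (fun ij => loser ij == k) pairs8.
    by rewrite has_count; apply: leq_ltn_trans h.
  case/hasP => ij /pairs8P /and3P[i8 j8 _] /eqP wk.
  by move: k8; rewrite -wk /loser; case: ifP => _; rewrite leqNgt ?i8 ?j8.
have := Ain k8; rewrite /= !loserE.
case: k k8 => [|[|[|[|[|[|[|[|k]]]]]]]] // _;
  rewrite /= ?if_same ?ifTF ?ifFT !mates ?flips ?A02 /=;
  clear; lia.
Qed.

Lemma cycles8 n : 2 <= n <= 6 ->
  exists p, [/\ size p = n, path A 2 p, uniq p, all (fun y => (y < 8) && (y \notin [:: 2; 0])) p
    & A (last 2 p) 0].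
Proof.
move=> n26; have sa0 : sound_adj [:: [:: 2]; [::]; [::]; [::]; [::]; [::]; [::]; [::]].
  by move=> i j; do 9?[case: i => [|i]] => //=; rewrite ?nth_nil // inE => /eqP ->.
have [adj sa] := orientationsP pairs8P wins8 losses8 sa0 search8_true.
move=> /allP/(_ n) al; apply: (closing_pathP sa); apply: al.
by move: n n26 => [|[|[|[|[|[|[|n]]]]]]].
Qed.
End SearchSound.

(** * Contracting an arc of a multipartite tournament *)

Section Assembly.
Variables (V : finType) (c : nat) (P : {set {set V}}) (arc : rel V).
Hypothesis hT : multipartite_tournament c P arc.
Hypothesis hcard : forall A : {set V}, A \in P -> #|A| = 2.

Definition same x y := pblock P x == pblock P y.

Lemma sameC x y : same x y = same y x. Proof. exact: eq_sym. Qed.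

Lemma same_mem x y : same x y = (y \in pblock P x).
Proof.
case: hT => /and3P[/eqP covP tP _] _ _ _.
by rewrite /same eq_pblock // covP inE.
Qed.

Lemma card_V : #|V| = c.*2.
Proof.
case: hT => partP cP _ _; rewrite -cardsT (card_uniform_partition hcard partP) cP.
by rewrite muln2.
Qed.

Lemma mate_ex x : exists x', [/\ x' != x, same x x' &
  forall y, same x y -> y = x \/ y = x'].
Proof.
case: hT => /and3P[/eqP covP tP _] _ _ _.
have xb : x \in pblock P x by rewrite mem_pblock covP inE.
have bP : pblock P x \in P by rewrite pblock_mem // covP inE.
have : #|pblock P x :\ x| == 1.
  by have := cardsD1 x (pblock P x); rewrite hcard // xb add1n => -[<-].
case/cards1P => x' Ex'; have : x' \in pblock P x :\ x by rewrite Ex' inE.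
rewrite !inE => /andP[x'x x'b]; exists x'; split=> // [|y].
  by rewrite same_mem.
rewrite same_mem => yb; have [->|yx] := eqVneq y x; [by left|right].
by apply/eqP; rewrite -in_set1 -Ex' !inE yx.
Qed.

Lemma arc_flip x y : ~~ same x y -> arc x y = ~~ arc y x.
Proof. by case: hT => _ _ adj _ /adj; case: (arc x y); case: (arc y x). Qed.

Lemma arc_same x y : same x y -> arc x y = false.
Proof. by case: hT => _ _ _ na /eqP/na/negbTE. Qed.

Lemma arc_nsame x y : arc x y -> ~~ same x y.
Proof. by apply: contraTN => /arc_same ->. Qed.

Lemma same_refl x : same x x. Proof. exact: eqxx. Qed.
Lemma arc_irr x : arc x x = false. Proof. exact/arc_same/same_refl. Qed.

Variable r : nat.
Hypothesis hreg : regular_digraph r arc.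
Hypothesis cr : c = r.+1.

Variables (u v : V).
Hypothesis huv : arc u v.

Definition contraction := {x : V | x != v}.
(** In the contraction z stands for u where arcs enter and for v where they
    leave. *)
Definition tail_of (x : contraction) : V := if val x == u then v else val x.
Definition contraction_arc (x y : contraction) := arc (tail_of x) (val y).

Lemma u_neq_v : u != v. Proof. by apply: contraTneq huv => ->; rewrite arc_irr. Qed.
Definition contraction_z : contraction := exist _ u u_neq_v.
Definition contraction_mate (x y : contraction) :=
  [&& x != contraction_z, y != contraction_z, x != y & same (val x) (val y)].

Lemma neq_contraction_z (x : contraction) : (x != contraction_z) = (val x != u). Proof. by
  []. Qed.

Lemma tail_nz x : x != contraction_z -> tail_of x = val x.
Proof. by rewrite neq_contraction_z /tail_of => /negPf ->. Qed.

Lemma count_head (f : pred V) :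
  #|[set y : contraction | f (val y)]| + f v = #|[set w | f w]|.
Proof.
rewrite (cardsD1 v [set w | f w]) inE addnC; congr (_ + _).
rewrite -(card_imset _ val_inj); apply: eq_card => w; rewrite !inE.
apply/imsetP/andP => [[y]|[wv fw]].
  by rewrite inE => fy ->; split=> //; exact: (valP y).
by exists (exist _ w wv); rewrite ?inE.
Qed.

Lemma tail_inj : injective tail_of.
Proof.
move=> x y; rewrite /tail_of; case: eqP => [xu|_]; case: eqP => [yu|_] E.
- by apply: val_inj; rewrite xu yu.
- by case/eqP: (valP y).
- by case/eqP: (valP x).
- exact: val_inj.
Qed.

(** Contracted vertices, as origins of arcs, are the vertices other than u. *)
Lemma count_tail (f : pred V) :
  #|[set y : contraction | f (tail_of y)]| + f u = #|[set w | f w]|.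
Proof.
rewrite (cardsD1 u [set w | f w]) inE addnC; congr (_ + _).
rewrite -(card_imset _ tail_inj); apply: eq_card => w; rewrite !inE.
apply/imsetP/andP => [[y]|[wu fw]].
  rewrite inE => fy ->; split=> //; rewrite /tail_of; case: ifP => [_|/negbT //].
  by rewrite eq_sym u_neq_v.
have [E|wv] := eqVneq w v.
  by exists contraction_z; rewrite ?inE /tail_of /= eqxx -?E.
by exists (exist _ w wv); rewrite ?inE /tail_of /= (negPf wu).
Qed.

Lemma contraction_contracted : exists pp qq, contracted contraction_arc contraction_z pp qq
  contraction_mate r.
Proof.
have nuv : ~~ same u v := arc_nsame huv.
have [u' [u'u su uP]] := mate_ex u; have [v' [v'v sv vP]] := mate_ex v.
have u'v : u' != v by apply: contraNneq nuv => <-.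
pose pp : contraction := exist _ u' u'v; pose qq : contraction := exist _ v' v'v.
have v'u : v' != u by apply: contraNneq nuv => <-; rewrite sameC.
have outr x : #|[set w | arc x w]| = r by case: (hreg x).
have inr x : #|[set w | arc w x]| = r by case: (hreg x).
have zt : tail_of contraction_z = v by rewrite /tail_of /= eqxx.
exists pp, qq; split.
- move=> x; rewrite /contraction_arc /tail_of; case: eqP => [->|_]; last by rewrite arc_irr.
  by rewrite (arc_flip (x := v)) ?huv // sameC.
- by move=> x y; rewrite /contraction_mate sameC [y == x]eq_sym; rewrite !andbA;
    congr (_ && _ && _); rewrite andbC.
- by move=> x; rewrite /contraction_mate eqxx !andbF.
- move=> x y y' /and4P[_ _ xy sxy] /and4P[_ _ xy' sxy'].
  have [x' [_ _ xP]] := mate_ex (val x).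
  have [E|E] := xP _ sxy; first by rewrite (val_inj E) eqxx in xy.
  have [E'|E'] := xP _ sxy'; first by rewrite (val_inj E') eqxx in xy'.
  by apply: val_inj; rewrite E E'.
- by move=> x; rewrite /contraction_mate eqxx.
- move=> x; apply/negP => /and4P[_ xz px]; rewrite /= => s.
  have : same u (val x) by rewrite /same (eqP su).
  case/uP => E; first by case/eqP: xz; apply: val_inj.
  by case/eqP: px; apply: val_inj.
- move=> x; apply/negP => /and4P[_ xz px]; rewrite /= => s.
  have : same v (val x) by rewrite /same (eqP sv).
  case/vP => E; first by case/eqP: (valP x).
  by case/eqP: px; apply: val_inj.
- move=> x y xz yz xy nm; rewrite /contraction_arc !tail_nz //.
  have ns : ~~ same (val x) (val y) by apply: contra nm; rewrite /contraction_mate xz yz xy.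
  by rewrite (arc_flip ns); case: (arc _ _).
- by move=> x y /and4P[xz _ _ s]; rewrite /contraction_arc tail_nz // arc_same.
- by rewrite neq_contraction_z.
- by rewrite neq_contraction_z.
- apply/eqP => /(congr1 val) /= E; case/negP: nuv.
  by rewrite /same (eqP su) E -(eqP sv).
- by rewrite /contraction_arc tail_nz ?neq_contraction_z //= arc_same // sameC.
- by rewrite /contraction_arc zt arc_same.
- move=> x xz; rewrite -(outr (val x)) -(count_head (arc (val x))) /contraction_arc zt.
  congr (_ + _); first by apply: eq_card => y; rewrite !inE tail_nz.
  have [->|xq] := eqVneq x qq; first by rewrite andbF arc_same // sameC.
  rewrite andbT (@arc_flip (val x)) //; apply/negP; rewrite sameC => /vP[] E.
    by case/eqP: (valP x).
  by case/eqP: xq; apply: val_inj.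
- move=> x xz; rewrite -(inr (val x)) -(count_tail (arc^~ (val x))) /contraction_arc tail_nz //.
  congr (_ + _); have [->|xq] := eqVneq x pp; first by rewrite andbF arc_same.
  rewrite andbT /= (@arc_flip u) //; apply/negP => /uP[] E.
    by case/eqP: xz; apply: val_inj.
  by case/eqP: xq; apply: val_inj.
- have := count_head (arc v); rewrite outr arc_irr addn0 => <-.
  by apply: eq_card => y; rewrite !inE /contraction_arc zt.
- by have := count_tail (arc^~ u); rewrite inr /= arc_irr addn0 => <-.
- by rewrite card_sig cardC1 card_V cr.
Qed.

(** Opening the cycle at z and inserting the arc from u to v. *)
Lemma lift_cycle k : has_cycle contraction_arc contraction_z k ->
  exists2 s, cycle_through arc u v s & size s = k.+1.
Proof.
case/has_cycleP => D [/andP[cD uD] zD sD].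
have [i l El] := rot_to zD.
have cl : cycle contraction_arc (contraction_z :: l) by rewrite -El rot_cycle.
have ul : uniq (contraction_z :: l) by rewrite -El rot_uniq.
have sl : k = (size l).+1 by rewrite -sD -(size_rot i) El.
exists (u :: v :: map val l); last by rewrite /= size_map sl.
have hpath x p : path contraction_arc x p -> contraction_z \notin p -> path arc (tail_of x)
  (map val p).
  elim: p x => //= y p IH x /andP[xy py]; rewrite inE negb_or eq_sym => /andP[yz zp].
  by rewrite [arc _ _]xy -(tail_nz yz) IH.
split; last 2 first.
- by rewrite inE eqxx.
- by rewrite /next /= eqxx.
have zl : contraction_z \notin l by case/andP: ul.
have uvl : v \notin map val l.
  by apply/negP => /mapP[x _ E]; case/eqP: (valP x).
have uul : u \notin map val l.
  by rewrite -[u]/(val contraction_z) (mem_map val_inj).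
apply/andP; split; last first.
  rewrite /= inE negb_or u_neq_v uvl uul (map_inj_uniq val_inj).
  by case/andP: ul.
move: cl; rewrite /= rcons_path => /andP[pl ll]; rewrite huv /= rcons_path.
have := hpath _ _ pl zl; rewrite /tail_of /= eqxx => ->.
case/lastP: l ll zl {El ul sl uvl uul pl} => [|l x].
  by rewrite /contraction_arc /tail_of /= eqxx.
rewrite last_rcons map_rcons last_rcons mem_rcons inE negb_or eq_sym => h /andP[xz _].
by move: h; rewrite /contraction_arc tail_nz.
Qed.

End Assembly.

(** * Cycle lengths through an arc *)

Section Eight.
Variables (V : finType) (P : {set {set V}}) (arc : rel V).
Hypothesis hT : multipartite_tournament 4 P arc.
Hypothesis hcard : forall A : {set V}, A \in P -> #|A| = 2.
Hypothesis hreg : regular_digraph 3 arc.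
Notation same := (same P).

Definition same_closed (s : seq V) := forall x y, x \in s -> same x y -> y \in s.

(** Used to list the vertices of a tournament by partite sets. *)
Lemma add_block s a : uniq s -> same_closed s -> a \notin s ->
  exists a', [/\ same a a', uniq (s ++ [:: a; a']) & same_closed (s ++ [:: a; a'])].
Proof.
move=> us cs as'; have [a' [a'a saa aP]] := mate_ex hT hcard a.
exists a'; split=> //.
  rewrite cat_uniq us /= orbF negb_or as' inE eq_sym a'a !andbT /=.
  by apply: contra as' => /cs; apply; rewrite sameC.
move=> x y; rewrite !mem_cat !inE => /or3P[xs|/eqP->|/eqP->] xy.
- by rewrite (cs x).
- by case: (aP y xy) => ->; rewrite eqxx ?orbT.
- have : same a y by rewrite /same (eqP saa).
  by case/aP => ->; rewrite eqxx ?orbT.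
Qed.

Lemma new_vertex s : size s < 8 -> exists a : V, a \notin s.
Proof.
move=> s8; apply/existsP; rewrite -negb_forall; apply/negP => /forallP al.
have : size (enum V) <= size s by apply: uniq_leq_size (enum_uniq _) _ => x _.
by rewrite -cardE (card_V hT hcard) leqNgt s8.
Qed.

Variables u v : V.
Hypothesis huv : arc u v.

(** The vertices are listed by partite sets with u and v at positions 0 and 2,
    as the search expects. *)
Lemma eight_cycles n : 2 <= n <= 6 ->
  exists2 s, cycle_through arc u v s & size s = n.+2.
Proof.
move=> n26.
have nuv : ~~ same u v := arc_nsame hT huv.
have [|u' [suu uq1 cl1]] := @add_block [::] u isT _ isT; first by move=> x.
have v1 : v \notin [:: u; u'].
  rewrite !inE; apply: contra nuv => /orP[] /eqP ->; first exact: same_refl.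
  exact: suu.
have [v' [svv uq2 cl2]] := add_block uq1 cl1 v1.
have [a a2] := @new_vertex [:: u; u'; v; v'] isT.
have [a' [saa uq3 cl3]] := add_block uq2 cl2 a2.
have [b b3] := @new_vertex [:: u; u'; v; v'; a; a'] isT.
have [b' [sbb uq4 cl4]] := add_block uq3 cl3 b3.
rewrite /= in uq4; pose s8 := [:: u; u'; v; v'; a; a'; b; b'].
pose f := nth u s8; pose A := relpre f arc.
pose flip i := if odd i then i.-1 else i.+1.
have flipP i : i < 8 -> [/\ same (f i) (f (flip i)), flip i < 8 & (flip i)./2 = i./2].
  by do 8?[case: i => [|i] //]; move=> _; split; rewrite // /f /= // sameC.
have f_inj i j : i < 8 -> j < 8 -> f i = f j -> i = j.
  by move=> i8 j8 /eqP; rewrite nth_uniq // => /eqP.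
have flip_ne i : flip i != i by rewrite /flip; case: i => // i; case: ifP => _;
  rewrite neq_ltn ltnSn ?orbT.
have sameP i j : i < 8 -> j < 8 -> same (f i) (f j) = (i./2 == j./2).
  move=> i8 j8; have [s1 f8 h1] := flipP i i8; have [x [xi sx xP]] := mate_ex hT hcard (f i).
  have Ex : x = f (flip i).
    by case: (xP _ s1) => // /f_inj E; have := flip_ne i; rewrite E ?eqxx.
  apply/idP/eqP => [/xP[|]|E].
  - by move/f_inj => ->.
  - by rewrite Ex => /f_inj ->.
  have : j = i \/ j = flip i.
    by move: E; rewrite /flip; clear; case: ifP; lia.
  by case=> ->; [apply: same_refl | apply: s1].
have sE x : x \in s8.
  have : size (enum V) <= size s8 by rewrite -cardE (card_V hT hcard).
  move=> le; have [//|ns] := boolP (x \in s8).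
  have := @uniq_leq_size _ (x :: s8) (enum V); rewrite /= -/s8 ns uq4 => /(_ isT).
  by rewrite -cardE (card_V hT hcard) => /(_ _) h; have : 8 < 8 by apply: h => y;
    rewrite mem_enum.
have pe : perm_eq s8 (enum V).
  by apply: uniq_perm; rewrite ?enum_uniq // => x; rewrite sE mem_enum.
have ms : map f (iota 0 8) = s8 by [].
have cnt (g : pred V) : count (preim f g) (iota 0 8) = #|[set w | g w]|.
  rewrite -count_map ms (permP pe) cardE -size_filter; apply/perm_size/uniq_perm.
  - exact: filter_uniq (enum_uniq _).
  - exact: enum_uniq.
  - by move=> y; rewrite mem_enum mem_filter mem_enum in_set andbT.
have [||||| p [sp pp up ap lp]] := @cycles8 A _ _ _ _ _ n n26.
- exact: huv.
- move=> i j i8 j8 ne; apply: (arc_flip hT); by rewrite sameP.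
- by move=> i j i8 j8 E; apply: (arc_same hT); rewrite sameP // E.
- by move=> i i8; rewrite (cnt (arc (f i))); case: (hreg (f i)).
- by move=> i i8; rewrite (cnt (arc^~ (f i))); case: (hreg (f i)).
exists (u :: v :: map f p); last by rewrite /= size_map sp.
have np i : i < 8 -> i \notin p -> f i \notin map f p.
  move=> i8 ip; apply: contra ip => /mapP[j jp /f_inj -> //].
  by case/andP: (allP ap j jp).
have zp : 0 \notin p by apply/negP => /(allP ap).
have tp : 2 \notin p by apply/negP => /(allP ap).
split; last 2 first.
- by rewrite inE eqxx.
- by rewrite /next /= eqxx.
apply/andP; split.
  have pv : path arc (f 2) (map f p) by rewrite path_map; exact: pp.
  have lv : arc (last (f 2) (map f p)) (f 0) by rewrite last_map; exact: lp.
  by rewrite /= huv andTb rcons_path; apply/andP; split; [exact: pv | exact: lv].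
rewrite /= inE negb_or (u_neq_v hT huv) (np 0) // (np 2) //=.
rewrite map_inj_in_uniq // => i j /(allP ap)/andP[i8 _] /(allP ap)/andP[j8 _].
exact: f_inj.
Qed.
End Eight.

Theorem corollary1p4 (c : nat) (hc : 4 <= c) (V : finType)
    (P : {set {set V}}) (arc : rel V)
    (hT : multipartite_tournament c P arc)
    (hreg : regular_digraph (c - 1) arc)
    (hcard : forall A : {set V}, A \in P -> #|A| = 2)
    (u v : V) (huv : arc u v) :
  exists C : 'I_(2 * c - 3) -> seq V,
    (forall i, cycle_through arc u v (C i)) /\
    (forall i j, i != j -> size (C i) != size (C j)).
Proof.
suff [len [inj ex]] : exists len : 'I_(2 * c - 3) -> nat, injective len /\
    forall i, exists s, cycle_through arc u v s /\ size s = len i.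
  have [C CP] := fin_all_exists ex.
  exists C; split=> [i|i j ij]; first by case: (CP i).
  by case: (CP i) => _ ->; case: (CP j) => _ ->; apply: contra ij => /eqP/inj ->.
move: hc; rewrite leq_eqVlt => /predU1P[c4|c5].
  subst c; exists (fun i => i + 4); split=> [i j /addIn/val_inj //|[i i5]].
  have [|s cs ss] := @eight_cycles V P arc hT hcard hreg u v huv (i + 2).
    by move: i5; clear; rewrite /=; lia.
  by exists s; split; rewrite // ss -!addn2 -addnA.
set r := c - 1 in hreg; have cr : c = r.+1 by rewrite /r; move: c5; clear; lia.
have r4 : 4 <= r by rewrite /r; move: c5; clear; lia.
have [pp [qq H]] := contraction_contracted hT hcard hreg cr huv.
set e := @contraction_arc V arc u v in H; set z := contraction_z hT huv in H.
have lift k : has_cycle e z k -> exists s, cycle_through arc u v s /\ size s = k.+1.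
  by move=> hk; have [s] := @lift_cycle V c P arc hT u v huv k hk; exists s.
have bnd (i : 'I_(2 * c - 3)) : i < r.*2 - 1.
  by apply: leq_trans (ltn_ord i) _; rewrite cr; clear; lia.
have [N|] := boolP [forall x, (x != z) ==> (e z x || e x z)].
  exists (fun i => i + 4); split=> [i j /addIn/val_inj //|[i i5]] /=.
  rewrite addnS; apply: lift; apply: (cycles_all_near H r4).
    by move=> x xz; have /forallP/(_ x) := N; rewrite xz.
  by move: (bnd (Ordinal i5)) r4 => /=; clear; lia.
rewrite negb_forall => /existsP[x]; rewrite negb_imply => /andP[xz nx].
have two : has_cycle e z 2.
  pose A := [set y | e z y]; pose B := [set y | e y z].
  have : A :|: B \subset ~: [set z; x].
    apply/subsetP => y; rewrite !inE => yAB; rewrite negb_or (near_neq_z H yAB) /=.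
    by apply: contraTneq yAB => ->.
  move/subset_leq_card; have := cardsUI A B; have := cardsC [set z; x].
  rewrite (c_card H) cards2 eq_sym xz (c_outz H : #|A| = r) (c_inz H : #|B| = r) => h1 h2 h3.
  have : 0 < #|A :&: B|.
    by move: h1 h2 h3; move: #|A :&: B| #|A :|: B| #|~: [set z; x]|; clear; lia.
  case/card_gt0P => y; rewrite !inE => /andP[zy yz].
  apply/has_cycleP; exists [:: z; y]; split=> //; last by rewrite inE eqxx.
  by rewrite /ucycle /= zy yz inE eq_sym (near_neq_z H) ?zy.
have [K [K1 hK]] : exists K, r.*2 <= K /\ has_cycle e z K.
  by case/orP: (cycles_top H r4) => h; [exists r.*2 | exists r.*2.+1].
(* At z these are the lengths 2, ..., 2r - 1 and K. *)
exists (fun i : 'I_(2 * c - 3) => (if i < r.*2 - 2 then i + 2 else K).+1); split=> [i j|i].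
  move=> [] E; apply: val_inj; move: E (bnd i) (bnd j) K1 r4 => /=.
  move: {i j}(i : nat) (j : nat) => i j; move: (r) => r'; clear; by case: ifP; case: ifP; lia.
apply: lift; case: ifP => // i2; case i0: (i : nat) => [|i'] //.
apply: (cycles_low H r4); move: i2; rewrite i0; clear; lia.
Qed.
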